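(* Fix a dimension $d\geq 2$. Let $P_{d,\alpha,\beta}$ be the beta$^*$ set with parameters $\alpha>0$ and $\beta>d/2$ and let $R:=\sup\{r>0: r\overline{\mathbb{B}}^d\subset P_{d,\alpha,\beta}\}$. (i) If $\beta>(d+1)/2$ and $\alpha>0$ is arbitrary, or if $\beta=(d+1)/2$ and $\alpha>(d-1)\pi$, then almost surely $P_{d,\alpha,\beta}$ is a $d$-dimensional polytope with $R>1$. (ii) If $d/2<\beta<(d+1)/2$ and $\alpha>0$ is arbitrary, or if $\beta=(d+1)/2$ and $0<\alpha<(d-1)\pi$, then $$\mathbb{P}[P_{d,\alpha,\beta}\text{ is not a polytope and }R=1]>0.$$
   Context: $\mathbb{B}^d=\{x\in\mathbb{R}^d:\|x\|<1\}$ and $\overline{\mathbb{B}}^d$ is its closure. For $d\in\mathbb{N}$, $\alpha>0$, $\beta>d/2$, let $\zeta_{d,\alpha,\beta}$ be a Poisson process on $\mathbb{R}^d\setminus\overline{\mathbb{B}}^d$ whose intensity with respect to Lebesgue measure is $$f_{d,\alpha,\beta}(x)=\frac{\alpha\,\tilde c_{d,\beta}}{(\|x\|^2-1)^{\beta}},\quad \|x\|>1,\qquad \tilde c_{d,\beta}=\frac{\Gamma(\beta)}{\pi^{d/2}\Gamma(\beta-\frac d2)}.$$ The beta$^*$ set $P_{d,\alpha,\beta}$ is the closed convex hull of the atoms of $\zeta_{d,\alpha,\beta}$. A polytope is the convex hull of finitely many points. *)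

(* Defs.v *)
From HB Require Import structures.
From mathcomp Require Import all_boot all_order all_algebra.
From mathcomp Require Import all_classical all_reals all_analysis.
From mathcomp Require Import measurable_realfun.

Set Implicit Arguments.
Unset Strict Implicit.
Unset Printing Implicit Defensive.

Import Order.TTheory GRing.Theory Num.Theory.
Import numFieldNormedType.Exports.

Local Open Scope classical_set_scope.
Local Open Scope ring_scope.

Section rV_measurable.
Context {R : realType}.

Definition rV_cylinders n : set (set 'rV[R]_n) :=
  [set A | exists i, exists2 B : set R,
    measurable B & A = [set x : 'rV[R]_n | B (x 0 i)]].

Let rV_set0 n : <<s @rV_cylinders n >> set0.
Proof. exact: sigma_algebra0. Qed.

Let rV_setC n A : <<s @rV_cylinders n >> A -> <<s @rV_cylinders n >> (~` A).
Proof. exact: sigma_algebraC. Qed.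

Let rV_bigcup n (F : (set 'rV[R]_n)^nat) :
  (forall i, <<s @rV_cylinders n >> (F i)) ->
  <<s @rV_cylinders n >> (\bigcup_i F i).
Proof. exact: sigma_algebra_bigcup. Qed.

(* The product sigma-algebra, as the library has on n.-tuple R; it is the
   Borel sigma-algebra of R^n (rV_measurable_open below). *)
HB.instance Definition _ n :=
  @isMeasurable.Build default_measure_display 'rV[R]_n <<s @rV_cylinders n >>
    (@rV_set0 n) (@rV_setC n) (@rV_bigcup n).

Lemma measurable_rV_coord n (i : 'I_n) :
  measurable_fun setT (fun x : 'rV[R]_n => x 0 i).
Proof.
move=> _ B mB; rewrite setTI; apply: sub_sigma_algebra.
by exists i; exists B.
Qed.

Lemma measurable_fun_rVP d (T : measurableType d) n (f : T -> 'rV[R]_n) :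
  measurable_fun setT f <-> forall i, measurable_fun setT (fun t => f t 0 i).
Proof.
split=> [mf i|mf].
  exact: (measurableT_comp (measurable_rV_coord i) mf).
apply: (@measurability _ _ _ _ setT f (@rV_cylinders n)) => //.
by move=> _ [_ [i [B mB ->]] <-]; exact: mf.
Qed.

Lemma measurable_rV_box n (A : 'I_n -> set R) : (forall i, measurable (A i)) ->
  measurable [set x : 'rV[R]_n | forall i, A i (x 0 i)].
Proof.
move=> mA; rewrite (_ : mkset _ =
    \bigcap_(i in [set: 'I_n]) [set x : 'rV[R]_n | A i (x 0 i)]).
  apply: fin_bigcap_measurable => // i _.
  by rewrite -[X in measurable X]setTI; exact: measurable_rV_coord.
by apply/seteqP; split=> x /= Ax i => [_|]; exact: Ax.
Qed.

Lemma open_measurable_rV n (U : set 'rV[R]_n) : open U -> measurable U.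
Proof.
move=> oU; pose box (qk : 'rV[rat]_n * nat) : set 'rV[R]_n :=
  [set x | forall i, ball (ratr (qk.1 0 i) : R) (qk.2.+1%:R^-1) (x 0 i)].
have mbox qk : measurable (box qk).
  apply: (@measurable_rV_box _ (fun i => ball _ _)) => i.
  by apply: open_measurable; exact: ball_open.
pose F qk := if `[< box qk `<=` U >] then box qk else set0.
rewrite (_ : U = \bigcup_qk F qk).
  apply: countable_bigcupT_measurable => [|qk]; first exact: countableP.
  by rewrite /F; case: ifP.
apply/seteqP; split => [x Ux|x [qk _]]; last first.
  by rewrite /F; case: ifPn => // /asboolP; exact.
have /nbhs_ballP[e /= e0 xeU] := open_nbhs_nbhs (conj oU Ux).
have [k] : exists k : nat, 0 + k.+1%:R^-1 < e / 2.
  by apply: ltr_add_invr; rewrite divr_gt0.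
rewrite add0r => ke.
have /choice[q xq] i : exists q : rat, ball (ratr q : R) k.+1%:R^-1 (x 0 i).
  have /(_ _ (ball_open _ _))[|y [xy [q _ qy]]] :=
    @dense_rat R (ball (x 0 i) k.+1%:R^-1).
    by exists (x 0 i); exact: ballxx.
  by exists q; rewrite qy; exact: ball_sym.
exists (\row_i q i, k) => //; rewrite /F; case: asboolP => [_ i|[]].
  by rewrite mxE.
move=> y /= yq; apply: xeU; split => // i j; rewrite ord1.
rewrite (splitr e); apply: (@ball_triangle _ R (ratr (q j)) (x 0 j) (y 0 j)).
  by apply: ball_sym; apply: le_ball (xq j); exact: ltW.
by have := yq j; rewrite mxE; apply: le_ball; exact: ltW.
Qed.

Lemma rV_measurable_open n : measurable = <<s @open 'rV[R]_n >>.
Proof.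
apply/seteqP; split; last first.
  apply: smallest_sub; first exact: sigma_algebra_measurable.
  exact: open_measurable_rV.
apply: smallest_sub; first exact: smallest_sigma_algebra.
move=> _ [i [B mB ->]].
have : measurable_fun setT
    (fun x : g_sigma_algebraType (@open 'rV[R]_n) => (x : 'rV[R]_n) 0 i).
  apply: (measurability _ (RGenOpens.measurableE R)) => _ [_ [a [b ->]] <-].
  rewrite setTI; apply: sub_sigma_algebra.
  apply: (@open_comp _ _ (fun x : 'rV[R]_n => x 0 i)).
    by move=> x _; exact: coord_continuous.
  exact: interval_open.
by move=> /(_ measurableT _ mB); rewrite setTI.
Qed.

Definition rV_cons n (p : R * 'rV[R]_n) : 'rV[R]_n.+1 :=
  \row_i if unlift ord0 i is Some j then p.2 0 j else p.1.

Lemma measurable_rV_cons n : measurable_fun setT (@rV_cons n).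
Proof.
apply/measurable_fun_rVP => i.
under eq_fun do rewrite mxE; case: unliftP => [j _|_].
  rewrite (_ : (fun _ => _) = (fun x : 'rV[R]_n => x 0 j) \o snd)//.
  by apply: measurableT_comp => //; exact: measurable_rV_coord.
exact: measurable_fst.
Qed.

Definition rV_uncons n (x : 'rV[R]_n.+1) : R * 'rV[R]_n :=
  (x 0 ord0, \row_i x 0 (lift ord0 i)).

Lemma rV_consK n : cancel (@rV_cons n) (@rV_uncons n).
Proof.
move=> [a v]; rewrite /rV_uncons mxE unlift_none; congr (_, _).
by apply/rowP => i; rewrite !mxE liftK.
Qed.

Lemma measurable_rV_uncons n : measurable_fun setT (@rV_uncons n).
Proof.
apply: measurable_fun_pair; first exact: measurable_rV_coord.
apply/measurable_fun_rVP => i.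
under eq_fun do rewrite mxE.
exact: measurable_rV_coord.
Qed.

End rV_measurable.

Section lebesgue_rV.
Context {R : realType}.
Local Open Scope ereal_scope.

Section step.
Variables (n : nat) (mu : {sigma_finite_measure set 'rV[R]_n -> \bar R}).

Definition lebesgue_rV_step : set 'rV[R]_n.+1 -> \bar R :=
  pushforward (lebesgue_measure \x mu) (@rV_cons R n).

Let step0 : lebesgue_rV_step set0 = 0.
Proof. by rewrite /lebesgue_rV_step /pushforward preimage_set0 measure0. Qed.

Let step_ge0 A : 0 <= lebesgue_rV_step A.
Proof. exact: (measure_ge0 (lebesgue_measure \x mu)). Qed.

Let step_sigma_additive : semi_sigma_additive lebesgue_rV_step.
Proof.
move=> F mF tF mUF; rewrite /lebesgue_rV_step /pushforward preimage_bigcup.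
have mpre A : measurable A -> measurable (@rV_cons R n @^-1` A).
  by move=> mA; rewrite -[X in measurable X]setTI; exact: measurable_rV_cons.
apply: (measure_semi_sigma_additive (s := lebesgue_measure \x mu)).
- by move=> k; exact: mpre.
- apply/trivIsetP => /= i j _ _ ij; rewrite -preimage_setI.
  by move/trivIsetP : tF => /(_ _ _ _ _ ij) ->//; rewrite preimage_set0.
- by rewrite -preimage_bigcup; exact: mpre.
Qed.

HB.instance Definition _ := isMeasure.Build _ _ _ lebesgue_rV_step
  step0 step_ge0 step_sigma_additive.

Lemma lebesgue_rV_stepE (A : set (R * 'rV[R]_n)) :
  lebesgue_rV_step (@rV_uncons R n @^-1` A) = (lebesgue_measure \x mu) A.
Proof.
rewrite /lebesgue_rV_step /pushforward; congr (_ _).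
by apply/seteqP; split => p /=; rewrite rV_consK.
Qed.

Let step_sigma_finite : sigma_finite setT lebesgue_rV_step.
Proof.
have /sigma_finiteP[F [TF ndF Foo]] :=
  sigma_finiteT (@lebesgue_measure R : {sigma_finite_measure set _ -> \bar R}).
have /sigma_finiteP[G [TG ndG Goo]] := sigma_finiteT mu.
exists (fun k => @rV_uncons R n @^-1` (F k `*` G k)).
  apply/esym; rewrite -subTset => x _.
  have [i _ Fi] : (\bigcup_k F k) (x 0%R ord0) by rewrite -TF.
  have [j _ Gj] : (\bigcup_k G k) (\row_i x 0%R (lift ord0 i)) by rewrite -TG.
  exists (maxn i j) => //; split => /=.
  - by move: Fi; exact/subsetPset/ndF/leq_maxl.
  - by move: Gj; exact/subsetPset/ndG/leq_maxr.
move=> k; have [mF Fk] := Foo k; have [mG Gk] := Goo k; split.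
  rewrite -[X in measurable X]setTI; apply: measurable_rV_uncons => //.
  exact: measurableX.
rewrite lebesgue_rV_stepE product_measure1E//.
by rewrite lte_mul_pinfty// ge0_fin_numE.
Qed.

HB.instance Definition _ := Measure_isSigmaFinite.Build _ _ _ lebesgue_rV_step
  step_sigma_finite.

End step.

(* Iterated product of the one-dimensional Lebesgue measure; see lebesgue_rV_box
   for its values on boxes. *)
Fixpoint lebesgue_rV n : {sigma_finite_measure set 'rV[R]_n -> \bar R} :=
  if n is m.+1 then lebesgue_rV_step (lebesgue_rV m) else \d_(0%R : 'rV[R]_0).

Lemma lebesgue_rV_box n (A : 'I_n -> set R) : (forall i, measurable (A i)) ->
  lebesgue_rV n [set x | forall i, A i (x 0%R i)] =
  \prod_(i < n) lebesgue_measure (A i).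
Proof.
elim: n A => [|n IHn] A mA.
  by rewrite big_ord0 /= diracE mem_set// => -[].
rewrite big_ord_recl -IHn//= -product_measure1E//; last 2 first.
- exact: mA.
- exact: (@measurable_rV_box _ _ (fun i => A (lift ord0 i))).
rewrite -lebesgue_rV_stepE; congr (_ _); apply/seteqP; split=> x /= Ax.
  by split => //= i; rewrite mxE.
move=> i; have [j ->|->] := unliftP ord0 i; last exact: Ax.1.
by have := Ax.2 j; rewrite mxE.
Qed.

End lebesgue_rV.

Section convex_geometry.
Context {R : realType} {d : nat}.
Implicit Types A K : set 'rV[R]_d.

(* The library norm of 'rV[R]_d is the sup norm. *)
Definition enorm (x : 'rV[R]_d) : R := Num.sqrt (\sum_i x 0 i ^+ 2).

Definition unit_ball : set 'rV[R]_d := [set x | enorm x < 1].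

Definition conv_hull A : set 'rV[R]_d := smallest (@convex_set R 'rV[R]_d) A.

Definition closed_conv_hull A : set 'rV[R]_d := closure (conv_hull A).

Definition polytope K := exists2 S, finite_set S & K = conv_hull S.

Definition affine_set A :=
  forall x y t, A x -> A y -> A ((1 - t) *: x + t *: y).

Definition affine_hull A : set 'rV[R]_d := smallest affine_set A.

Definition has_dim A (k : nat) := exists x (V : {vspace 'rV[R]_d}),
  \dim V = k /\ affine_hull A = [set x + v | v in [set` V]].

(* Extended real: -oo if K contains no centred ball, +oo if K is the whole
   space. *)
Definition ball_radius K : \bar R :=
  ereal_sup [set r%:E | r in
    [set r : R | 0 < r /\ [set r *: x | x in closure unit_ball] `<=` K]].

End convex_geometry.

Section poisson_process.
Local Open Scope ereal_scope.
Context {R : realType} {dO : measure_display} {Omega : measurableType dO}.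
Variable P : probability Omega R.

Definition mutually_independent n (N : 'I_n -> Omega -> \bar R) :=
  forall A : 'I_n -> set (\bar R), (forall i, measurable (A i)) ->
  P [set w | forall i, A i (N i w)] = \prod_(i < n) P (N i @^-1` A i).

Context {dE : measure_display} {E : measurableType dE}.

(* Countable sums of Dirac masses, i.e. points x i with multiplicities k i. *)
Definition point_measure (m : {measure set E -> \bar R}) :=
  exists (x : nat -> E) (k : nat -> nat), forall B, measurable B ->
    m B = \sum_(0 <= i <oo) (k i)%:R%:E * \d_(x i) B.

Definition atoms (m : {measure set E -> \bar R}) : set E :=
  [set x | 0 < m [set x]].

(* Poisson process on the state space X with intensity measure lambda. When
   lambda B = 0, poisson_prob is the Dirac mass at 0, as it should be; its second
   argument is ignored by its definition. *)
Definition poisson_process (X : set E) (lambda : set E -> \bar R)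
    (zeta : Omega -> {measure set E -> \bar R}) :=
  [/\ forall w, point_measure (zeta w) /\ zeta w (~` X) = 0,
      forall B, measurable B -> measurable_fun setT (zeta ^~ B),
      forall B, measurable B -> B `<=` X -> lambda B < +oo ->
        forall k : nat, P [set w | zeta w B = k%:R%:E] =
          poisson_prob (fine (lambda B)) k [set k],
      forall B, measurable B -> B `<=` X -> lambda B = +oo ->
        P [set w | zeta w B = +oo] = 1 &
      forall n (B : 'I_n -> set E),
        (forall i, measurable (B i) /\ B i `<=` X) -> trivIset setT B ->
        mutually_independent (fun i w => zeta w (B i))].

End poisson_process.

Section beta_star.
Context {R : realType}.

Definition Gamma (z : R) : R :=
  \int[lebesgue_measure]_(t in `]0, +oo[) (t `^ (z - 1) * expR (- t)).

Definition beta_star_const d (beta : R) : R :=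
  Gamma beta / (pi `^ (d%:R / 2) * Gamma (beta - d%:R / 2)).

Definition beta_star_density d (alpha beta : R) (x : 'rV[R]_d) : R :=
  alpha * beta_star_const d beta / (enorm x ^+ 2 - 1) `^ beta.

Definition beta_star_intensity d (alpha beta : R) (B : set 'rV[R]_d) : \bar R :=
  (\int[lebesgue_rV d]_(x in B) (beta_star_density alpha beta x)%:E)%E.

Definition beta_star_process d (alpha beta : R) (dO : measure_display)
    (Omega : measurableType dO) (P : probability Omega R)
    (zeta : Omega -> {measure set 'rV[R]_d -> \bar R}) :=
  poisson_process P (~` closure unit_ball) (beta_star_intensity alpha beta) zeta.

Definition beta_star_set d (m : {measure set 'rV[R]_d -> \bar R}) :
  set 'rV[R]_d := closed_conv_hull (atoms m).

End beta_star.

(* Main.v *)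
(* Put s(x) = |x|^2 - 1, d = n + 1 and let u be a unit vector. In case (i) the cap
   {delta < s(x), 1 + k s(x) < <x, u>} has, for some k > 0, intensity at least
   a ln(1/delta) - C with a > n/2; in case (ii) the larger cap
   {delta < s(x), 1 - k s(x) < <x, u>} has intensity at most a ln(1/delta) + C
   with a < n/2. Indeed, rotating u to the first axis, the slice at height t > 1
   contributes, at the critical exponent, alpha / (2 pi (t - 1)).

   (i) A net of order m^n directions, with delta of order 1/m^2, misses an atom in
   one of its caps with probability at most of order m^n delta^a -> 0. If no cap
   is missed, the atoms reach beyond the sphere in every direction, and only
   finitely many atoms lie outside a ball of radius r > 1.

   (ii) By a second moment bound, with probability bounded below one of m^n caps
   is empty for infinitely many m. The cluster points u of these directions
   satisfy <x, u> <= 1 - k s(x) for all atoms x. On the other hand the intensity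
   is infinite near every point of the sphere, so the hull contains the unit ball.
   It contains no larger ball, as <y, u> <= 1 on it; and it meets <y, u> = 1 at u
   only, so as a polytope it would lie in a cone |y - u| <= c (1 - <y, u>), which
   does not contain the unit ball. *)
Require Import Defs.
From HB Require Import structures.
From mathcomp Require Import all_boot all_order all_algebra.
From mathcomp Require Import all_classical all_reals all_analysis.
From mathcomp Require Import measurable_realfun ring lra.

Set Implicit Arguments.
Unset Strict Implicit.
Unset Printing Implicit Defensive.

Import Order.TTheory GRing.Theory Num.Theory.
Import numFieldNormedType.Exports.

Local Open Scope classical_set_scope.
Local Open Scope ring_scope.

(** Rotating a cap needs the invariance of [lebesgue_rV], which is built coordinate by coordinate.
    Reflections suffice, since one of them exchanges two given unit vectors. They are linear
    involutions that fix the unit ball, so a uniqueness argument for invariant measures applies and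
    no determinant is computed. Slices are integrated only at the critical exponent b = n/2 + 1. For
    another beta, s^(-beta) is compared with s^(-b) on s <= s1; the cost is a factor s1^(b - beta),
    which a small s1 makes as large or as small as desired, so alpha matters only at beta = b. In
    (ii) the strict inequality a < n/2 serves the second moment. Two void events are correlated by
    the exponential of the intensity shared by their caps, at most a constant times (m/r)^(n g) at
    grid distance r with g < 1, and this has a bounded mean over an n-dimensional grid. A lower
    bound on the probability in (ii) by monotonicity requires a measurable event, hence the
    descriptions of hulls by countable rational data. In (i), coverings of the exceptional set by
    events of small probability are enough. *)

Definition image_measure d d' (T1 : measurableType d) (T2 : measurableType d')
    (R : realType) (m : {measure set T1 -> \bar R}) (f : T1 -> T2)
    (mf : measurable_fun setT f) : {measure set T2 -> \bar R} :=
  measure_function_pushforward__canonical__measure_function_Measure m mf.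

(** * Affine changes of variable on the line *)

Section lebesgue_affine.
Context {R : realType}.
Local Notation mu := (@lebesgue_measure R).

Let measurable_affine (a c : R) :
  measurable_fun setT (fun x : measurableTypeR R => (a * x + c : measurableTypeR R)).
Proof. by apply: measurable_funD => //; exact: measurable_funM. Qed.

(** The scaled pushforward agrees with Lebesgue measure on half-open intervals, which determine
    it. *)
Lemma lebesgue_measure_affine (a c : R) (A : set (measurableTypeR R)) :
  0 < a -> measurable A ->
  mu A = (a%:E * mu ((fun x : R => (a * x + c)%R) @^-1` A))%E.
Proof.
move=> a0 mA.
pose nu := mscale (NngNum (ltW a0)) (image_measure mu (measurable_affine a c)).
rewrite (lebesgue_measure_unique (mu := nu)) => //= _ [[p q] _ <-].
rewrite /nu /mscale/= /pushforward.
have -> : (fun x : R => a * x + c) @^-1` `]p, q] = `](p - c) / a, (q - c) / a]%classic.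
  apply/seteqP; split => x /=; rewrite !in_itv/= ltr_pdivrMr// ler_pdivlMr//;
    by rewrite ltrBlDr lerBrDr mulrC.
rewrite !lebesgue_measure_itv/= !lte_fin ltr_pM2r ?invr_gt0// ltrD2r.
case: ifPn => _; last by rewrite mule0.
rewrite -!EFinD -EFinM; congr EFin; field; exact: lt0r_neq0.
Qed.

Lemma ge0_integral_affine (a c : R) (f : R -> \bar R) : 0 < a ->
  measurable_fun setT f -> (forall x, 0 <= f x)%E ->
  (\int[mu]_x f x = a%:E * \int[mu]_x f (a * x + c)%R)%E.
Proof.
move=> a0 mf f0.
rewrite -[X in _ = (_ * X)%E](ge0_integral_pushforward (measurable_affine a c) mu
  (D := setT) (f := f))//.
rewrite -(@ge0_integral_mscale _ _ _ (image_measure mu (measurable_affine a c)) _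
  measurableT (NngNum (ltW a0)) f)//.
apply: eq_measure_integral => A mA _.
by rewrite /mscale/= /pushforward (lebesgue_measure_affine c a0).
Qed.

End lebesgue_affine.

(** * Translations and linear involutions of n-dimensional space *)

Section lebesgue_rV_invariance.
Context {R : realType}.
Local Open Scope ereal_scope.

Lemma ge0_integral_lebesgue_rVS n (f : 'rV[R]_n.+1 -> \bar R) :
  measurable_fun setT f -> (forall x, 0 <= f x) ->
  \int[lebesgue_rV n.+1]_x f x =
  \int[lebesgue_measure]_t \int[lebesgue_rV n]_y f (rV_cons (t, y)).
Proof.
move=> mf f0.
pose m : {measure set (measurableTypeR R * 'rV[R]_n) -> \bar R} := (lebesgue_measure \x lebesgue_rV n)%E.
have mc : measurable_fun setT (@rV_cons R n : measurableTypeR R * 'rV[R]_n -> 'rV[R]_n.+1).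
  exact: measurable_rV_cons.
transitivity (\int[pushforward m (@rV_cons R n)]_x f x); first by [].
rewrite (ge0_integral_pushforward mc m measurableT)//.
rewrite preimage_setT /m fubini_tonelli1//.
- exact: (measurableT_comp mf mc).
- by move=> x; exact: f0.
Qed.

Lemma measurable_rV_funD d (T : measurableType d) n (f g : T -> 'rV[R]_n) :
  measurable_fun setT f -> measurable_fun setT g ->
  measurable_fun setT (fun x => f x + g x)%R.
Proof.
move=> /measurable_fun_rVP mf /measurable_fun_rVP mg; apply/measurable_fun_rVP => i.
under eq_fun do rewrite mxE.
by apply: measurable_funD; [exact: mf|exact: mg].
Qed.

Lemma measurable_rV_opp n : measurable_fun setT (-%R : 'rV[R]_n -> 'rV[R]_n).
Proof.
apply/measurable_fun_rVP => i; under eq_fun do rewrite mxE.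
by apply: measurableT_comp => //; exact: measurable_rV_coord.
Qed.

Lemma measurable_rV_add n (v : 'rV[R]_n) : measurable_fun setT (fun x : 'rV[R]_n => x + v)%R.
Proof. exact: (measurable_rV_funD (f := id)). Qed.

(** By induction on the dimension: a shift acts separately on the first coordinate and on the
    others, so the shifted product measure has the right values on rectangles, and these determine
    it. *)
Lemma lebesgue_rV_shift n (v : 'rV[R]_n) (A : set 'rV[R]_n) : measurable A ->
  lebesgue_rV n ((fun x => x + v)%R @^-1` A) = lebesgue_rV n A.
Proof.
elim: n v A => [|n IHn] v A mA.
  by congr (_ _); apply/seteqP; split => x /=; rewrite [(x + v)%R]thinmx0 [x]thinmx0.
have mS : measurable_fun setT (fun p : measurableTypeR R * 'rV[R]_n =>
    ((p.1 + v 0 ord0)%R : measurableTypeR R, (p.2 + \row_i v 0 (lift ord0 i))%R)).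
  apply: measurable_fun_pair; first exact: measurable_funD.
  by apply: (measurableT_comp (@measurable_rV_add _ _)); exact: measurable_snd.
have mcA : measurable (@rV_cons R n @^-1` A).
  by rewrite -[X in measurable X]setTI; exact: measurable_rV_cons.
rewrite /= /lebesgue_rV_step /pushforward.
pose m : {measure set (measurableTypeR R * 'rV[R]_n) -> \bar R} :=
  (lebesgue_measure \x lebesgue_rV n)%E.
rewrite [RHS](product_measure_unique (m' := image_measure m mS)) => //=.
  congr (_ _); apply/seteqP; split => -[t y] /=;
  rewrite (_ : (_ + v)%R = rV_cons ((t + v 0 ord0)%R, (y + \row_i v 0 (lift ord0 i))%R))//;
  apply/rowP => i; rewrite !mxE; case: unliftP => [j ->|->]//; by rewrite !mxE.
move=> B C mB mC; rewrite /pushforward.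
have -> : (fun p : R * 'rV[R]_n => ((p.1 + v 0 ord0)%R,
    (p.2 + \row_i v 0 (lift ord0 i))%R)) @^-1` (B `*` C) =
    ((fun t : R => t + v 0 ord0)%R @^-1` B) `*`
    ((fun y : 'rV[R]_n => y + \row_i v 0 (lift ord0 i))%R @^-1` C) by [].
rewrite product_measure1E//; last 2 first.
- rewrite -[X in measurable X]setTI.
  by apply: (@measurable_funD _ _ _ _ id (cst (v 0%R ord0))).
- by rewrite -[X in measurable X]setTI; exact: measurable_rV_add.
congr (_ * _); last exact: IHn.
rewrite (lebesgue_measure_affine (v 0%R ord0) ltr01 mB) mul1e.
by congr (_ _); apply/seteqP; split => x /=; rewrite mul1r.
Qed.

Let integral_indicT n (A : set 'rV[R]_n) : measurable A ->
  \int[lebesgue_rV n]_x (\1_A x)%:E = lebesgue_rV n A.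
Proof. by move=> mA; rewrite integral_indic// setIT. Qed.

Lemma cavalieri n (S : set ('rV[R]_n * 'rV[R]_n)) : measurable S ->
  \int[lebesgue_rV n]_x lebesgue_rV n [set y | S (x, y)] =
  \int[lebesgue_rV n]_y lebesgue_rV n [set x | S (x, y)].
Proof.
move=> mS.
have mf : measurable_fun setT (fun z => (\1_S z : R)%:E).
  by apply/measurable_EFinP; exact: measurable_indic.
have H := @fubini_tonelli _ _ _ _ R (lebesgue_rV n) (lebesgue_rV n) _ mf
  (fun z => ltac:(by rewrite lee_fin)).
transitivity (\int[lebesgue_rV n]_x \int[lebesgue_rV n]_y (\1_S (x, y))%:E).
  apply: eq_integral => x _.
  have mSx : measurable [set y | S (x, y)].
    by have := measurable_xsection x mS; rewrite /xsection; under eq_set do rewrite in_setE.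
  by rewrite -[LHS]integral_indicT.
rewrite H; apply: eq_integral => y _.
have mSy : measurable [set x | S (x, y)].
  by have := measurable_ysection y mS; rewrite /ysection; under eq_set do rewrite in_setE.
by rewrite -[RHS]integral_indicT.
Qed.

(* Weil's uniqueness argument for Haar measures, applied to the image of
   Lebesgue measure under the linear involution [H]. *)
Lemma lebesgue_rV_involution n (H : 'rV[R]_n -> 'rV[R]_n) (A B : set 'rV[R]_n) :
  measurable_fun setT H -> involutive H -> {morph H : x y / (x - y)%R} ->
  measurable A -> measurable B ->
  lebesgue_rV n (H @^-1` A) * lebesgue_rV n B =
  lebesgue_rV n (H @^-1` B) * lebesgue_rV n (-%R @^-1` A).
Proof.
move=> mH HH HB mA mB.
have mpre C : measurable C -> measurable (H @^-1` C).
  by move=> mC; rewrite -[X in measurable X]setTI; exact: mH.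
have mN := @measurable_rV_opp n.
have mNA : measurable (-%R @^-1` A) by rewrite -[X in measurable X]setTI; exact: mN.
have mfst : measurable_fun setT (fun p : 'rV[R]_n * 'rV[R]_n => H p.1).
  exact: (measurableT_comp mH measurable_fst).
have cstM (C D : set 'rV[R]_n) : measurable D ->
    \int[lebesgue_rV n]_x lebesgue_rV n [set y | C y /\ D x] =
    lebesgue_rV n D * lebesgue_rV n C.
  move=> mD.
  under eq_integral => x _.
    rewrite (_ : lebesgue_rV n _ = lebesgue_rV n C * (\1_D x)%:E); last first.
      rewrite indicE; case: (asboolP (D x)) => Dx.
        rewrite mem_set// mule1; congr (_ _).
        by apply/seteqP; split => y /=; tauto.
      rewrite memNset// mule0 -[RHS](@measure0 _ _ _ (lebesgue_rV n)).
      by congr (_ _); apply/seteqP; split => y //= [].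
    over.
  rewrite ge0_integralZl//; last by apply/measurable_EFinP; exact: measurable_indic.
  by rewrite integral_indic// setIT muleC.
have mcst (C : set 'rV[R]_n) (Q : Prop) : measurable C -> measurable [set y | C y /\ Q].
  move=> mC; case: (asboolP Q) => q.
    by rewrite (_ : mkset _ = C)//; apply/seteqP; split => y /=; tauto.
  by rewrite (_ : mkset _ = set0)//; apply/seteqP; split => y //= [].
(* Integrating out the second variable of [S] first gives the left side, by the shift [H x].
   Integrating out the first variable first, the shift [- H y] turns [S] into [S'], because
   [H (x - H y) = H x - y]. *)
pose S := [set z : 'rV[R]_n * 'rV[R]_n | B (z.2 + H z.1)%R /\ A (H z.1)].
pose S' := [set z : 'rV[R]_n * 'rV[R]_n | A (H z.1 - z.2)%R /\ B (H z.1)].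
have mS : measurable S.
  apply: measurableI; rewrite -[X in measurable X]setTI.
  - by apply: (measurable_rV_funD measurable_snd mfst) => //.
  - exact: mfst.
have mS' : measurable S'.
  apply: measurableI; rewrite -[X in measurable X]setTI; last exact: mfst.
  exact: (measurable_rV_funD mfst (measurableT_comp mN measurable_snd)).
have H0 : H 0%R = 0%R by rewrite -[in LHS](subrr 0%R) HB subrr.
have HN x : H (- x)%R = (- H x)%R by rewrite -[in LHS](sub0r x) HB H0 sub0r.
transitivity (\int[lebesgue_rV n]_x lebesgue_rV n [set y | S (x, y)]).
  rewrite -cstM//; last exact: mpre.
  apply: eq_integral => x _.
  by rewrite -(lebesgue_rV_shift (H x))//; exact: mcst.
rewrite cavalieri//.
transitivity (\int[lebesgue_rV n]_y lebesgue_rV n [set x | S' (x, y)]).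
  apply: eq_integral => y _.
  rewrite -(lebesgue_rV_shift (- H y))//; last first.
    by have := measurable_ysection y mS; rewrite /ysection; under eq_set do rewrite in_setE.
  congr (_ _); apply/seteqP; split => x /=.
    by rewrite /S/= HB HH addrCA subrr addr0 => -[].
  by rewrite /S'/= /S/= HB HH addrCA subrr addr0 => -[].
rewrite -cavalieri// -cstM//; last exact: mpre.
apply: eq_integral => x _.
rewrite -(lebesgue_rV_shift (- H x) (mcst _ (B (H x)) mNA)).
by congr (_ _); apply/seteqP; split => y /=; rewrite opprB.
Qed.

End lebesgue_rV_invariance.

(** * Euclidean structure *)

Section euclidean.
Context {R : realType} {n : nat}.
Implicit Types (x y z u v : 'rV[R]_n) (a : R).

Definition dotp x y : R := \sum_i x 0 i * y 0 i.

Lemma dotpC x y : dotp x y = dotp y x.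
Proof. by apply: eq_bigr => i _; rewrite mulrC. Qed.

Lemma dotpDl x y z : dotp (x + y) z = dotp x z + dotp y z.
Proof. by rewrite -big_split; apply: eq_bigr => i _; rewrite mxE mulrDl. Qed.

Lemma dotpZl a x y : dotp (a *: x) y = a * dotp x y.
Proof. by rewrite mulr_sumr; apply: eq_bigr => i _; rewrite mxE mulrA. Qed.

Lemma dotpNl x y : dotp (- x) y = - dotp x y.
Proof. by rewrite -scaleN1r dotpZl mulN1r. Qed.

Lemma dotpBl x y z : dotp (x - y) z = dotp x z - dotp y z.
Proof. by rewrite dotpDl dotpNl. Qed.

Lemma dotpDr x y z : dotp x (y + z) = dotp x y + dotp x z.
Proof. by rewrite dotpC dotpDl !(dotpC x). Qed.

Lemma dotpZr a x y : dotp x (a *: y) = a * dotp x y.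
Proof. by rewrite dotpC dotpZl dotpC. Qed.

Lemma dotpBr x y z : dotp x (y - z) = dotp x y - dotp x z.
Proof. by rewrite dotpC dotpBl !(dotpC x). Qed.

Lemma dotp0l x : dotp 0 x = 0.
Proof. by rewrite -(scale0r x) dotpZl mul0r. Qed.

Lemma dotp_ge0 x : 0 <= dotp x x.
Proof. by apply: sumr_ge0 => i _; rewrite -expr2 sqr_ge0. Qed.

Lemma enorm_ge0 x : 0 <= enorm x. Proof. exact: sqrtr_ge0. Qed.

Lemma enorm_sqr x : enorm x ^+ 2 = dotp x x.
Proof. by rewrite sqr_sqrtr ?sumr_ge0// => i _; exact: sqr_ge0. Qed.

Lemma enormE x : enorm x = Num.sqrt (dotp x x). Proof. by []. Qed.

Lemma enorm0 : enorm (0 : 'rV[R]_n) = 0.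
Proof. by rewrite enormE dotp0l sqrtr0. Qed.

Lemma enormZ a x : enorm (a *: x) = `|a| * enorm x.
Proof. by rewrite !enormE dotpZl dotpZr mulrA -expr2 sqrtrM ?sqr_ge0// sqrtr_sqr. Qed.

Lemma enormN x : enorm (- x) = enorm x.
Proof. by rewrite -scaleN1r enormZ normrN1 mul1r. Qed.

Lemma enormB_sqr x y : enorm (x - y) ^+ 2 = enorm x ^+ 2 - dotp x y *+ 2 + enorm y ^+ 2.
Proof. by rewrite !enorm_sqr dotpBl !dotpBr (dotpC y x); ring. Qed.

Lemma enorm_eq0 x : (enorm x == 0) = (x == 0).
Proof.
apply/idP/eqP => [|->]; last by rewrite enorm0.
rewrite -sqrf_eq0 enorm_sqr psumr_eq0/=; last by move=> i _; rewrite -expr2 sqr_ge0.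
move=> /allP x0; apply/rowP => i; rewrite mxE.
by have := x0 i (mem_index_enum _); rewrite -expr2 sqrf_eq0 => /eqP.
Qed.

Lemma enorm_gt0 x : (0 < enorm x) = (x != 0).
Proof. by rewrite lt_neqAle enorm_ge0 andbT eq_sym enorm_eq0. Qed.

Lemma dotp_le x y : dotp x y <= enorm x * enorm y.
Proof.
have [->|y0] := eqVneq y 0; first by rewrite dotpC dotp0l enorm0 mulr0.
apply: le_trans (ler_norm _) _.
rewrite -(@ler_pXn2r _ 2)// ?nnegrE ?mulr_ge0 ?enorm_ge0//.
rewrite real_normK ?num_real// exprMn !enorm_sqr.
have yy : 0 < dotp y y by rewrite -enorm_sqr exprn_gt0 ?enorm_gt0.
(* The squared norm of this vector is [dotp y y] times the Gram determinant of [x] and [y]. *)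
have := dotp_ge0 (dotp y y *: x - dotp x y *: y).
rewrite dotpBl !dotpBr !dotpZl !dotpZr (dotpC y x).
rewrite (_ : _ - _ = dotp y y * (dotp x x * dotp y y - dotp x y ^+ 2)); last by ring.
by rewrite pmulr_rge0// subr_ge0.
Qed.

Lemma enorm_triangle x y : enorm (x + y) <= enorm x + enorm y.
Proof.
rewrite -(@ler_pXn2r _ 2)// ?nnegrE ?addr_ge0 ?enorm_ge0// sqrrD !enorm_sqr.
rewrite dotpDl !dotpDr (dotpC y x).
by have := dotp_le x y; lra.
Qed.

Lemma enormBC x y : enorm (x - y) = enorm (y - x).
Proof. by rewrite -enormN opprB. Qed.

Lemma enormB_triangle z x y : enorm (x - y) <= enorm (x - z) + enorm (z - y).
Proof. by apply: le_trans (enorm_triangle _ _); rewrite addrA subrK. Qed.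

Lemma coord_le_enorm x i : `|x 0 i| <= enorm x.
Proof.
rewrite -sqrtr_sqr ler_wsqrtr// (bigD1 i)//= lerDl sumr_ge0// => j _; exact: sqr_ge0.
Qed.

Lemma rV_norm_le x (r : R) : 0 <= r -> (forall i, `|x 0 i| <= r) -> `|x| <= r.
Proof.
by move=> r0 xr; rewrite /Num.norm/= mx_normrE; apply: bigmax_le => // -[j i] _ /=; rewrite (ord1 j).
Qed.

Lemma norm_le_enorm x : `|x| <= enorm x.
Proof.
by apply: rV_norm_le => [|i]; [exact: enorm_ge0|exact: coord_le_enorm].
Qed.

Lemma coord_le_norm x i : `|x 0 i| <= `|x|.
Proof.
by rewrite {2}/Num.norm/= mx_normrE; apply: (le_bigmax _ (fun ij => `|x ij.1 ij.2|) (0, i)).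
Qed.

Lemma enorm_le_norm x : enorm x <= n%:R * `|x|.
Proof.
rewrite -(@ler_pXn2r _ 2)// ?nnegrE ?mulr_ge0 ?enorm_ge0// enorm_sqr.
apply: (@le_trans _ _ (\sum_(i < n) `|x| ^+ 2)).
  apply: ler_sum => i _; rewrite -expr2 -real_normK ?num_real//.
  by rewrite ler_pXn2r ?nnegrE// coord_le_norm.
rewrite sumr_const card_ord exprMn -[leLHS]mulr_natl ler_wpM2r ?sqr_ge0//.
by rewrite -natrX ler_nat; case: n => // m; rewrite leq_pmulr.
Qed.

Let sum_continuous (F : 'I_n -> 'rV[R]_n -> R) :
  (forall i, continuous (F i)) -> continuous (fun x => \sum_i F i x).
Proof.
move=> cF x; apply: (@cvg_big R^o 'I_n +%R 0 xpredT (@add_continuous R^o)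
  'rV[R]_n (nbhs x) _ F (F ^~ x) (nbhs_filter x)) => i _.
exact: cF.
Qed.

Lemma dotp_continuous v : continuous (dotp v).
Proof.
rewrite /dotp; apply: (@sum_continuous (fun i x => v 0 i * x 0 i)) => i x.
apply: (@cvgM _ _ (nbhs x) (nbhs_filter x) (cst (v 0 i)) (fun x => x 0 i)).
- exact: (@cvg_cst R^o _ _ _ (nbhs_filter x)).
- exact: coord_continuous.
Qed.

Lemma enorm_continuous : continuous (@enorm R n).
Proof.
move=> x; apply: continuous_comp; last exact: sqrt_continuous.
move: x; apply: (@sum_continuous (fun i x => x 0 i ^+ 2)) => i x.
by rewrite /continuous_at expr2;
  apply: (@cvgM _ _ (nbhs x) (nbhs_filter x) (fun x => x 0 i) (fun x => x 0 i)); exact: coord_continuous.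
Qed.

Lemma measurable_dotp v : measurable_fun setT (dotp v).
Proof.
apply: measurable_sum => i; apply: measurable_funM => //.
exact: measurable_rV_coord.
Qed.

Lemma measurable_enorm : measurable_fun setT (@enorm R n).
Proof.
have ms : measurable_fun setT (@Num.sqrt R).
  exact: (continuous_measurable_fun (@sqrt_continuous R)).
apply: (measurableT_comp ms).
apply: measurable_sum => i; apply: measurable_funX; exact: measurable_rV_coord.
Qed.

(** The orthogonal reflection in the hyperplane normal to [v]. For [v = 0] it is the identity, so
    equal directions need no separate treatment. *)
Definition reflection v x := x - (2 * dotp v x / dotp v v) *: v.

Lemma reflectionB v : {morph reflection v : x y / x - y}.
Proof.
move=> x y; rewrite /reflection dotpBr mulrBr mulrBl scalerBl.
by rewrite !opprD !opprK addrACA.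
Qed.

Lemma dotp_reflection v x y : dotp (reflection v x) (reflection v y) = dotp x y.
Proof.
rewrite /reflection dotpBl !dotpBr !dotpZl !dotpZr !(dotpC _ v).
have [->|v0] := eqVneq v 0; first by rewrite !dotp0l; ring.
by field; rewrite -enorm_sqr expf_neq0// enorm_eq0.
Qed.

Lemma enorm_reflection v x : enorm (reflection v x) = enorm x.
Proof. by rewrite !enormE dotp_reflection. Qed.

Lemma reflectionK v : involutive (reflection v).
Proof.
move=> x; rewrite {1}/reflection /reflection dotpBr dotpZr.
have [->|v0] := eqVneq v 0; first by rewrite !scaler0 !subr0.
rewrite -addrA -opprD -scalerDl.
rewrite [X in X *: v](_ : _ = 0) ?scale0r ?subr0//.
by field; rewrite -enorm_sqr expf_neq0// enorm_eq0.
Qed.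

(** As [u] and [v] have equal length, [u - v] is normal to their bisecting hyperplane: the
    coefficient 2 <u - v, u> / |u - v|^2 equals 1. *)
Lemma reflection_unit u v : enorm u = 1 -> enorm v = 1 -> reflection (u - v) u = v.
Proof.
move=> u1 v1; have uu : dotp u u = 1 by rewrite -enorm_sqr u1 expr1n.
have vv : dotp v v = 1 by rewrite -enorm_sqr v1 expr1n.
have [->|uv] := eqVneq u v; first by rewrite subrr /reflection scaler0 subr0.
have : dotp (u - v) (u - v) != 0 by rewrite -enorm_sqr expf_neq0// enorm_eq0 subr_eq0.
rewrite /reflection !dotpBl !dotpBr uu vv (dotpC v u) => d0.
rewrite [X in X *: (u - v)](_ : _ = 1) ?scale1r ?subKr//.
by field.
Qed.

Lemma measurable_reflection v : measurable_fun setT (reflection v).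
Proof.
apply/measurable_fun_rVP => i; under eq_fun do rewrite !mxE.
apply: measurable_funB; first exact: measurable_rV_coord.
apply: measurable_funM => //; apply: measurable_funM => //.
by apply: measurable_funM => //; exact: measurable_dotp.
Qed.

Lemma measurable_ball_enorm r : measurable [set x : 'rV[R]_n | enorm x < r].
Proof.
rewrite -[X in measurable X]setTI -[X in measurable (_ `&` X)]/(enorm @^-1` [set x | x < r]).
by apply: measurable_enorm => //; rewrite -set_itvNyo; exact: measurable_itv.
Qed.

Let lebesgue_rV_cube (r : R) : 0 < r ->
  lebesgue_rV n [set x : 'rV[R]_n | forall i, (- r < x 0 i < r)%R] = ((r *+ 2) ^+ n)%:E.
Proof.
move=> r0; have <- : [set x : 'rV[R]_n | forall i, `]- r, r[%classic (x 0 i)] =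
    [set x | forall i, - r < x 0 i < r].
  by apply/seteqP; split => x /= h i; have := h i; rewrite /= in_itv.
rewrite (@lebesgue_rV_box _ _ (fun=> `]- r, r[%classic))//.
rewrite lebesgue_measure_itv/= lte_fin gtrN// -EFinB opprK -mulr2n.
elim: n => [|m IH]; first by rewrite big_ord0 expr0.
by rewrite big_ord_recl IH exprS.
Qed.

Let measurable_cube (r : R) : measurable [set x : 'rV[R]_n | forall i, (- r < x 0 i < r)%R].
Proof.
have <- : [set x : 'rV[R]_n | forall i, `]- r, r[%classic (x 0 i)] =
    [set x | forall i, - r < x 0 i < r].
  by apply/seteqP; split => x /= h i; have := h i; rewrite /= in_itv.
exact: (measurable_rV_box (A := fun=> `]- r, r[%classic)).
Qed.

Lemma lebesgue_rV_ball_gt0 (r : R) : 0 < r ->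
  (0 < lebesgue_rV n [set x : 'rV[R]_n | enorm x < r]%R)%E.
Proof.
(* A cube of half-side r/(n+1) fits strictly inside, since |x| is at most n times the sup norm. The
   divisor n+1 gives the strict inequality and covers n = 0. *)
move=> r0; have r1 : 0 < r / n.+1%:R by rewrite divr_gt0.
apply: (@lt_le_trans _ _ ((r / n.+1%:R *+ 2) ^+ n)%:E).
  by rewrite lte_fin exprn_gt0// mulrn_wgt0.
rewrite -lebesgue_rV_cube//; apply: le_measure; rewrite ?inE//;
  try exact: measurable_ball_enorm; try exact: measurable_cube.
move=> x /= xn; apply: le_lt_trans (enorm_le_norm _) _.
have xn1 : `|x| <= r / n.+1%:R.
  apply: rV_norm_le => [|i]; first exact: ltW.
  by have := xn i; rewrite -ltr_norml => /ltW.
apply: le_lt_trans (ler_wpM2l _ xn1) _ => //.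
by rewrite mulrA ltr_pdivrMr// mulrC ltr_pM2l// ltr_nat.
Qed.

Lemma lebesgue_rV_ball_lty (r : R) : 0 < r ->
  (lebesgue_rV n [set x : 'rV[R]_n | enorm x < r]%R < +oo)%E.
Proof.
move=> r0; apply: (@le_lt_trans _ _ ((r *+ 2) ^+ n)%:E); last by rewrite ltry.
rewrite -lebesgue_rV_cube//; apply: le_measure; rewrite ?inE//;
  try exact: measurable_ball_enorm; try exact: measurable_cube.
move=> x /= x1 i; rewrite -ltr_norml.
exact: le_lt_trans (coord_le_enorm _ _) x1.
Qed.

(** In the involution identity take for [B] the unit ball, which every reflection fixes. Its volume
    is positive and finite and cancels, so all reflections carry [A] to sets of one measure, that of
    [-A]. The reflection along 0 is the identity, which identifies this value. *)
Lemma lebesgue_rV_reflection v (A : set 'rV[R]_n) : measurable A ->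
  lebesgue_rV n (reflection v @^-1` A) = lebesgue_rV n A.
Proof.
move=> mA; pose U := [set x : 'rV[R]_n | enorm x < 1].
have mU : measurable U := measurable_ball_enorm 1.
have U0 : (0 < lebesgue_rV n U)%E := lebesgue_rV_ball_gt0 ltr01.
have Uoo : (lebesgue_rV n U < +oo)%E := lebesgue_rV_ball_lty ltr01.
have Ufin : lebesgue_rV n U \is a fin_num by rewrite ge0_fin_numE.
have key w : lebesgue_rV n (reflection w @^-1` A) = lebesgue_rV n (-%R @^-1` A).
  have := lebesgue_rV_involution (measurable_reflection w) (reflectionK w)
    (reflectionB w) mA mU.
  rewrite (_ : reflection w @^-1` U = U); last first.
    by apply/seteqP; split => x; rewrite /U/= enorm_reflection.
  have Ur : fine (lebesgue_rV n U) != 0 by rewrite gt_eqF// fine_gt0// U0.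
  rewrite [RHS]muleC -(fineK Ufin) => /(congr1 (fun z : \bar R => z * ((fine (lebesgue_rV n U))^-1)%:E)%E).
  by rewrite -!muleA -EFinM divff// !mule1.
rewrite key -(key 0); congr (_ _); apply/seteqP; split => x;
  by rewrite /reflection/= scaler0 subr0.
Qed.

Lemma ge0_integral_reflection v (D : set 'rV[R]_n) (f : 'rV[R]_n -> \bar R) :
  measurable D -> measurable_fun D f -> (forall x, 0 <= f x)%E ->
  (\int[lebesgue_rV n]_(x in D) f x =
   \int[lebesgue_rV n]_(x in reflection v @^-1` D) f (reflection v x))%E.
Proof.
move=> mD mf f0.
rewrite -(ge0_integral_pushforward (measurable_reflection v) (lebesgue_rV n) mD mf)//.
apply: (@eq_measure_integral _ _ _ D
  (image_measure (lebesgue_rV n) (measurable_reflection v)) (lebesgue_rV n)) => A mA _.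
exact/esym/lebesgue_rV_reflection.
Qed.

End euclidean.

(** * Gamma and beta integrals *)

Section gamma_integrals.
Context {R : realType}.
Local Notation mu := (@lebesgue_measure R).

Lemma integral_derive (F f : R -> R) (a b : R) : a < b ->
  (forall x, a <= x <= b -> is_derive x 1 F (f x)) ->
  (forall x, a <= x <= b -> {for x, continuous f}) ->
  (\int[mu]_(x in `[a, b]) (f x)%:E = (F b - F a)%:E)%E.
Proof.
move=> ab dF cf.
have cF x : a <= x <= b -> {for x, continuous F}.
  by move=> /dF/@ex_derive/derivable1_diffP/differentiable_continuous.
rewrite (@continuous_FTC2 _ f F)//.
- by apply: continuous_in_subspaceT => x; rewrite inE/= in_itv/=; exact: cf.
- split.
  + by move=> x; rewrite in_itv/= => /andP[/ltW ax /ltW xb]; apply: ex_derive; apply: dF; rewrite ax.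
  + by apply: cvg_at_right_filter; apply: cF; rewrite lexx ltW.
  + by apply: cvg_at_left_filter; apply: cF; rewrite lexx ltW.
- move=> x; rewrite in_itv/= => /andP[/ltW ax /ltW xb].
  by rewrite derive1E; apply: derive_val; apply: dF; rewrite ax.
Qed.

Lemma integral_expR_sqr (t : R) : 0 < t ->
  (\int[mu]_x (expR (- (t * x ^+ 2)))%:E = ((pi / t) `^ (1 / 2))%:E)%E.
Proof.
move=> t0; have st0 : 0 < Num.sqrt t by rewrite sqrtr_gt0.
have mg : measurable_fun setT (fun x : R => (gauss_fun x)%:E).
  by apply/measurable_EFinP; exact: measurable_gauss_fun.
have := ge0_integral_affine 0 st0 mg (fun x => ltac:(by rewrite lee_fin gauss_fun_ge0)).
under [in X in _ = X -> _]eq_integral => x _.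
  rewrite /gauss_fun addr0 exprMn sqr_sqrtr ?ltW//; over.
rewrite integralT_gauss => /(congr1 (fun z : \bar R => (Num.sqrt t)^-1%:E * z)%E).
rewrite muleA -!EFinM mulVf ?gt_eqF// mul1e => <-.
rewrite div1r powR12_sqrt ?divr_ge0 ?pi_ge0 ?ltW//.
by rewrite sqrtrM ?pi_ge0// sqrtrV ?ltW// mulrC.
Qed.

Lemma enorm_rV_cons n (t : R) (y : 'rV[R]_n) :
  enorm (rV_cons (t, y)) ^+ 2 = t ^+ 2 + enorm y ^+ 2.
Proof.
rewrite !enorm_sqr /dotp big_ord_recl !mxE unlift_none -expr2; congr +%R.
by apply: eq_bigr => i _; rewrite !mxE liftK.
Qed.

Lemma measurable_expR_enorm n (t : R) :
  measurable_fun setT (fun y : 'rV[R]_n => expR (- (t * enorm y ^+ 2))).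
Proof.
apply: measurableT_comp; first exact: measurable_expR.
apply: measurable_funN; apply: measurable_funM => //.
by apply: measurable_funX; exact: measurable_enorm.
Qed.

Lemma integral_expR_enorm n (t : R) : 0 < t ->
  (\int[lebesgue_rV n]_y (expR (- (t * enorm y ^+ 2)))%:E =
   ((pi / t) `^ (n%:R / 2))%:E)%E.
Proof.
move=> t0; have pt : 0 < pi / t by rewrite divr_gt0// pi_gt0.
elim: n => [|n IH].
  rewrite mul0r powRr0 /= integral_dirac//; last first.
    by apply/measurable_EFinP; exact: measurable_expR_enorm.
  by rewrite diracT mul1e enorm_sqr /dotp big_ord0 mulr0 oppr0 expR0.
rewrite ge0_integral_lebesgue_rVS//; last first.
  by apply/measurable_EFinP; exact: measurable_expR_enorm.
under eq_integral => s _.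
  under eq_integral => y _.
    rewrite enorm_rV_cons mulrDr opprD expRD EFinM; over.
  rewrite ge0_integralZl ?lee_fin ?expR_ge0//; last first.
  - by apply/measurable_EFinP; exact: measurable_expR_enorm.
  rewrite IH; over.
rewrite ge0_integralZr ?lee_fin ?powR_ge0//; last first.
  apply/measurable_EFinP; apply: measurableT_comp; first exact: measurable_expR.
  by apply: measurable_funN; apply: measurable_funM => //; exact: measurable_funX.
rewrite integral_expR_sqr// -EFinM -powRD; last by rewrite gt_eqF ?implybT//.
by rewrite -mulrDl addrC natr1.
Qed.

Lemma powR_divr (x t q : R) : 0 <= x -> 0 < t -> (x / t) `^ q = x `^ q * t `^ (- q).
Proof.
move=> x0 t0; rewrite powRM ?invr_ge0 ?(ltW t0)//.
by rewrite -powR_inv1 ?(ltW t0)// -powRrM mulN1r.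
Qed.

(** The extended-real Gamma integral. Tonelli identities hold for it before convergence is known,
    whereas [Gamma] is its finite part. *)
Definition gamma_integral (z : R) : \bar R :=
  (\int[mu]_(t in `]0%R, +oo[) (t `^ (z - 1) * expR (- t))%:E)%E.

Lemma measurable_gamma_integrand (z a : R) :
  measurable_fun setT (fun t : R => t `^ (z - 1) * expR (- (a * t))).
Proof.
apply: measurable_funM; first exact: measurable_powR.
apply: measurableT_comp; first exact: measurable_expR.
by apply: measurable_funN; exact: measurable_funM.
Qed.

Lemma gamma_integral_scale (z a : R) : 0 < a ->
  (\int[mu]_(t in `]0%R, +oo[) (t `^ (z - 1) * expR (- (a * t)))%:E =
   (a `^ (- z))%:E * gamma_integral z)%E.
Proof.
move=> a0.
pose f t : \bar R := ((t `^ (z - 1) * expR (- (t)))%:E)%E.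
have mf : measurable_fun setT f.
  apply/measurable_EFinP; have := measurable_gamma_integrand z 1.
  by apply: eq_measurable_fun => t _; rewrite mul1r.
have mfr : measurable_fun setT (f \_ `]0, +oo[).
  by apply/(measurable_restrictT f) => //; exact: measurable_funTS.
have fr0 x : (0 <= (f \_ `]0%R, +oo[) x)%E.
  by apply: erestrict_ge0 => t _; rewrite lee_fin mulr_ge0 ?powR_ge0 ?expR_ge0.
have -> : gamma_integral z = (\int[mu]_x (f \_ `]0%R, +oo[) x)%E.
  by rewrite /gamma_integral integral_mkcond.
rewrite (ge0_integral_affine 0 a0)//.
rewrite muleA -EFinM [in LHS]integral_mkcond -ge0_integralZl//; last 2 first.
- by under eq_fun do rewrite addr0; exact: (measurableT_comp mfr (mulrl_measurable a)).
- by rewrite lee_fin mulr_ge0 ?powR_ge0// ltW.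
apply: eq_integral => t _; rewrite addr0 !patchE !mem_setE !in_itv/= !andbT pmulr_rgt0//.
case: ifPn => [t0|_]; last by rewrite mule0.
rewrite /f -EFinM; congr EFin.
rewrite powRM ?ltW// mulrA; congr (_ * _).
suff e : a `^ (- z) * a * a `^ (z - 1) = 1 by rewrite mulrA e mul1r.
have a1 : a != 0 by rewrite gt_eqF.
rewrite -{2}(powRr1 (ltW a0)) -!powRD ?a1 ?implybT//.
by rewrite (_ : _ + _ + _ = 0) ?powRr0//; ring.
Qed.

Let measurable_gamma_integrand1 (z : R) (D : set R) :
  measurable_fun D (fun t : R => (t `^ (z - 1) * expR (- t))%:E).
Proof.
apply/measurable_EFinP/measurable_funTS; have := measurable_gamma_integrand z 1.
by apply: eq_measurable_fun => t _; rewrite mul1r.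
Qed.

Let gamma_integrand_ge0 (z t : R) : (0 <= (t `^ (z - 1) * expR (- t))%:E)%E.
Proof. by rewrite lee_fin mulr_ge0 ?powR_ge0 ?expR_ge0. Qed.

Lemma gamma_integral_gt0 (z : R) : (0 < gamma_integral z)%E.
Proof.
pose c := expR (- (`|z - 1| * ln 2 + 2)).
apply: (@lt_le_trans _ _ (\int[mu]_(t in `[1%R, 2%R]) (cst c%:E) t)%E).
  rewrite integral_cst//= lebesgue_measure_itv/= lte_fin ltr1n -EFinD -EFinM lte_fin.
  by rewrite mulr_gt0 ?expR_gt0//; lra.
apply: (@le_trans _ _ (\int[mu]_(t in `[1%R, 2%R]) (t `^ (z - 1) * expR (- t))%:E)%E).
  apply: ge0_le_integral => //.
  - by move=> t _; rewrite lee_fin expR_ge0.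
  - exact: measurable_gamma_integrand1.
  - move=> t /=; rewrite in_itv/= => /andP[t1 t2]; rewrite lee_fin /powR gt_eqF; last lra.
    rewrite -expRD ler_expR opprD lerD// ?lerN2//.
    have lt0 : 0 <= ln t by rewrite ln_ge0.
    have lt2 : ln t <= ln 2 by rewrite ler_ln// posrE; lra.
    apply: (@le_trans _ _ (- (`|z - 1| * ln t))).
      by rewrite lerN2 ler_wpM2l.
    rewrite -mulNr ler_wpM2r// lerNl -normrN; exact: ler_norm.
apply: ge0_subset_integral => //; first exact: measurable_gamma_integrand1.
by move=> t /=; rewrite !in_itv/= andbT => /andP[t1 _]; lra.
Qed.

Lemma integral_powR_itv01 (p : R) : 0 < p ->
  (\int[mu]_(t in `]0%R, 1%R]) (t `^ (p - 1))%:E <= (p^-1)%:E)%E.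
Proof.
move=> p0.
(* The offset in [k.+2] keeps the left endpoint strictly below 1, as the fundamental theorem is
   stated for a nondegenerate interval. *)
pose F (k : nat) : set R := `[k.+2%:R^-1, 1]%classic.
have mf (D : set R) : measurable_fun D (fun t : R => (t `^ (p - 1))%:E).
  by apply/measurable_EFinP/measurable_funTS; exact: measurable_powR.
have UF : `]0, 1]%classic = \bigcup_k F k.
  apply/seteqP; split => [t|t [k _]]; rewrite /F/= !in_itv/=.
    move=> /andP[t0 t1].
    have [k] : exists k : nat, 0 + k.+1%:R^-1 < t by apply: ltr_add_invr.
    rewrite add0r => kt; exists k => //; rewrite /= in_itv/=; apply/andP; split=> //.
    by apply: ltW; apply: le_lt_trans kt; rewrite lef_pV2 ?posrE// ler_nat.
  by move=> /andP[kt ->]; rewrite andbT; apply: lt_le_trans kt; rewrite invr_gt0.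
have ndF : nondecreasing_seq F.
  move=> m k mk; rewrite subsetEset => t; rewrite /F/= !in_itv/= => /andP[mt ->].
  by rewrite andbT; apply: le_trans mt; rewrite lef_pV2 ?posrE// ler_nat ltnS.
have f0 (k : nat) x : F k x -> (0 <= (x `^ (p - 1))%:E)%E by rewrite lee_fin powR_ge0.
have := @ge0_nondecreasing_set_cvg_integral _ (measurableTypeR R) _ F
  (fun t => (t `^ (p - 1))%:E) mu ndF (fun i => measurable_itv _) (fun i => mf _) f0.
rewrite -UF => cF; rewrite -(cvg_lim _ cF)//; apply: lime_le; first exact: cvgP cF.
apply: nearW => k; rewrite /F.
have k0 : 0 < (k.+2%:R^-1 : R) by rewrite invr_gt0.
have k1 : (k.+2%:R^-1 : R) < 1 by rewrite invf_lt1// ltr1n.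
have dF (x : R) : k.+2%:R^-1 <= x <= 1 ->
    is_derive x 1 (p^-1 \*: (@powR R ^~ p) : R -> R) (x `^ (p - 1)).
  move=> /andP[xk _]; have x0 : 0 < x by exact: lt_le_trans xk.
  apply: (is_derive_eq (is_deriveZ p^-1 (is_derive1_powR p x0))).
  by rewrite scalerA mulVf ?gt_eqF// scale1r.
rewrite (integral_derive k1 dF).
  by rewrite /= powR1 lee_fin /GRing.scale/= mulr1 lerBlDr lerDl mulr_ge0 ?powR_ge0// invr_ge0 ltW.
move=> x /andP[xk _]; have x0 : 0 < x by exact: lt_le_trans xk.
by have /@ex_derive/derivable1_diffP/differentiable_continuous := is_derive1_powR (p - 1) x0.
Qed.

Lemma gamma_integral_lty (z : R) : 0 < z -> (gamma_integral z < +oo)%E.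
Proof.
move=> z0; rewrite /gamma_integral.
have -> : `]0, +oo[%classic = (`]0, 1] `|` `]1, +oo[)%classic :> set R.
  apply/seteqP; split => t /=; rewrite !in_itv/= !andbT.
    by move=> ->; case: (leP t 1) => /= _; [left|right].
  by case=> [/andP[]//|]; lra.
rewrite ge0_integral_setU//; last first.
- by apply/disj_setPRL => t /=; rewrite !in_itv/= andbT; case: leP => //; rewrite andbF.
- exact: measurable_gamma_integrand1.
apply: lte_add_pinfty.
  apply: (@le_lt_trans _ _ (z^-1)%:E); last exact: ltry.
  apply: le_trans (integral_powR_itv01 z0).
  apply: ge0_le_integral => //.
  - exact: measurable_gamma_integrand1.
  - by apply/measurable_EFinP/measurable_funTS; exact: measurable_powR.
  - move=> t /=; rewrite in_itv/= => /andP[t0 _]; rewrite lee_fin.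
    by rewrite ler_piMr ?powR_ge0// -expR0 ler_expR lerNl oppr0 ltW.
(* On the tail the integrand is compared with an exponential density of rate 1/2. The inequality ln
   (t / 2p) <= t / 2p - 1 gives t^p <= (2p)^p e^(t/2), which is the origin of [C]; the summand 1
   keeps [p] positive. *)
pose p := `|z - 1| + 1; have p0 : 0 < p by rewrite ltr_wpDl.
pose C := expR (p * ln (2 * p)).
apply: (@le_lt_trans _ _ (\int[mu]_(t in `]1%R, +oo[)
    ((C * 2)%:E * (exponential_pdf 2^-1 t)%:E))%E).
  apply: ge0_le_integral => //.
  - exact: measurable_gamma_integrand1.
  - by apply: measurable_funeM; apply/measurable_EFinP/measurable_funTS; exact: measurable_exponential_pdf.
  - move=> t /=; rewrite in_itv/= andbT => t1.
    have t0 : 0 < t by lra.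
    rewrite exponential_pdfE; last exact: ltW.
    rewrite -EFinM lee_fin.
    rewrite (_ : C * 2 * (2^-1 * _) = C * expR (- (2^-1) * t)); last by field.
    rewrite /C -expRD /powR gt_eqF// -expRD ler_expR.
    have lnt : (z - 1) * ln t <= p * ln t.
      rewrite ler_wpM2r ?ln_ge0 ?ltW// /p; have := ler_norm (z - 1); lra.
    have : ln t - ln (2 * p) <= t / (2 * p) - 1.
      rewrite -ln_div ?posrE// ?mulr_gt0//.
      have := @le_ln1Dx R (t / (2 * p) - 1).
      rewrite addrCA subrr addr0; apply.
      by rewrite ltrBDl subrr divr_gt0 ?mulr_gt0.
    move=> /(ler_wpM2l (ltW p0)); rewrite !mulrBr mulr1.
    rewrite (_ : p * (t / (2 * p)) = t / 2); last by field; rewrite gt_eqF.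
    lra.
rewrite ge0_integralZl//; last 3 first.
- by apply/measurable_EFinP/measurable_funTS; exact: measurable_exponential_pdf.
- by move=> t _; rewrite lee_fin exponential_pdf_ge0.
- by rewrite lee_fin mulr_ge0 ?expR_ge0.
apply: lte_mul_pinfty => //; first by rewrite lee_fin mulr_ge0 ?expR_ge0.
apply: (@le_lt_trans _ _ (\int[mu]_t (exponential_pdf 2^-1 t)%:E)%E).
  apply: ge0_subset_integral => //.
  - by apply/measurable_EFinP; exact: measurable_exponential_pdf.
  - by move=> t _; rewrite lee_fin exponential_pdf_ge0.
by rewrite integral_exponential_pdf ?ltry.
Qed.

Lemma Gamma_gamma_integral (z : R) : 0 < z -> gamma_integral z = (Gamma z)%:E.
Proof.
by move=> z0; rewrite -[LHS]fineK// ge0_fin_numE ?gamma_integral_lty// ltW ?gamma_integral_gt0.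
Qed.

Lemma Gamma_gt0 (z : R) : 0 < z -> 0 < Gamma z.
Proof. by move=> z0; rewrite -lte_fin -Gamma_gamma_integral// gamma_integral_gt0. Qed.

Lemma measurable_powR_enorm n (a b : R) :
  measurable_fun setT (fun y : 'rV[R]_n => (a + enorm y ^+ 2) `^ b).
Proof.
apply: (measurableT_comp (measurable_powR _)).
apply: measurable_funD => //; apply: measurable_funX; exact: measurable_enorm.
Qed.

(* Write [(a + |y|^2)^(-b)] as a Laplace transform, so that the integral over
   [y] becomes Gaussian. *)
Lemma gamma_integral_beta n (a b : R) : 0 < a ->
  (gamma_integral b * \int[lebesgue_rV n]_y ((a + enorm y ^+ 2) `^ (- b))%:E =
   (pi `^ (n%:R / 2) * a `^ (n%:R / 2 - b))%:E * gamma_integral (b - n%:R / 2))%E.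
Proof.
move=> a0.
pose h (p : 'rV[R]_n * measurableTypeR R) : \bar R :=
  (p.2 `^ (b - 1) * expR (- ((a + enorm p.1 ^+ 2) * p.2)) * \1_(`]0, +oo[) p.2)%:E.
have mD : measurable (`]0, +oo[%classic : set (measurableTypeR R)) by [].
have msnd : measurable_fun setT (fun p : 'rV[R]_n * measurableTypeR R => p.2 : R).
  exact: measurable_snd.
have mnorm : measurable_fun setT (fun p : 'rV[R]_n * measurableTypeR R => enorm p.1).
  by apply: (measurableT_comp (@measurable_enorm R n)); exact: measurable_fst.
have mI : measurable_fun setT (\1_(`]0, +oo[) : measurableTypeR R -> R).
  exact: measurable_indic.
have mh : measurable_fun setT h.
  apply/measurable_EFinP; apply: measurable_funM; first apply: measurable_funM.
  - exact: (measurableT_comp (measurable_powR _) msnd).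
  - apply: measurableT_comp; first exact: measurable_expR.
    apply: measurable_funN; apply: measurable_funM => //.
    by apply: measurable_funD => //; exact: measurable_funX.
  - exact: (measurableT_comp mI msnd).
have h0 p : (0 <= h p)%E by rewrite lee_fin !mulr_ge0 ?powR_ge0 ?expR_ge0.
have ay y : 0 < a + enorm y ^+ 2 :> R by rewrite ltr_pwDl// sqr_ge0.
transitivity (\int[lebesgue_rV n]_y \int[mu]_t h (y, t))%E.
  rewrite -ge0_integralZl//; last first.
  - exact/ltW/gamma_integral_gt0.
  - by move=> y _; rewrite lee_fin powR_ge0.
  - by apply/measurable_EFinP; exact: measurable_powR_enorm.
  apply: eq_integral => y _; rewrite muleC -gamma_integral_scale//.
  rewrite integral_mkcond; apply: eq_integral => t _.
  rewrite patchE /h /= indicE; case: ifPn => tD; rewrite ?mulr1// mulr0//.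
rewrite (fubini_tonelli h mh h0) EFinM -muleA -[n%:R / 2 - b]opprB.
rewrite -(gamma_integral_scale (b - n%:R / 2) a0).
rewrite -[RHS]ge0_integralZl//; last 3 first.
- by apply/measurable_EFinP/measurable_funTS; exact: measurable_gamma_integrand.
- by move=> t _; rewrite lee_fin mulr_ge0 ?powR_ge0 ?expR_ge0.
- by rewrite lee_fin powR_ge0.
rewrite [RHS]integral_mkcond; apply: eq_integral => t _.
rewrite patchE mem_setE in_itv/= andbT /h/= indicE mem_setE in_itv/= andbT.
case: ifPn => t0; last first.
  by apply: integral0_eq => y _; rewrite mulr0.
under eq_integral => y _.
  rewrite mulr1 (mulrC _ t) mulrDr opprD expRD mulrA EFinM; over.
rewrite ge0_integralZl//; last first.
- by rewrite lee_fin mulr_ge0 ?powR_ge0 ?expR_ge0.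
- by apply/measurable_EFinP; exact: measurable_expR_enorm.
rewrite (mulrC a t).
rewrite integral_expR_enorm// -!EFinM; congr EFin.
have t1 : t != 0 by rewrite gt_eqF.
have -> : (pi / t) `^ (n%:R / 2) = pi `^ (n%:R / 2) * t `^ (- (n%:R / 2)).
  exact: powR_divr (pi_ge0 R) t0.
suff -> : t `^ (b - n%:R / 2 - 1) = t `^ (b - 1) * t `^ (- (n%:R / 2)) by ring.
by rewrite -powRD ?t1 ?implybT//; congr (_ `^ _); ring.
Qed.

Lemma integral_powR_enorm n (a b : R) : 0 < a -> n%:R / 2 < b ->
  (\int[lebesgue_rV n]_y ((a + enorm y ^+ 2) `^ (- b))%:E =
   (pi `^ (n%:R / 2) * Gamma (b - n%:R / 2) / Gamma b * a `^ (n%:R / 2 - b))%:E)%E.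
Proof.
move=> a0 nb; have b0 : 0 < b by apply: le_lt_trans nb; rewrite divr_ge0.
have := gamma_integral_beta n b a0; rewrite !Gamma_gamma_integral ?subr_gt0//.
move=> /(congr1 (fun z : \bar R => ((Gamma b)^-1%:E * z)%E)).
rewrite muleA -EFinM mulVf ?mul1e ?gt_eqF ?Gamma_gt0// => ->.
by rewrite -!EFinM; congr EFin; ring.
Qed.

End gamma_integrals.

(** * Logarithmic integrals, the normalising constant and rotation to the first axis *)

Section tail_estimates.
Context {R : realType}.
Local Notation mu := (@lebesgue_measure R).

Lemma measurable_set_lt d (T : measurableType d) (f g : T -> R) :
  measurable_fun setT f -> measurable_fun setT g -> measurable [set x | f x < g x].
Proof.
move=> mf mg; have := measurable_fun_ltr mf mg.
by move=> /(_ measurableT [set true] Logic.I); rewrite setTI.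
Qed.

Lemma measurable_set_le d (T : measurableType d) (f g : T -> R) :
  measurable_fun setT f -> measurable_fun setT g -> measurable [set x | f x <= g x].
Proof.
move=> mf mg; rewrite (_ : mkset _ = ~` [set x | g x < f x]).
  by apply: measurableC; exact: measurable_set_lt.
by apply/seteqP; split => x /=; rewrite leNgt => /negP.
Qed.

Lemma integral_inv_right (a p q : R) : a < p -> p < q ->
  (\int[mu]_(t in `[p, q]) ((t - a)^-1)%:E = (ln (q - a) - ln (p - a))%:E)%E.
Proof.
move=> ap pq.
have dF (x : R) : p <= x <= q -> is_derive x 1 (fun t => ln (t - a)) ((x - a)^-1).
  move=> /andP[px _]; have xa : 0 < x - a by lra.
  have h : is_derive x 1 (fun t : R => t - a) 1.
    by apply: is_derive_eq; rewrite subr0.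
  have := @is_derive1_comp R (@ln R) (fun t => t - a) x _ 1 (is_derive1_ln xa) h.
  by rewrite mulr1.
rewrite (integral_derive pq dF)// => x /andP[px _].
apply: continuousV; first by rewrite gt_eqF//; lra.
by apply: cvgB => //; exact: cvg_cst.
Qed.

Lemma integral_inv_left (a p q : R) : p < q -> q < a ->
  (\int[mu]_(t in `[p, q]) ((a - t)^-1)%:E = (ln (a - p) - ln (a - q))%:E)%E.
Proof.
move=> pq qa.
have dF (x : R) : p <= x <= q -> is_derive x 1 (fun t => - ln (a - t)) ((a - x)^-1).
  move=> /andP[_ qx]; have xa : 0 < a - x by lra.
  have h : is_derive x 1 (fun t : R => a - t) (-1).
    by apply: (is_derive_eq (is_deriveB (is_derive_cst a x 1) (is_derive_id x 1))); rewrite sub0r.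
  have := is_deriveN (@is_derive1_comp R (@ln R) (fun t => a - t) x _ (-1) (is_derive1_ln xa) h).
  by rewrite mulrN1 opprK.
rewrite (integral_derive pq dF).
  by congr EFin; ring.
move=> x /andP[_ xq].
apply: continuousV; first by rewrite gt_eqF//; lra.
by apply: cvgB => //; exact: cvg_cst.
Qed.

(** The value of the integral of (1 + |y|^2)^(-b) over n-dimensional space when n/2 < b. *)
Definition beta_integral n (b : R) : R :=
  pi `^ (n%:R / 2) * Gamma (b - n%:R / 2) / Gamma b.

Lemma beta_integral_gt0 n (b : R) : n%:R / 2 < b -> 0 < beta_integral n b.
Proof.
move=> nb; have b0 : 0 < b by apply: le_lt_trans nb; rewrite divr_ge0.
by rewrite divr_gt0 ?mulr_gt0 ?powR_gt0 ?pi_gt0 ?Gamma_gt0// subr_gt0.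
Qed.

Lemma integral_inv_oneDsqr : (\int[mu]_t ((1 + t ^+ 2) `^ (-1))%:E = pi%:E)%E.
Proof.
have -> : (fun t : R => ((1 + t ^+ 2) `^ (-1))%:E) = (fun t => ((oneDsqr t)^-1)%:E).
  by apply/funext => t; rewrite powR_inv1// addr_ge0// sqr_ge0.
rewrite (@ge0_symfun_integralT R (fun t => (oneDsqr t)^-1)).
- by rewrite -set_itvcy integral0y_oneDsqr -EFinM; congr EFin; field.
- by move=> x; rewrite invr_ge0 ltW// oneDsqr_gt0.
- exact: continuous_oneDsqrV.
- by move=> x /=; rewrite /oneDsqr sqrrN.
Qed.

(** For n = b = 1 the integral is that of the arctangent derivative. This relates Gamma (1/2), Gamma
    1 and pi without evaluating Gamma at 1/2. *)
Lemma beta_integral11 : beta_integral 1 1 = pi.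
Proof.
apply: EFin_inj; rewrite -integral_inv_oneDsqr.
have half : (1%:R / 2 : R) < 1 by lra.
have := @integral_powR_enorm R 1 1 1 ltr01 half; rewrite powR1 mulr1 => <-.
rewrite ge0_integral_lebesgue_rVS; last 2 first.
- by apply/measurable_EFinP; exact: measurable_powR_enorm.
- by move=> x; rewrite lee_fin powR_ge0.
apply: eq_integral => t _.
have e0 (y : 'rV[R]_0) : enorm y ^+ 2 = 0 by rewrite enorm_sqr /dotp big_ord0.
under eq_integral => y _ do rewrite enorm_rV_cons e0 addr0.
by rewrite integral_cst//= diracT mule1.
Qed.

Lemma beta_star_const_gt0 d (beta : R) : d%:R / 2 < beta -> 0 < beta_star_const d beta.
Proof.
move=> db; have b0 : 0 < beta by apply: le_lt_trans db; rewrite divr_ge0.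
by rewrite divr_gt0 ?mulr_gt0 ?powR_gt0 ?pi_gt0 ?Gamma_gt0// subr_gt0.
Qed.

(** The factors Gamma (n/2 + 1) and pi^(n/2) cancel, and what remains is the reciprocal of
    [beta_integral 1 1]. This is where pi enters the threshold for alpha. *)
Lemma beta_star_const_critical n :
  beta_star_const n.+1 (n%:R / 2 + 1 : R) * beta_integral n (n%:R / 2 + 1) = pi^-1.
Proof.
have := beta_integral11; rewrite /beta_integral /beta_star_const.
rewrite (_ : 1 - 1%:R / 2 = 1 / 2 :> R); last by field.
rewrite (_ : n%:R / 2 + 1 - n.+1%:R / 2 = 1 / 2 :> R); last by rewrite -natr1; field.
rewrite (_ : n%:R / 2 + 1 - n%:R / 2 = 1 :> R); last by ring.
rewrite (_ : n.+1%:R / 2 = n%:R / 2 + 1 / 2 :> R); last by rewrite -natr1; field.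
have pi0 := pi_gt0 R.
rewrite powRD ?gt_eqF ?implybT//.
have p1 : pi `^ (n%:R / 2) != 0 :> R by rewrite gt_eqF// powR_gt0.
have p2 : pi `^ (1 / 2) != 0 :> R by rewrite gt_eqF// powR_gt0.
have g1 : Gamma (1 : R) != 0 by rewrite gt_eqF// Gamma_gt0.
have g2 : Gamma (1 / 2 : R) != 0 by rewrite gt_eqF// Gamma_gt0//; lra.
have g3 : Gamma (n%:R / 2 + 1 : R) != 0 by rewrite gt_eqF// Gamma_gt0// ltr_wpDl// divr_ge0.
move=> piE; rewrite -[in RHS]piE.
move: (Gamma _) (Gamma _) (Gamma _) (_ `^ _) (_ `^ _) g1 g2 g3 p1 p2 => a b c p q a0 b0 c0 p0 q0.
by field; rewrite a0 b0 c0 p0 q0.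
Qed.

Definition e0 n : 'rV[R]_n.+1 := rV_cons (1, 0).

Lemma enorm_e0 n : enorm (e0 n) = 1.
Proof.
apply/eqP; rewrite -(@eqrXn2 _ 2) ?enorm_ge0// expr1n enorm_rV_cons enorm0.
by rewrite expr1n expr0n addr0.
Qed.

Lemma dotp_e0 n (t : R) (y : 'rV[R]_n) : dotp (rV_cons (t, y)) (e0 n) = t.
Proof.
rewrite /dotp big_ord_recl !mxE unlift_none mulr1 big1 ?addr0// => i _.
by rewrite !mxE liftK mxE mulr0.
Qed.

(** The reflection along [u - e0 n] exchanges the two directions and preserves norms, so a region
    described by the norm and one scalar product is carried to the first axis. *)
Lemma integral_rotate n (u : 'rV[R]_n.+1) (Q : R -> R -> Prop) (f : R -> \bar R) :
  enorm u = 1 ->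
  measurable [set x : 'rV[R]_n.+1 | Q (enorm x) (dotp x u)] ->
  measurable_fun setT f -> (forall r, 0 <= f r)%E ->
  (\int[lebesgue_rV n.+1]_(x in [set x | Q (enorm x) (dotp x u)]) f (enorm x) =
   \int[lebesgue_rV n.+1]_(x in [set x | Q (enorm x) (dotp x (e0 n))]) f (enorm x))%E.
Proof.
move=> u1 mQ mf f0.
rewrite (ge0_integral_reflection (u - e0 n) mQ)//; last first.
  by apply: measurable_funTS; exact: (measurableT_comp mf (@measurable_enorm R n.+1)).
rewrite (_ : reflection _ @^-1` _ = [set x | Q (enorm x) (dotp x (e0 n))]).
  by apply: eq_integral => x _; rewrite enorm_reflection.
have E x : dotp (reflection (u - e0 n) x) u = dotp x (e0 n).
  by rewrite -[in X in dotp _ X](reflectionK (u - e0 n) u) dotp_reflection reflection_unit ?enorm_e0.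
by apply/seteqP; split => x /=; rewrite enorm_reflection E.
Qed.

End tail_estimates.

(** * Integrals over caps *)

Section cap_estimates.
Context {R : realType}.
Local Notation mu := (@lebesgue_measure R).

Lemma measurable_integral_slice n (f : 'rV[R]_n.+1 -> \bar R) :
  measurable_fun setT f -> (forall x, 0 <= f x)%E ->
  measurable_fun setT (fun t : measurableTypeR R => \int[lebesgue_rV n]_y f (rV_cons (t, y)))%E.
Proof.
move=> mf f0.
have mc : measurable_fun setT (@rV_cons R n : measurableTypeR R * 'rV[R]_n -> 'rV[R]_n.+1).
  exact: measurable_rV_cons.
apply: (@measurable_fun_fubini_tonelli_F _ _ _ _ _ (lebesgue_rV n) (f \o @rV_cons R n)).
  exact: (measurableT_comp mf mc).
by move=> x; exact: f0.
Qed.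

Lemma measurable_rV_slice n (f : 'rV[R]_n.+1 -> \bar R) (t : R) :
  measurable_fun setT f -> measurable_fun setT (fun y => f (rV_cons (t, y))).
Proof.
move=> mf; apply: (measurableT_comp mf).
by apply: (measurableT_comp (@measurable_rV_cons R n)); exact: measurable_pair1.
Qed.

Lemma integral_powR_enorm_critical n (a : R) : 0 < a ->
  (\int[lebesgue_rV n]_y ((a + enorm y ^+ 2) `^ (- (n%:R / 2 + 1)))%:E =
   (beta_integral n (n%:R / 2 + 1) / a)%:E)%E.
Proof.
move=> a0; rewrite integral_powR_enorm//; last by rewrite ltrDl.
congr (_ * _)%:E; rewrite -(powR_inv1 (ltW a0)); congr (_ `^ _); ring.
Qed.

Lemma le_integral_critical n (h : 'rV[R]_n -> \bar R) (c a : R) : 0 < a -> 0 <= c ->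
  measurable_fun setT h -> (forall y, 0 <= h y)%E ->
  (forall y, h y <= (c * (a + enorm y ^+ 2) `^ (- (n%:R / 2 + 1)))%:E)%E ->
  (\int[lebesgue_rV n]_y h y <= (c * (beta_integral n (n%:R / 2 + 1) / a))%:E)%E.
Proof.
move=> a0 c0 mh h0 hle.
have mp := @measurable_powR_enorm R n a (- (n%:R / 2 + 1)).
apply: (@le_trans _ _ (\int[lebesgue_rV n]_y
    (c%:E * ((a + enorm y ^+ 2) `^ (- (n%:R / 2 + 1)))%:E))%E).
  apply: ge0_le_integral => //.
  by apply: measurable_funeM; exact/measurable_EFinP.
rewrite ge0_integralZl//; last 2 first.
- exact/measurable_EFinP.
- by move=> y _; rewrite lee_fin powR_ge0.
by rewrite integral_powR_enorm_critical.
Qed.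

Lemma ge0_powRN_le (x y b : R) : 0 <= b -> 0 < x -> x <= y -> y `^ (- b) <= x `^ (- b).
Proof.
move=> b0 x0 xy; have y0 : 0 < y by exact: lt_le_trans xy.
rewrite !powRN lef_pV2 ?posrE ?powR_gt0//.
by apply: ge0_ler_powR; rewrite ?nnegrE ?(ltW x0) ?(ltW y0).
Qed.

Lemma ge0_measurable_funV d (T : measurableType d) (D : set T) (g : T -> R) :
  measurable_fun setT g -> (forall x, D x -> 0 <= g x) ->
  measurable_fun D (fun x => (g x)^-1).
Proof.
move=> mg g0; apply: (@eq_measurable_fun _ _ _ _ _ (fun x => g x `^ (-1))).
  by move=> x /[!inE] Dx; rewrite powR_inv1// g0.
by apply: measurable_funTS; exact: (measurableT_comp (measurable_powR _)).
Qed.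

Lemma integral_scaled_inv_right (c a p q : R) : 0 <= c -> a < p -> p < q ->
  (\int[mu]_(t in `[p, q]) (c%:E * ((t - a)^-1)%:E) = (c * (ln (q - a) - ln (p - a)))%:E)%E.
Proof.
move=> c0 ap pq; rewrite ge0_integralZl//.
- by rewrite integral_inv_right.
- apply/measurable_EFinP; apply: ge0_measurable_funV; first exact: measurable_funB.
  by move=> t; rewrite /= in_itv/= => /andP[t1 _]; lra.
- by move=> t; rewrite /= in_itv/= => /andP[t1 _]; rewrite lee_fin invr_ge0; lra.
Qed.

Lemma integral_scaled_inv_left (c a p q : R) : 0 <= c -> p < q -> q < a ->
  (\int[mu]_(t in `[p, q]) (c%:E * ((a - t)^-1)%:E) = (c * (ln (a - p) - ln (a - q)))%:E)%E.
Proof.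
move=> c0 pq qa; rewrite ge0_integralZl//.
- by rewrite integral_inv_left.
- apply/measurable_EFinP; apply: ge0_measurable_funV; first exact: measurable_funB.
  by move=> t; rewrite /= in_itv/= => /andP[_ t1]; lra.
- by move=> t; rewrite /= in_itv/= => /andP[_ t1]; rewrite lee_fin invr_ge0; lra.
Qed.

Definition beta_kernel n (b : R) (x : 'rV[R]_n) : \bar R :=
  ((enorm x ^+ 2 - 1) `^ (- b))%:E.

Lemma measurable_beta_kernel n (b : R) : measurable_fun setT (@beta_kernel n b).
Proof.
apply/measurable_EFinP; apply: (measurableT_comp (measurable_powR _)).
by apply: measurable_funB => //; apply: measurable_funX; exact: measurable_enorm.
Qed.

Lemma beta_kernel_ge0 n (b : R) (x : 'rV[R]_n) : (0 <= beta_kernel b x)%E.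
Proof. by rewrite lee_fin powR_ge0. Qed.

(** A positive [k] gives caps strictly beyond the tangent hyperplane, a negative one the larger caps
    that cross it. The cut at [s1] confines the cap to where two exponents can be compared. *)
Definition cap_set n (k s0 s1 : R) (u : 'rV[R]_n) : set 'rV[R]_n :=
  [set x | (s0 < enorm x ^+ 2 - 1 <= s1) /\ 1 + k * (enorm x ^+ 2 - 1) < dotp x u].

Lemma measurable_enorm_sqr_sub n : measurable_fun setT (fun x : 'rV[R]_n => enorm x ^+ 2 - 1).
Proof. by apply: measurable_funB => //; apply: measurable_funX; exact: measurable_enorm. Qed.

Lemma measurable_dotpr n (u : 'rV[R]_n) : measurable_fun setT (fun x => dotp x u).
Proof. by under eq_fun do rewrite dotpC; exact: measurable_dotp. Qed.

Lemma measurable_cap_set n (k s0 s1 : R) (u : 'rV[R]_n) : measurable (cap_set k s0 s1 u).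
Proof.
have ms := @measurable_enorm_sqr_sub n.
rewrite (_ : cap_set _ _ _ _ = [set x | s0 < enorm x ^+ 2 - 1] `&`
  [set x | enorm x ^+ 2 - 1 <= s1] `&` [set x | 1 + k * (enorm x ^+ 2 - 1) < dotp x u]).
  apply: measurableI; first apply: measurableI.
  - exact: measurable_set_lt.
  - exact: measurable_set_le.
  - apply: measurable_set_lt; last exact: measurable_dotpr.
    by apply: measurable_funD => //; exact: measurable_funM.
apply/seteqP; split => x; rewrite /cap_set/=; first by move=> [/andP[? ?] ?].
by move=> [[? ?] ?]; split => //; apply/andP.
Qed.

Lemma integral_cap_set_rotate n (k s0 s1 b : R) (u : 'rV[R]_n.+1) : enorm u = 1 ->
  (\int[lebesgue_rV n.+1]_(x in cap_set k s0 s1 u) beta_kernel b x =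
   \int[lebesgue_rV n.+1]_(x in cap_set k s0 s1 (e0 n)) beta_kernel b x)%E.
Proof.
move=> u1.
apply: (@integral_rotate R n u (fun r t => (s0 < r ^+ 2 - 1 <= s1) /\ 1 + k * (r ^+ 2 - 1) < t)
  (fun r => ((r ^+ 2 - 1) `^ (- b))%:E)) => //.
- exact: measurable_cap_set.
- apply/measurable_EFinP; apply: (measurableT_comp (measurable_powR _)).
  by apply: measurable_funB => //; exact: measurable_funX.
- by move=> r; rewrite lee_fin powR_ge0.
Qed.

(** At the exponent n/2 + 1 a slice with parameter [a] has integral this constant over [a], so that
    integrating over the height produces a logarithm. *)
Definition critical_integral n : R := beta_integral n (n%:R / 2 + 1).

Lemma critical_integral_gt0 n : 0 < critical_integral n.
Proof. by apply: beta_integral_gt0; rewrite ltrDl. Qed.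

Lemma enorm_rV_cons_sub1 n (t : R) (y : 'rV[R]_n) :
  enorm (rV_cons (t, y)) ^+ 2 - 1 = t ^+ 2 - 1 + enorm y ^+ 2.
Proof. by rewrite enorm_rV_cons; ring. Qed.

(* In the critical case the slices at height [t] of the cap contribute about
   [1 / (2 (t - 1))] for [t > 1 + delta], a bounded amount near [t = 1], and an
   arbitrarily small multiple of [1 / (1 - t)] below that. *)
Lemma cap_upper n (k delta : R) (u : 'rV[R]_n.+1) : enorm u = 1 ->
  0 < k <= 1 -> 0 < delta < 1 ->
  (\int[lebesgue_rV n.+1]_(x in cap_set (- k) delta 1 u) beta_kernel (n%:R / 2 + 1) x
    <= ((critical_integral n / 2 + 4 `^ (n%:R / 2 + 1) * critical_integral n * k) *
          ln delta^-1 +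
        4 `^ (n%:R / 2 + 1) * critical_integral n * (1 + k))%:E)%E.
Proof.
move=> u1 /andP[k0 k1] /andP[d0 d1]; rewrite integral_cap_set_rotate//.
set I := critical_integral n; set b := n%:R / 2 + 1; set c := 4 `^ b * I.
have b0 : 0 <= b by rewrite addr_ge0// divr_ge0.
have I0 : 0 < I := critical_integral_gt0 n.
have c0 : 0 < c by rewrite mulr_gt0// powR_gt0.
have kd : k * delta < k by rewrite gtr_pMr.
have kd0 : 0 < k * delta by rewrite mulr_gt0.
pose f := @beta_kernel n.+1 b \_ (cap_set (- k) delta 1 (e0 n)).
have mf : measurable_fun setT f.
  apply/(measurable_restrictT _ (measurable_cap_set _ _ _ _)).
  by apply: measurable_funTS; exact: measurable_beta_kernel.
have f0 x : (0 <= f x)%E by apply: erestrict_ge0 => y _; exact: beta_kernel_ge0.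
(* In the cap s <= 1, so the heights lie between 1 - k and 2. The middle range has length (1 + k)
   delta, which cancels the 1/delta in [g2]. *)
pose A : set R := `[1 + delta, 2]%classic.
pose B : set R := `[1 - k * delta, 1 + delta]%classic.
pose C : set R := `[1 - k, 1 - k * delta]%classic.
pose g1 (t : R) := ((I / 2)%:E * ((t - 1)^-1)%:E)%E.
pose g2 (t : R) := (c / delta)%:E.
pose g3 (t : R) := ((c * k)%:E * ((1 - t)^-1)%:E)%E.
have mg1 : measurable_fun A g1.
  apply: measurable_funeM; apply/measurable_EFinP; apply: ge0_measurable_funV.
    exact: measurable_funB.
  by move=> t; rewrite /A/= in_itv/= => /andP[t1 _]; lra.
have mg3 : measurable_fun C g3.
  apply: measurable_funeM; apply/measurable_EFinP; apply: ge0_measurable_funV.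
    exact: measurable_funB.
  by move=> t; rewrite /C/= in_itv/= => /andP[_ t1]; lra.
rewrite integral_mkcond ge0_integral_lebesgue_rVS//.
have mg2 : measurable_fun B g2 by exact: measurable_cst.
have ck0 : 0 < c * k by rewrite mulr_gt0.
have g1_ge0 t : A t -> (0 <= g1 t)%E.
  rewrite /A/= in_itv/= => /andP[t1 _].
  by apply: mule_ge0; rewrite lee_fin ?invr_ge0; lra.
have g2_ge0 t : B t -> (0 <= g2 t)%E by move=> _; rewrite lee_fin divr_ge0// ltW.
have g3_ge0 t : C t -> (0 <= g3 t)%E.
  rewrite /C/= in_itv/= => /andP[_ t1].
  by apply: mule_ge0; rewrite lee_fin ?invr_ge0; lra.
have ge0A t : (0 <= (g1 \_ A) t)%E by exact: erestrict_ge0.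
have ge0B t : (0 <= (g2 \_ B) t)%E by exact: erestrict_ge0.
have ge0C t : (0 <= (g3 \_ C) t)%E by exact: erestrict_ge0.
have slice t : (\int[lebesgue_rV n]_y f (rV_cons (t, y)) <=
    (g1 \_ A) t + (g2 \_ B) t + (g3 \_ C) t)%E.
  have g10 := ge0A t; have g20 := ge0B t; have g30 := ge0C t.
  have msl := measurable_rV_slice t mf.
  (* In the cap 1 - t < k s <= s, so |y|^2 = s + 1 - t^2 <= 3 s. If moreover a <= s, then a + |y|^2
     <= 4 s and the kernel is at most 4^b times the critical one with parameter [a]. This is used
     with a = delta near the hyperplane and a = (1 - t) / k below it. *)
  have near (a : R) : 0 < a ->
      (forall s r, delta < s <= 1 -> 0 <= r -> s = t ^+ 2 - 1 + r -> 1 - k * s < t -> a + r <= 4 * s) ->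
      (\int[lebesgue_rV n]_y f (rV_cons (t, y)) <= (c / a)%:E)%E.
    move=> a0 ha; rewrite /c -mulrA; apply: le_integral_critical => // y.
    rewrite /f patchE; case: ifPn => [|_]; last first.
      by rewrite lee_fin mulr_ge0 ?powR_ge0.
    rewrite inE /cap_set/= dotp_e0 mulNr => -[].
    have := ha (enorm (rV_cons (t, y)) ^+ 2 - 1) (enorm y ^+ 2).
    rewrite /beta_kernel -/b enorm_rV_cons_sub1; move: (t ^+ 2 - 1 + _) => s + s1 ts.
    move=> /(_ s1 (sqr_ge0 _) erefl ts) as4.
    have as0 : 0 < a + enorm y ^+ 2 by rewrite ltr_pwDl// sqr_ge0.
    rewrite lee_fin (_ : 4 `^ b = (4^-1) `^ (- b)); last first.
      by rewrite -(powR_inv1 (_ : 0 <= 4))// -powRrM mulN1r opprK.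
    rewrite -powRM ?(ltW as0) ?invr_ge0//; apply: ge0_powRN_le => //.
      by rewrite mulr_gt0.
    lra.
  have [t2|t2] := ltP 2 t.
    rewrite integral0_eq ?adde_ge0// => y _.
    rewrite /f patchE; case: ifPn => //; rewrite inE /cap_set/= enorm_rV_cons_sub1 => -[/andP[_ s1] _].
    by exfalso; have := sqr_ge0 (enorm y); nra.
  have [t1d|t1d] := leP (1 + delta) t.
    rewrite [(g1 \_ A) t]patchE mem_set/=; last by rewrite /A/= in_itv/= t1d.
    apply: (@le_trans _ _ (g1 t)); last by rewrite -addeA leeDl// adde_ge0.
    have t21 : 0 < t ^+ 2 - 1 by nra.
    have -> : g1 t = (1 * (I / (2 * (t - 1))))%:E.
      by rewrite /g1 -EFinM; congr EFin; field; rewrite gt_eqF//; lra.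
    apply: (@le_trans _ _ (1 * (I / (t ^+ 2 - 1)))%:E).
      apply: le_integral_critical => // y; rewrite /f patchE; case: ifPn => _.
        by rewrite /beta_kernel enorm_rV_cons_sub1 mul1r.
      by rewrite lee_fin mul1r powR_ge0.
    rewrite lee_fin !mul1r ler_wpM2l ?(ltW I0)// lef_pV2 ?posrE//; last 1 first.
    - by rewrite mulr_gt0//; lra.
    by nra.
  have [t1k|t1k] := leP (1 - k * delta) t.
    rewrite [(g2 \_ B) t]patchE mem_set/=; last by rewrite /B/= in_itv/= t1k ltW.
    apply: (@le_trans _ _ (g2 t)); last by rewrite addeAC leeDr// adde_ge0.
    apply: near => // s r /andP[ds s1] r0 sE kst.
    by nra.
  have [t1|t1] := leP (1 - k) t; last first.
    rewrite integral0_eq ?adde_ge0// => y _.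
    rewrite /f patchE; case: ifPn => //; rewrite inE /cap_set/= dotp_e0 => -[/andP[_ s1] ts].
    by exfalso; nra.
  rewrite [(g3 \_ C) t]patchE mem_set/=; last by rewrite /C/= in_itv/= t1 ltW.
  apply: (@le_trans _ _ (g3 t)); last by rewrite leeDr// adde_ge0.
  have -> : g3 t = (c / ((1 - t) / k))%:E.
    by rewrite /g3 -EFinM; congr EFin; field; rewrite !gt_eqF//; lra.
  apply: near => [|s r /andP[ds s1] r0 sE kst]; first by rewrite divr_gt0//; lra.
  have : (1 - t) / k <= s by rewrite ler_pdivrMr//; lra.
  by nra.
have mA : measurable_fun setT (g1 \_ A) by apply/(measurable_restrictT g1)=> //; exact: measurable_itv.
have mB : measurable_fun setT (g2 \_ B) by apply/(measurable_restrictT g2)=> //; exact: measurable_itv.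
have mC : measurable_fun setT (g3 \_ C) by apply/(measurable_restrictT g3)=> //; exact: measurable_itv.
apply: (@le_trans _ _ (\int[mu]_t ((g1 \_ A) t + (g2 \_ B) t + (g3 \_ C) t))%E).
  apply: ge0_le_integral => //.
  - by move=> t _; exact: integral_ge0.
  - exact: measurable_integral_slice.
  - by apply: emeasurable_funD => //; exact: emeasurable_funD.
rewrite ge0_integralD//; last 2 first.
- by move=> t _; rewrite adde_ge0.
- exact: emeasurable_funD.
rewrite ge0_integralD// -!integral_mkcond.
have iA : (\int[mu]_(t in A) g1 t = (I / 2 * (ln (2 - 1) - ln (1 + delta - 1)))%:E)%E.
  by rewrite integral_scaled_inv_right//; lra.
have iC : (\int[mu]_(t in C) g3 t =
    (c * k * (ln (1 - (1 - k)) - ln (1 - (1 - k * delta))))%:E)%E.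
  by rewrite integral_scaled_inv_left//; lra.
have iB : (\int[mu]_(t in B) g2 t = (c / delta * (delta + k * delta))%:E)%E.
  rewrite integral_cst//=; last exact: measurable_itv.
  rewrite /B lebesgue_measure_itv/= lte_fin ifT; last by lra.
  by rewrite -EFinD -EFinM; congr (_ * _)%:E; ring.
rewrite iA iB iC -!EFinD lee_fin.
rewrite (_ : 2 - 1 = 1) ?ln1; last by ring.
rewrite (_ : 1 + delta - 1 = delta); last by ring.
rewrite !subKr lnM ?posrE// lnV ?posrE//.
rewrite (_ : c / delta * (delta + k * delta) = c * (1 + k)); last by field; rewrite gt_eqF.
by rewrite le_eqVlt; apply/orP; left; apply/eqP; ring.
Qed.

End cap_estimates.

Section cap_lower_estimate.
Context {R : realType}.
Local Notation mu := (@lebesgue_measure R).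

(* Truncating a slice at [|y| <= M sqrt (t^2 - 1)] loses a fraction of order
   [1 / M] of its mass. *)
Lemma slice_lower n (M a : R) (h : 'rV[R]_n -> \bar R) : 0 < M -> 0 < a ->
  measurable_fun setT h -> (forall y, 0 <= h y)%E ->
  (forall y, enorm y ^+ 2 <= M ^+ 2 * a ->
    h y = ((a + enorm y ^+ 2) `^ (- (n%:R / 2 + 1)))%:E) ->
  (((critical_integral n - beta_integral n (n%:R / 2 + 1 / 2) / M) / a)%:E
    <= \int[lebesgue_rV n]_y h y)%E.
Proof.
move=> M0 a0 mh h0 hE.
pose b : R := n%:R / 2 + 1; set I2 := beta_integral n _.
have I20 : 0 < I2 by apply: beta_integral_gt0; rewrite ltrDl.
(* Where |y|^2 > M^2 a, the factor (a + |y|^2)^(-1/2) is at most [c]. The remaining exponent n/2 +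
   1/2 is still integrable over the whole space, which bounds the tail by a multiple of 1/(M a). *)
pose c := M^-1 * a `^ (- (1 / 2)).
have c0 : 0 <= c by rewrite mulr_ge0 ?powR_ge0// invr_ge0 ltW.
have m2 := @measurable_powR_enorm R n a (- (n%:R / 2 + 1 / 2)).
have mc : measurable_fun setT (fun y : 'rV[R]_n =>
    (c%:E * ((a + enorm y ^+ 2) `^ (- (n%:R / 2 + 1 / 2)))%:E)%E).
  by apply: measurable_funeM; exact/measurable_EFinP.
have tail : (\int[lebesgue_rV n]_y
    (c%:E * ((a + enorm y ^+ 2) `^ (- (n%:R / 2 + 1 / 2)))%:E) = (I2 / M / a)%:E)%E.
  rewrite ge0_integralZl//; last 2 first.
  - exact/measurable_EFinP.
  - by move=> y _; rewrite lee_fin powR_ge0.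
  rewrite integral_powR_enorm//; last by rewrite ltrDl.
  rewrite -/I2 -EFinM /c; congr EFin.
  rewrite (_ : n%:R / 2 - (n%:R / 2 + 1 / 2) = - (1 / 2)); last by ring.
  have -> : a^-1 = a `^ (- (1 / 2)) * a `^ (- (1 / 2)).
    have a1 : a != 0 by rewrite gt_eqF.
    rewrite -(powR_inv1 (ltW a0)) -powRD ?a1 ?implybT//.
    by congr (_ `^ _); field.
  by rewrite /I2 /beta_integral; ring.
rewrite mulrBl EFinB leeBlDr// -tail -[leLHS]integral_powR_enorm_critical// -ge0_integralD//; last first.
  by move=> y _; rewrite mule_ge0 ?lee_fin// powR_ge0.
apply: ge0_le_integral => //.
- by move=> y _; rewrite lee_fin powR_ge0.
- by apply/measurable_EFinP; exact: measurable_powR_enorm.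
- exact: emeasurable_funD.
move=> y _; have [ry|ry] := leP (enorm y ^+ 2) (M ^+ 2 * a).
  by rewrite hE// leeDl// mule_ge0 ?lee_fin ?powR_ge0.
rewrite -[leLHS]add0e leeD// -EFinM lee_fin.
have ar : 0 < a + enorm y ^+ 2 by rewrite ltr_pwDl// sqr_ge0.
rewrite -/b (_ : - b = - (1 / 2) + - (n%:R / 2 + 1 / 2)); last by rewrite /b; field.
rewrite powRD ?(gt_eqF ar) ?implybT// ler_wpM2r ?powR_ge0//.
have -> : c = (M ^+ 2 * a) `^ (- (1 / 2)).
  rewrite powRM ?sqr_ge0 ?(ltW a0)// /c; congr (_ * _).
  rewrite -powR_mulrn ?(ltW M0)// -powRrM -(powR_inv1 (ltW M0)).
  by congr (_ `^ _); field.
apply: ge0_powRN_le => //; first by rewrite mulr_gt0// exprn_gt0.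
by rewrite ltW// ltr_wpDl// ltW.
Qed.

(** For heights t from 1 + delta to 1 + t0 the truncated slices lie inside the cap: there s <= (1 +
    M^2) (t^2 - 1), and t + 1 < 3 turns this into both the slope [k] and the upper cut. The
    denominator comes from t^2 - 1 <= (2 + t0) (t - 1). *)
Lemma cap_lower n (M t0 delta : R) (u : 'rV[R]_n.+1) : enorm u = 1 ->
  0 < M -> 0 < t0 < 1 -> 0 < delta < t0 ->
  beta_integral n (n%:R / 2 + 1 / 2) / M <= critical_integral n ->
  (((critical_integral n - beta_integral n (n%:R / 2 + 1 / 2) / M) / (2 + t0) *
      (ln t0 - ln delta))%:E
   <= \int[lebesgue_rV n.+1]_(x in
        cap_set (3 * (1 + M ^+ 2))^-1 delta (3 * (1 + M ^+ 2) * t0) u)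
        beta_kernel (n%:R / 2 + 1) x)%E.
Proof.
move=> u1 M0 /andP[t00 t01] /andP[d0 dt] IM; rewrite integral_cap_set_rotate//.
set k := (3 * (1 + M ^+ 2))^-1; set s1 := 3 * (1 + M ^+ 2) * t0.
pose b : R := n%:R / 2 + 1; set J := critical_integral n - _.
have J0 : 0 <= J by rewrite subr_ge0.
have M3 : 0 < 3 * (1 + M ^+ 2) by rewrite mulr_gt0// ltr_pwDl// sqr_ge0.
pose f := @beta_kernel R n.+1 b \_ (cap_set k delta s1 (e0 n)).
have mf : measurable_fun setT f.
  apply/(measurable_restrictT _ (measurable_cap_set _ _ _ _)).
  by apply: measurable_funTS; exact: measurable_beta_kernel.
have f0 x : (0 <= f x)%E by apply: erestrict_ge0 => y _; exact: beta_kernel_ge0.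
rewrite [leRHS]integral_mkcond ge0_integral_lebesgue_rVS//.
pose A : set R := `[1 + delta, 1 + t0]%classic.
have c0 : 0 <= J / (2 + t0) by rewrite divr_ge0//; lra.
apply: (@le_trans _ _ (\int[mu]_(t in A) \int[lebesgue_rV n]_y f (rV_cons (t, y)))%E); last first.
  apply: ge0_subset_integral => //.
  - exact: measurable_itv.
  - exact: measurable_integral_slice.
  - by move=> t _; exact: integral_ge0.
have -> : ln t0 - ln delta = ln (1 + t0 - 1) - ln (1 + delta - 1).
  by congr (ln _ - ln _); ring.
rewrite -integral_scaled_inv_right//; last 2 first.
- by rewrite ltrDl.
- by rewrite ltrD2l.
apply: ge0_le_integral => //.
- move=> t; rewrite /A/= in_itv/= => /andP[t1 _].
  by apply: mule_ge0; rewrite lee_fin ?invr_ge0; lra.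
- apply: measurable_funeM; apply/measurable_EFinP; apply: ge0_measurable_funV.
    exact: measurable_funB.
  by move=> t; rewrite /= in_itv/= => /andP[t1 _]; lra.
- by apply: measurable_funTS; exact: measurable_integral_slice.
move=> t; rewrite /A/= in_itv/= => /andP[t1 t2].
have a0 : 0 < t ^+ 2 - 1 by nra.
apply: (le_trans _ (@slice_lower n M (t ^+ 2 - 1) _ M0 a0 (measurable_rV_slice t mf) _ _)) => //.
  rewrite -EFinM lee_fin -/J -mulrA ler_wpM2l// -invfM lef_pV2 ?posrE//; last first.
    by rewrite mulr_gt0//; lra.
  by nra.
move=> y ry; rewrite /f patchE ifT /beta_kernel ?enorm_rV_cons_sub1//.
rewrite inE /cap_set/= dotp_e0 enorm_rV_cons_sub1.
have r0 := sqr_ge0 (enorm y).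
have sM : t ^+ 2 - 1 + enorm y ^+ 2 <= (1 + M ^+ 2) * (t ^+ 2 - 1) by lra.
have M1 : 0 < 1 + M ^+ 2 by rewrite ltr_pwDl// sqr_ge0.
split; first (apply/andP; split; first by nra).
  apply: (le_trans sM); rewrite /s1 mulrAC [leRHS]mulrC ler_wpM2l ?(ltW M1)//.
  by nra.
rewrite -ltrBrDl /k mulrC ltr_pdivrMr//; apply: (le_lt_trans sM).
rewrite -subr_gt0 (_ : _ - _ = (1 + M ^+ 2) * ((t - 1) * (2 - t))); last by ring.
by rewrite !mulr_gt0//; lra.
Qed.

End cap_lower_estimate.

(** * Intensity of caps *)

Section intensity_estimates.
Context {R : realType}.
Local Notation mu := (@lebesgue_measure R).
Implicit Types (alpha beta : R).

Lemma beta_star_intensityE d alpha beta (B : set 'rV[R]_d) :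
  0 < alpha -> d%:R / 2 < beta -> measurable B ->
  (beta_star_intensity alpha beta B =
   (alpha * beta_star_const d beta)%:E * \int[lebesgue_rV d]_(x in B) beta_kernel beta x)%E.
Proof.
move=> a0 db mB; rewrite -ge0_integralZl//; last 3 first.
- by apply: measurable_funTS; exact: measurable_beta_kernel.
- by move=> x _; exact: beta_kernel_ge0.
- by rewrite lee_fin mulr_ge0 ?(ltW a0)// ltW// beta_star_const_gt0.
by apply: eq_integral => x _; rewrite /beta_kernel powRN.
Qed.

Lemma beta_star_intensity_ge0 d alpha beta (B : set 'rV[R]_d) :
  0 < alpha -> d%:R / 2 < beta -> measurable B -> (0 <= beta_star_intensity alpha beta B)%E.
Proof.
move=> a0 db mB; rewrite beta_star_intensityE// mule_ge0//.
  by rewrite lee_fin mulr_ge0 ?(ltW a0)// ltW// beta_star_const_gt0.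
by apply: integral_ge0 => x _; exact: beta_kernel_ge0.
Qed.

Lemma le_beta_star_intensity d alpha beta (A B : set 'rV[R]_d) :
  0 < alpha -> d%:R / 2 < beta -> measurable A -> measurable B -> A `<=` B ->
  (beta_star_intensity alpha beta A <= beta_star_intensity alpha beta B)%E.
Proof.
move=> a0 db mA mB AB; rewrite !beta_star_intensityE// lee_wpmul2l//.
  by rewrite lee_fin mulr_ge0 ?(ltW a0)// ltW// beta_star_const_gt0.
apply: ge0_subset_integral => //.
- by apply: measurable_funTS; exact: measurable_beta_kernel.
- by move=> x _; exact: beta_kernel_ge0.
Qed.

Lemma measurable_shell n (s : R) : measurable [set x : 'rV[R]_n | s < enorm x ^+ 2 - 1].
Proof. by apply: measurable_set_lt => //; exact: measurable_enorm_sqr_sub. Qed.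

(** Away from the sphere the density is comparable with (1 + |x|^2)^(-beta), which is integrable
    because d/2 < beta. *)
Lemma beta_star_intensity_shell d alpha beta (s : R) :
  0 < alpha -> d%:R / 2 < beta -> 0 < s ->
  (beta_star_intensity alpha beta [set x : 'rV[R]_d | s < enorm x ^+ 2 - 1]%R < +oo)%E.
Proof.
move=> a0 db s0; have b0 : 0 < beta by apply: le_lt_trans db; rewrite divr_ge0.
rewrite beta_star_intensityE//; last exact: measurable_shell.
apply: lte_mul_pinfty => //.
  by rewrite lee_fin mulr_ge0 ?(ltW a0)// ltW// beta_star_const_gt0.
(* From 1 + |x|^2 = (|x|^2 - 1) + 2 and s < |x|^2 - 1. *)
pose c := (1 + 2 / s)^-1; have c0 : 0 < c by rewrite invr_gt0 ltr_pwDl// divr_ge0// ltW.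
have m1 := @measurable_powR_enorm R d 1 (- beta).
apply: (@le_lt_trans _ _ (\int[lebesgue_rV d]_x
    ((c `^ (- beta))%:E * ((1 + enorm x ^+ 2) `^ (- beta))%:E))%E); last first.
  rewrite ge0_integralZl//; last 3 first.
  - exact/measurable_EFinP.
  - by move=> x _; rewrite lee_fin powR_ge0.
  - by rewrite lee_fin powR_ge0.
  by rewrite integral_powR_enorm// -EFinM ltry.
rewrite integral_mkcond; apply: ge0_le_integral => //.
- by move=> x _; apply: erestrict_ge0 => {}x _; exact: beta_kernel_ge0.
- apply/(measurable_restrictT _ (measurable_shell _)).
  by apply: measurable_funTS; exact: measurable_beta_kernel.
- by apply: measurable_funeM; exact/measurable_EFinP.
move=> x _; rewrite patchE; case: ifPn => [|_]; last first.
  by rewrite -EFinM lee_fin mulr_ge0 ?powR_ge0.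
rewrite inE /= => sx; rewrite -EFinM lee_fin.
have x1 : 0 < 1 + enorm x ^+ 2 by rewrite ltr_pwDl// sqr_ge0.
rewrite -powRM ?(ltW c0) ?(ltW x1)//; apply: ge0_powRN_le; first exact: ltW.
  by rewrite mulr_gt0.
rewrite /c mulrC ler_pdivrMr; last by rewrite ltr_pwDl// divr_ge0// ltW.
have : 2 <= 2 / s * (enorm x ^+ 2 - 1).
  by rewrite mulrAC ler_pdivlMr// ler_pM2l// ltW.
lra.
Qed.

Lemma exists_small_powR (p e tau : R) : 0 < p -> 0 < e -> 0 < tau ->
  exists s, 0 < s <= tau /\ s `^ p <= e.
Proof.
move=> p0 ep tau0; pose s := Num.min tau (e `^ p^-1).
have s0 : 0 < s by rewrite lt_min tau0 powR_gt0.
exists s; split; first by rewrite s0 ge_min lexx.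
rewrite -[leRHS](powRr1 (ltW ep)) -[X in e `^ X](mulVf (_ : p != 0)) ?gt_eqF// powRrM.
apply: ge0_ler_powR; rewrite ?nnegrE ?powR_ge0 ?(ltW s0) ?(ltW p0)//.
by rewrite ge_min lexx orbT.
Qed.

(** Atoms with height above [s1] have finite intensity, which goes into [C]; below it s^(-beta) <=
    s1^(b - beta) s^(-b) reduces to the critical estimate. For beta < b a small [s1] lowers the
    coefficient; at beta = b it is lowered by a small slope [k]. *)
Lemma cap_intensity_upper n alpha beta : (0 < n)%N -> 0 < alpha -> n.+1%:R / 2 < beta ->
  beta < n%:R / 2 + 1 \/ beta = n%:R / 2 + 1 /\ alpha < n%:R * pi ->
  exists k a C : R, [/\ 0 < k, 0 <= a < n%:R / 2 &
    forall delta (u : 'rV[R]_n.+1), 0 < delta < 1 -> enorm u = 1 ->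
    (beta_star_intensity alpha beta
      [set x | delta < enorm x ^+ 2 - 1 /\ 1 - k * (enorm x ^+ 2 - 1) < dotp x u]%R
     <= (a * ln delta^-1 + C)%:E)%E].
Proof.
move=> n0 a0 db bcase.
set b := n%:R / 2 + 1 in bcase; pose I := @critical_integral R n.
have I0 : 0 < I := critical_integral_gt0 n.
pose A := alpha * beta_star_const n.+1 beta.
have A0 : 0 < A by rewrite mulr_gt0// beta_star_const_gt0.
have n20 : 0 < n%:R / 2 :> R by rewrite divr_gt0// ltr0n.
pose q := 4 `^ b; have q0 : 0 < q by rewrite powR_gt0.
have [k [s1 [k01 s101 sb coef]]] : exists k s1, [/\ 0 < k <= 1, 0 < s1 <= 1, beta <= b &
    A * s1 `^ (b - beta) * (I / 2 + q * I * k) < n%:R / 2].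
  case: bcase => [bb|[bE al]].
    have X0 : 0 < A * (I / 2 + q * I * 1).
      by have qI : 0 < q * I; rewrite mulr_gt0//; lra.
    have e0 : 0 < n%:R / 4 / (A * (I / 2 + q * I * 1)).
      by rewrite divr_gt0// divr_gt0// ltr0n.
    have bb0 : 0 < b - beta by rewrite subr_gt0.
    have [s [s01 sE]] := exists_small_powR bb0 e0 ltr01.
    exists 1, s; split => //; first by rewrite ltr01 lexx.
      exact: ltW.
    rewrite mulrAC -ltr_pdivlMl//.
    apply: (le_lt_trans sE); rewrite [ltRHS]mulrC ltr_pM2r ?invr_gt0//.
    have nr0 : 0 < n%:R :> R by rewrite ltr0n.
    by lra.
  have pi0 := pi_gt0 R.
  have AI : A * I = alpha / pi.
    by rewrite /A /I -mulrA bE /critical_integral beta_star_const_critical.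
  (* The requirement is alpha/2 + alpha q k < n pi / 2; this [k] spends at most half of the
     available slack. *)
  pose k := Num.min 1 ((n%:R * pi - alpha) / (alpha * q * 4)).
  have k0 : 0 < k by rewrite lt_min ltr01 divr_gt0 ?subr_gt0// !mulr_gt0.
  have kle : k * (alpha * q * 4) <= n%:R * pi - alpha.
    by rewrite -ler_pdivlMr ?mulr_gt0// ge_min lexx orbT.
  exists k, 1; split; rewrite ?ltr01 ?lexx ?k0 ?bE ?lexx//.
    by rewrite ge_min lexx.
  rewrite powR1 mulr1 (_ : _ * _ = alpha / pi * (1 / 2 + q * k)); last first.
    by rewrite -AI; field.
  rewrite mulrAC ltr_pdivrMr// -(ltr_pM2r (_ : 0 < 4))//.
  by lra.
exists k, (A * s1 `^ (b - beta) * (I / 2 + q * I * k)).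
pose V := [set x : 'rV[R]_n.+1 | s1 < enorm x ^+ 2 - 1].
have Vfin : beta_star_intensity alpha beta V \is a fin_num.
  have /andP[s10 _] := s101.
  by rewrite ge0_fin_numE ?beta_star_intensity_shell// beta_star_intensity_ge0//; exact: measurable_shell.
exists (fine (beta_star_intensity alpha beta V) +
  A * s1 `^ (b - beta) * (q * I * (1 + k))).
have /andP[k0 k1] := k01; have /andP[s10 s11] := s101.
split => //.
  have qIk : 0 < q * I * k by apply: mulr_gt0 => //; exact: mulr_gt0.
  rewrite coef andbT; apply: mulr_ge0; first by rewrite mulr_ge0 ?powR_ge0// ltW.
  by lra.
move=> delta u d01 u1; set D := (X in beta_star_intensity _ _ X).
have mD : measurable D.
  apply: measurableI; first exact: measurable_shell.
  apply: measurable_set_lt; last exact: measurable_dotpr.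
  apply: measurable_funB => //; apply: measurable_funM => //; exact: measurable_enorm_sqr_sub.
have mV : measurable V by exact: measurable_shell.
pose W := cap_set (- k) delta 1 u.
have mW : measurable W by exact: measurable_cap_set.
rewrite beta_star_intensityE//.
have key : (\int[lebesgue_rV n.+1]_(x in D) beta_kernel beta x <=
    \int[lebesgue_rV n.+1]_(x in V) beta_kernel beta x +
    (s1 `^ (b - beta))%:E * \int[lebesgue_rV n.+1]_(x in W) beta_kernel b x)%E.
  rewrite -ge0_integralZl//; last 3 first.
  - by apply: measurable_funTS; exact: measurable_beta_kernel.
  - by move=> x _; exact: beta_kernel_ge0.
  - by rewrite lee_fin powR_ge0.
  rewrite (integral_mkcond D) (integral_mkcond V) (integral_mkcond W).
  have mres (C : set 'rV[R]_n.+1) (g : 'rV[R]_n.+1 -> \bar R) :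
      measurable C -> measurable_fun setT g -> measurable_fun setT (g \_ C).
    by move=> mC mg; apply/(measurable_restrictT g) => //; exact: measurable_funTS.
  have mkb := @measurable_beta_kernel R n.+1 beta.
  have mkb' : measurable_fun setT (fun x => ((s1 `^ (b - beta))%:E * @beta_kernel R n.+1 b x)%E).
    by apply: measurable_funeM; exact: measurable_beta_kernel.
  have ge1 (C : set 'rV[R]_n.+1) x : (0 <= (beta_kernel beta \_ C) x)%E.
    by apply: erestrict_ge0 => y _; exact: beta_kernel_ge0.
  have ge2 (C : set 'rV[R]_n.+1) x :
      (0 <= ((fun x => ((s1 `^ (b - beta))%:E * @beta_kernel R n.+1 b x)%E) \_ C) x)%E.
    apply: erestrict_ge0 => y _; apply: mule_ge0; last exact: beta_kernel_ge0.
    by rewrite lee_fin powR_ge0.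
  rewrite -ge0_integralD//; last 2 first.
  - exact: mres.
  - exact: mres.
  apply: ge0_le_integral => //; first exact: mres.
    by apply: emeasurable_funD; exact: mres.
  move=> x _; rewrite [leLHS]patchE; case: ifPn => [|_]; last by rewrite adde_ge0.
  rewrite inE => -[/= dx kx].
  have [xs|xs] := ltP s1 (enorm x ^+ 2 - 1).
    by rewrite [X in (_ <= X + _)%E]patchE ifT ?inE// leeDl.
  rewrite [X in (_ <= _ + X)%E]patchE ifT; last first.
    rewrite inE /W /cap_set/= mulNr; split => //; rewrite dx/=; exact: le_trans s11.
  rewrite -[leLHS]add0e leeD// /beta_kernel -EFinM lee_fin.
  have /andP[d0 d1] := d01.
  have s0 : 0 < enorm x ^+ 2 - 1 by exact: lt_trans dx.
  rewrite [in leLHS](_ : - beta = (b - beta) + - b); last by ring.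
  rewrite powRD ?(gt_eqF s0) ?implybT// ler_wpM2r ?powR_ge0//.
  apply: ge0_ler_powR => //.
  - by rewrite subr_ge0.
  - by rewrite nnegrE ltW.
  - by rewrite nnegrE ltW.
apply: (le_trans (lee_wpmul2l _ key)); first by rewrite lee_fin ltW.
rewrite ge0_muleDr; last 2 first.
- by apply: integral_ge0 => x _; exact: beta_kernel_ge0.
- apply: mule_ge0; first by rewrite lee_fin powR_ge0.
  by apply: integral_ge0 => x _; exact: beta_kernel_ge0.
rewrite -beta_star_intensityE// -[X in (X + _)%E](fineK Vfin) muleA -EFinM.
have As0 : 0 <= A * s1 `^ (b - beta) by rewrite mulr_ge0 ?powR_ge0 ?(ltW A0).
apply: (le_trans (leeD (lexx _) (lee_wpmul2l _ (cap_upper u1 k01 d01)))); first by rewrite lee_fin.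
rewrite -EFinM -EFinD lee_fin -/b -/I -/q le_eqVlt; apply/orP; left; apply/eqP.
rewrite /A; ring.
Qed.

End intensity_estimates.

Section intensity_lower_estimates.
Context {R : realType}.
Local Notation mu := (@lebesgue_measure R).
Implicit Types (alpha beta : R).

(** On s <= s1 the inequality s^(-beta) >= s1^(b - beta) s^(-b) reduces to the critical estimate.
    For beta > b a small [s1] outweighs every fixed loss, while at beta = b the losses from the
    truncation and from the range of heights must both fit into the excess of alpha over n pi. *)
Lemma cap_intensity_lower n alpha beta : (0 < n)%N -> 0 < alpha -> n.+1%:R / 2 < beta ->
  n%:R / 2 + 1 < beta \/ beta = n%:R / 2 + 1 /\ n%:R * pi < alpha ->
  exists k s1 a C d0 : R, [/\ 0 < k, n%:R / 2 < a, 0 < d0 &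
    forall delta (u : 'rV[R]_n.+1), 0 < delta < d0 -> enorm u = 1 ->
    ((a * ln delta^-1 - C)%:E <= beta_star_intensity alpha beta (cap_set k delta s1 u))%E].
Proof.
move=> n0 a0 db bcase.
set b := n%:R / 2 + 1 in bcase; have [I IE] : exists I, I = @critical_integral R n by eexists.
have I0 : 0 < I by rewrite IE critical_integral_gt0.
have [I2 I2E] : exists I2, I2 = @beta_integral R n (n%:R / 2 + 1 / 2) by eexists.
have I20 : 0 < I2 by rewrite I2E beta_integral_gt0// ltrDl.
have [A AE] : exists A, A = alpha * beta_star_const n.+1 beta by eexists.
have A0 : 0 < A by rewrite AE mulr_gt0// beta_star_const_gt0.
have nr0 : 0 < n%:R :> R by rewrite ltr0n.
have [M [t0 [M0 t001 bb IM coef]]] : exists M t0 : R, [/\ 0 < M, 0 < t0 < 1, b <= beta,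
    I2 / M <= I &
    n%:R / 2 < A * (3 * (1 + M ^+ 2) * t0) `^ (b - beta) * ((I - I2 / M) / (2 + t0))].
  case: bcase => [bb|[bE al]].
    (* The truncation loses half of [I]. Since [t0] stays at most 1/2, the last factor of the
       coefficient is at least I/6, and [e] is chosen to make the coefficient at least n. *)
    pose M := 2 * I2 / I; have M0 : 0 < M by rewrite divr_gt0// mulr_gt0.
    have IM : I2 / M = I / 2 by rewrite /M; field; rewrite !gt_eqF.
    pose L := 3 * (1 + M ^+ 2).
    have L0 : 0 < L by rewrite mulr_gt0// ltr_pwDl// sqr_ge0.
    pose e := A * (I / 6) / n%:R.
    have e0 : 0 < e by rewrite divr_gt0// mulr_gt0//; lra.
    have bb0 : 0 < beta - b by rewrite subr_gt0.
    have tau0 : 0 < L / 2 by rewrite divr_gt0.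
    have [s [/andP[s0 sL] sE]] := exists_small_powR bb0 e0 tau0.
    exists M, (s / L); split => //; last 2 first.
    - by rewrite IM; lra.
    - rewrite -/L [L * _]mulrC divfK ?gt_eqF// IM -(opprB beta) powRN.
      have sp : 0 < s `^ (beta - b) by rewrite powR_gt0.
      have sL2 : s / L <= 1 / 2 by rewrite ler_pdivrMr//; lra.
      have sL0 : 0 < s / L by rewrite divr_gt0.
      apply: (@lt_le_trans _ _ (A * e^-1 * (I / 6))).
        have -> : A * e^-1 * (I / 6) = n%:R.
          by rewrite /e; field; rewrite !gt_eqF.
        lra.
      apply: ler_pM.
      + by apply: mulr_ge0; rewrite ?invr_ge0 ltW.
      + lra.
      + by rewrite ler_wpM2l ?(ltW A0)// lef_pV2.
      + by rewrite ler_pdivlMr; nra.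
    - rewrite divr_gt0//= ltr_pdivrMr//; lra.
    - exact: ltW.
  have pi0 := pi_gt0 R.
  have AI : A * I = alpha / pi.
    by rewrite AE IE -mulrA bE /critical_integral beta_star_const_critical.
  have [q qE] : exists q, q = alpha / (n%:R * pi) by eexists.
  have q1 : 1 < q by rewrite qE ltr_pdivlMr ?mul1r// mulr_gt0.
  (* The truncation uses a quarter of the relative slack q - 1. Three quarters remain, and dividing
     by 2 + t0 with t0 <= q - 1 costs at most a half. *)
  pose eta := (q - 1) / (4 * q).
  have eta0 : 0 < eta by rewrite divr_gt0//; lra.
  have qeta : q * (1 - eta) = 1 + 3 / 4 * (q - 1).
    by rewrite /eta; field; rewrite gt_eqF//; lra.
  have eta1 : eta < 1 by rewrite ltr_pdivrMr; lra.
  pose M := I2 / (I * eta).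
  have M0 : 0 < M by apply: divr_gt0 => //; exact: mulr_gt0.
  have IM : I2 / M = I * eta by rewrite /M; field; rewrite !gt_eqF.
  pose t0 := Num.min (1 / 2) (q - 1).
  have t00 : 0 < t0 by rewrite lt_min; apply/andP; split; lra.
  have t01 : t0 <= 1 / 2 by rewrite ge_min lexx.
  have t02 : t0 <= q - 1 by rewrite ge_min lexx orbT.
  exists M, t0; split => //.
  - by rewrite t00/=; lra.
  - by rewrite bE.
  - by rewrite IM ler_piMr// ltW.
  rewrite bE subrr powRr0 mulr1 IM.
  have -> : A * ((I - I * eta) / (2 + t0)) = n%:R * (q * (1 - eta)) / (2 + t0).
    rewrite (_ : n%:R * (q * (1 - eta)) = A * I * (1 - eta)); last first.
      rewrite AI qE; move: pi0; move: (@pi R) => p p0.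
      by field; rewrite (gt_eqF p0) (gt_eqF nr0).
    by field; rewrite gt_eqF//; lra.
  rewrite qeta ltr_pdivlMr; last by lra.
  by rewrite mulrAC -mulrA ltr_pM2l//; lra.
have /andP[t00 t01] := t001.
set L := 3 * (1 + M ^+ 2) in coef.
have L0 : 0 < L by rewrite mulr_gt0// ltr_pwDl// sqr_ge0.
pose s1 := L * t0; have s10 : 0 < s1 by rewrite mulr_gt0.
pose a := A * s1 `^ (b - beta) * ((I - I2 / M) / (2 + t0)).
exists L^-1, s1, a, (a * - ln t0), t0; split => //; first by rewrite invr_gt0.
move=> delta u dt u1; have /andP[d0 dt0] := dt.
rewrite beta_star_intensityE//; last exact: measurable_cap_set.
rewrite -AE; have As0 : 0 <= A * s1 `^ (b - beta) by rewrite mulr_ge0 ?powR_ge0 ?(ltW A0).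
rewrite IE I2E in IM; have low := cap_lower u1 M0 t001 dt IM; rewrite -IE -I2E in low.
apply: (@le_trans _ _ ((A * s1 `^ (b - beta))%:E *
    \int[lebesgue_rV n.+1]_(x in cap_set L^-1 delta s1 u) beta_kernel b x)%E).
  apply: le_trans (lee_wpmul2l _ low); last by rewrite lee_fin.
  rewrite -EFinM lee_fin lnV ?posrE// le_eqVlt; apply/orP; left; apply/eqP.
  by rewrite /a; ring.
rewrite EFinM -muleA lee_wpmul2l ?lee_fin ?(ltW A0)// -ge0_integralZl//; last 4 first.
- exact: measurable_cap_set.
- by apply: measurable_funTS; exact: measurable_beta_kernel.
- by move=> x _; exact: beta_kernel_ge0.
- by rewrite lee_fin powR_ge0.
apply: ge0_le_integral => //.
- exact: measurable_cap_set.
- by move=> x _; apply: mule_ge0; rewrite ?lee_fin ?powR_ge0.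
- by apply: measurable_funeM; apply: measurable_funTS; exact: measurable_beta_kernel.
- by apply: measurable_funTS; exact: measurable_beta_kernel.
move=> x [/andP[dx xs] _]; rewrite /beta_kernel -EFinM lee_fin.
have s0 : 0 < enorm x ^+ 2 - 1 by exact: lt_trans dx.
rewrite [in leRHS](_ : - beta = (b - beta) + - b); last by ring.
rewrite [in leRHS]powRD ?(gt_eqF s0) ?implybT// ler_wpM2r ?powR_ge0// -(opprB beta).
by apply: ge0_powRN_le => //; rewrite subr_ge0.
Qed.

(** With the transversal coordinate y fixed and c = sqrt (1 - |y|^2), the height is s = (t - c) (t +
    c) <= 3 (t - c) <= 1, so s^(-beta) >= 1 / (3 (t - c)) as beta >= 1. The integral in t diverges
    logarithmically for every small y. *)
Lemma beta_star_intensity_sphere n alpha beta (p : 'rV[R]_n.+1) (e : R) :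
  0 < alpha -> n.+1%:R / 2 < beta -> 1 <= beta -> enorm p = 1 -> 0 < e ->
  (beta_star_intensity alpha beta [set x | 1 < enorm x /\ enorm (x - p) < e]%R = +oo)%E.
Proof.
move=> a0 db b1 p1 ep.
pose Q (r t : R) := 1 < r /\ r ^+ 2 - 2 * t + 1 < e ^+ 2.
have -> : [set x | 1 < enorm x /\ enorm (x - p) < e] = [set x | Q (enorm x) (dotp x p)].
  have E x : (enorm (x - p) < e) = (enorm x ^+ 2 - 2 * dotp x p + 1 < e ^+ 2).
    rewrite -(@ltr_pXn2r _ 2)// ?nnegrE ?enorm_ge0 ?(ltW ep)// enormB_sqr p1 expr1n.
    by rewrite mulr_natl.
  by apply/seteqP; split => x /=; rewrite /Q E.
have mQ (u : 'rV[R]_n.+1) : measurable [set x : 'rV[R]_n.+1 | Q (enorm x) (dotp x u)].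
  apply: measurableI; first by apply: measurable_set_lt => //; exact: measurable_enorm.
  apply: measurable_set_lt => //; apply: measurable_funD => //; apply: measurable_funB.
    by apply: measurable_funX; exact: measurable_enorm.
  by apply: measurable_funM => //; exact: measurable_dotpr.
rewrite beta_star_intensityE//.
rewrite (@integral_rotate R n p Q (fun r => ((r ^+ 2 - 1) `^ (- beta))%:E))//; last 2 first.
- apply/measurable_EFinP; apply: (measurableT_comp (measurable_powR _)).
  by apply: measurable_funB => //; exact: measurable_funX.
- by move=> r; rewrite lee_fin powR_ge0.
suff -> : (\int[lebesgue_rV n.+1]_(x in [set x | Q (enorm x) (dotp x (e0 n))])
    ((enorm x ^+ 2 - 1) `^ (- beta))%:E = +oo)%E.
  by rewrite gt0_muley// lte_fin mulr_gt0// beta_star_const_gt0.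
pose eta := Num.min (1 / 3) (e / 2).
have eta0 : 0 < eta by rewrite lt_min; apply/andP; split; lra.
have eta3 : eta <= 1 / 3 by rewrite ge_min lexx.
have etae : eta <= e / 2 by rewrite ge_min lexx orbT.
pose D := [set x : 'rV[R]_n.+1 | Q (enorm x) (dotp x (e0 n))].
pose f := (@beta_kernel R n.+1 beta) \_ D.
have mf : measurable_fun setT f.
  apply/(measurable_restrictT _ (mQ _)).
  by apply: measurable_funTS; exact: measurable_beta_kernel.
have f0 x : (0 <= f x)%E by apply: erestrict_ge0 => y _; exact: beta_kernel_ge0.
have mc : measurable_fun setT (@rV_cons R n : measurableTypeR R * 'rV[R]_n -> 'rV[R]_n.+1).
  exact: measurable_rV_cons.
pose B := [set y : 'rV[R]_n | enorm y < eta].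
have mB : measurable B := measurable_ball_enorm eta.
have B0 : (0 < lebesgue_rV n B)%E := lebesgue_rV_ball_gt0 eta0.
have Bfin : lebesgue_rV n B \is a fin_num.
  by rewrite ge0_fin_numE// lebesgue_rV_ball_lty.
pose l := fine (lebesgue_rV n B).
have l0 : 0 < l by rewrite -lte_fin /l fineK.
apply/eqyP => N N0.
(* With this lower cut (ln eta - ln delta) / 3 = N / l, and integrating over a ball of volume [l]
   returns [N]. *)
pose delta := eta * expR (- (3 * N / l)).
have N3 : 0 < 3 * N / l by rewrite divr_gt0// mulr_gt0.
have d0 : 0 < delta by rewrite mulr_gt0// expR_gt0.
have deta : delta < eta by rewrite gtr_pMr// -[ltRHS]expR0 ltr_expR; lra.
rewrite integral_mkcond.
rewrite (_ : (\int[_]_x _)%E = \int[lebesgue_rV n.+1]_x f x)%E// ge0_integral_lebesgue_rVS//.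
rewrite (@fubini_tonelli _ _ _ _ _ mu (lebesgue_rV n) (f \o @rV_cons R n)); last 2 first.
- exact: (measurableT_comp mf mc).
- by move=> x; exact: f0.
apply: (@le_trans _ _ (\int[lebesgue_rV n]_(y in B) (N / l)%:E)%E).
  have -> : (\int[lebesgue_rV n]_(y in B) (N / l)%:E = (N / l)%:E * lebesgue_rV n B)%E.
    exact: integral_cst.
  by rewrite -(fineK Bfin) -/l -EFinM divfK// gt_eqF.
rewrite integral_mkcond; apply: ge0_le_integral => //.
- by move=> y _; apply: erestrict_ge0 => z _; rewrite lee_fin divr_ge0// ltW.
- by apply/(measurable_restrictT _ mB).
- by apply: (@measurable_fun_fubini_tonelli_G _ _ _ _ _ mu (f \o @rV_cons R n)) => //;
    [exact: (measurableT_comp mf mc)|move=> x; exact: f0].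
move=> y _; rewrite patchE; case: ifPn => [|_]; last by apply: integral_ge0 => t _; exact: f0.
rewrite inE /B/= => yeta.
have r0 := enorm_ge0 y.
have y1 : enorm y ^+ 2 < eta ^+ 2 by rewrite ltr_pXn2r// nnegrE// ltW.
pose c := Num.sqrt (1 - enorm y ^+ 2).
have cE : c ^+ 2 = 1 - enorm y ^+ 2 by rewrite sqr_sqrtr//; nra.
have c0 : 0 <= c by rewrite sqrtr_ge0.
have c1 : c <= 1 by rewrite -(@ler_pXn2r _ 2)// ?nnegrE// cE expr1n lerBlDr lerDl sqr_ge0.
have ceta : 1 - eta ^+ 2 <= c.
  rewrite -(@ler_pXn2r _ 2)// ?nnegrE//; last by nra.
  have e21 : eta ^+ 2 <= 1 by nra.
  have e4 : eta ^+ 2 * eta ^+ 2 <= eta ^+ 2 by rewrite ler_piMl// sqr_ge0.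
  by rewrite cE; nra.
pose E : set R := `[c + delta, c + eta]%classic.
apply: (@le_trans _ _ (\int[mu]_(t in E) ((3^-1)%:E * ((t - c)^-1)%:E))%E).
  rewrite integral_scaled_inv_right//; last 2 first.
  - by rewrite ltrDl.
  - by rewrite ltrD2l.
  rewrite lee_fin ![c + _ - c]addrAC subrr !add0r /delta lnM ?posrE ?expR_gt0// expRK.
  by rewrite le_eqVlt; apply/orP; left; apply/eqP; field; rewrite gt_eqF.
rewrite integral_mkcond; apply: ge0_le_integral => //.
- move=> t _; apply: erestrict_ge0 => {}t; rewrite /E/= in_itv/= => /andP[t1 _].
  by apply: mule_ge0; rewrite lee_fin ?invr_ge0; lra.
- apply/(measurable_restrictT _ (measurable_itv _)).
  apply: measurable_funeM; apply/measurable_EFinP; apply: ge0_measurable_funV.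
    exact: measurable_funB.
  by move=> t; rewrite /E/= in_itv/= => /andP[t1 _]; lra.
- apply: (measurableT_comp mf); apply: (measurableT_comp mc); exact: measurable_pair2.
move=> t _; rewrite patchE; case: ifPn => [|_]; last exact: f0.
rewrite inE /E/= in_itv/= => /andP[t1 t2].
have sE : t ^+ 2 - 1 + enorm y ^+ 2 = (t - c) * (t + c) by rewrite -subr_sqr cE; ring.
have tc0 : 0 < t - c by lra.
have s3 : (t - c) * (t + c) <= 3 * (t - c) by rewrite mulrC ler_wpM2r//; lra.
have s0 : 0 < (t - c) * (t + c) by rewrite mulr_gt0//; nra.
rewrite /f patchE ifT.
  rewrite /beta_kernel enorm_rV_cons_sub1 sE -EFinM -invfM lee_fin.
  apply: (@le_trans _ _ ((t - c) * (t + c))^-1); first by rewrite lef_pV2// posrE//; lra.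
  rewrite -powR_inv1 ?(ltW s0)//; apply: ger_powR; last by rewrite lerN2.
  by rewrite s0/=; lra.
rewrite inE /D/= /Q dotp_e0 enorm_rV_cons; split.
  rewrite -(@ltr_pXn2r _ 2)// ?nnegrE ?enorm_ge0// enorm_rV_cons expr1n.
  by rewrite -subr_gt0 addrAC sE.
have ee : eta ^+ 2 <= eta by nra.
have l1 : 0 <= eta - (t - 1) by lra.
have l2 : 0 <= eta + (t - 1) by lra.
have := mulr_ge0 l1 l2.
have e2 : eta ^+ 2 * 4 <= e ^+ 2 by nra.
by nra.
Qed.

End intensity_lower_estimates.

(** * Convex hulls *)

Section ultralimits.
Context {R : realType}.

Lemma eventually_ultrafilter : exists U : set_system nat, UltraFilter U /\ \oo `<=` U.
Proof. exact: ultraFilterLemma. Qed.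

(** Compactness of [-M, M] provides a cluster point, and an ultrafilter converges to each of its
    cluster points. *)
Lemma bounded_ultralimit (U : set_system nat) (f : nat -> R) (M : R) :
  UltraFilter U -> (forall k, `|f k| <= M) -> exists l : R, f @ U --> l.
Proof.
move=> UU fM.
have UP : ProperFilter U by exact: ultra_proper.
have FF : ProperFilter (f @ U) by exact: fmap_proper_filter.
have [l [_ ll]] : `[- M, M]%classic `&` cluster (f @ U) !=set0.
  apply: (@segment_compact R (- M) M) => //.
  by apply: (@filterE _ U) => k; rewrite /= in_itv/= -ler_norml; exact: fM.
exists l => V lV; rewrite /= /fmap/=.
have [//|nV] := in_ultra_setVsetC (f @^-1` V) UU.
have [z [/= zV]] := ll (~` V) V nV lV.
by [].
Qed.

End ultralimits.

Section convex_combinations.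
Context {R : realType} {d : nat}.
Implicit Types (A C : set 'rV[R]_d).

Definition weights n : set ('I_n -> R) :=
  [set w | (forall i, 0 <= w i) /\ \sum_i w i = 1].

Definition barycenter n (w : 'I_n -> R) (x : 'I_n -> 'rV[R]_d) : 'rV[R]_d :=
  \sum_i w i *: x i.

Lemma convex_setP C : @convex_set R 'rV[R]_d C <->
  forall x y t, 0 <= t <= 1 -> C x -> C y -> C (t *: x + (1 - t) *: y).
Proof.
split=> [cC x y t t01 Cx Cy|cC].
  pose l : {i01 R} := Itv01 (proj1 (andP t01)) (proj2 (andP t01)).
  by have := cC x y l; rewrite !inE => /(_ Cx Cy).
move=> x y l; rewrite !inE => Cx Cy.
by apply: cC => //; rewrite ge0 le1.
Qed.

Lemma convex_barycenter C n (w : 'I_n -> R) (x : 'I_n -> 'rV[R]_d) :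
  @convex_set R 'rV[R]_d C -> weights w -> (forall i, C (x i)) -> C (barycenter w x).
Proof.
move=> /convex_setP cC; elim: n w x => [|n IH] w x [w0 w1] Cx.
  by move/eqP: w1; rewrite big_ord0 eq_sym oner_eq0.
rewrite /barycenter big_ord_recl; move: w1; rewrite big_ord_recl => w1.
have s0 : 0 <= \sum_(i < n) w (lift ord0 i) by apply: sumr_ge0.
have [s00|sn0] := eqVneq (\sum_(i < n) w (lift ord0 i)) 0.
  move: w1; rewrite s00 addr0 => ->.
  rewrite big1 ?addr0 ?scale1r// => i _.
  move/eqP: s00; rewrite psumr_eq0// => /allP/(_ i (mem_index_enum _))/= /eqP ->.
  by rewrite scale0r.
have sE : \sum_(i < n) w (lift ord0 i) = 1 - w ord0 by rewrite -w1 addrC addKr.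
have -> : \sum_(i < n) w (lift ord0 i) *: x (lift ord0 i) =
    (1 - w ord0) *: barycenter (fun i => w (lift ord0 i) / (1 - w ord0)) (fun i => x (lift ord0 i)).
  rewrite /barycenter scaler_sumr; apply: eq_bigr => i _.
  by rewrite scalerA mulrC divfK// -sE.
apply: cC => //; first by rewrite w0/= -subr_ge0 -sE.
apply: IH => // ; split=> [i|]; first by rewrite divr_ge0// -sE.
by rewrite -mulr_suml sE divff// -sE.
Qed.

Lemma barycenterD n m (w : 'I_n -> R) (w' : 'I_m -> R)
    (x : 'I_n -> 'rV[R]_d) (x' : 'I_m -> 'rV[R]_d) (t : R) :
  0 <= t <= 1 -> weights w -> weights w' ->
  exists v : 'I_(n + m) -> R, weights v /\
    t *: barycenter w x + (1 - t) *: barycenter w' x' =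
    barycenter v (fun k => match fintype.split k with inl i => x i | inr j => x' j end).
Proof.
move=> /andP[t0 t1] [w0 w1] [w0' w1'].
have sl i : fintype.split (lshift m i) = inl i :> 'I_n + 'I_m := unsplitK (inl i).
have sr j : fintype.split (rshift n j) = inr j :> 'I_n + 'I_m := unsplitK (inr j).
exists (fun k => match fintype.split k with inl i => t * w i | inr j => (1 - t) * w' j end).
split; [split|] => [k||].
- by case: (fintype.split k) => i; rewrite mulr_ge0// subr_ge0.
- rewrite big_split_ord/=; under eq_bigr do rewrite sl.
  under [X in _ + X]eq_bigr do rewrite sr.
  by rewrite -!mulr_sumr w1 w1'; ring.
- rewrite /barycenter big_split_ord/=; under [in RHS]eq_bigr do rewrite sl.
  under [X in _ = _ + X]eq_bigr do rewrite sr.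
  by rewrite !scaler_sumr; congr (_ + _); apply: eq_bigr => i _; rewrite scalerA.
Qed.

Lemma conv_hullE A : conv_hull A = [set y | exists n (x : 'I_n -> 'rV[R]_d) w,
  [/\ weights w, forall i, A (x i) & y = barycenter w x]].
Proof.
apply/seteqP; split => [y|y [n [x [w [ww Ax ->]]]]]; last first.
  move=> C [cC AsubC]; apply: convex_barycenter => // i; exact: AsubC.
apply; split.
  apply/convex_setP => a b t t01 [n [x [w [ww Ax ->]]]] [m [x' [w' [ww' Ax' ->]]]].
  have [v [wv ->]] := barycenterD x x' t01 ww ww'.
  exists (n + m)%N, (fun k => match fintype.split k with inl i => x i | inr j => x' j end), v.
  by split => // k; case: (fintype.split k).
move=> x Ax; exists 1%N, (fun=> x), (fun=> 1).
split=> //; first by split=> [i|]; rewrite ?ler01 ?big_ord1.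
by rewrite /barycenter big_ord1 scale1r.
Qed.

Lemma sub_conv_hull A : A `<=` conv_hull A.
Proof. by move=> x Ax C [_]; apply. Qed.

Lemma convex_conv_hull A : @convex_set R 'rV[R]_d (conv_hull A).
Proof.
by apply/convex_setP => x y t t01 Ax Ay C CA; apply: (proj1 (convex_setP C) CA.1) => //;
  [exact: Ax|exact: Ay].
Qed.

Lemma conv_hull_sub A C : @convex_set R 'rV[R]_d C -> A `<=` C -> conv_hull A `<=` C.
Proof. by move=> cC AC x; apply. Qed.

(** The generators are an indexed family, repetitions allowed, so that limits can be taken index by
    index. For [n = 0] the set is empty, as no empty family of weights sums to 1. *)
Definition simplex_hull n (x : 'I_n -> 'rV[R]_d) : set 'rV[R]_d :=
  [set y | exists2 w, weights w & y = barycenter w x].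

Lemma convex_simplex_hull n (x : 'I_n -> 'rV[R]_d) :
  @convex_set R 'rV[R]_d (simplex_hull x).
Proof.
apply/convex_setP => a b t /andP[t0 t1] [w [w0 w1] ->] [w' [w0' w1'] ->].
exists (fun i => t * w i + (1 - t) * w' i).
  split=> [i|]; first by rewrite addr_ge0// mulr_ge0// subr_ge0.
  by rewrite big_split/= -!mulr_sumr w1 w1'; ring.
rewrite /barycenter !scaler_sumr -big_split/=; apply: eq_bigr => i _.
by rewrite !scalerA scalerDl.
Qed.

Lemma mem_simplex_hull n (x : 'I_n -> 'rV[R]_d) i : simplex_hull x (x i).
Proof.
exists (fun j => (j == i)%:R).
  split=> [j|]; first by rewrite ler0n.
  by rewrite (bigD1 i)//= eqxx big1 ?addr0// => j /negbTE ->.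
rewrite /barycenter (bigD1 i)//= eqxx scale1r big1 ?addr0// => j /negbTE ->.
by rewrite scale0r.
Qed.

Lemma conv_hull_range n (x : 'I_n -> 'rV[R]_d) : conv_hull (range x) = simplex_hull x.
Proof.
apply/seteqP; split.
  apply: conv_hull_sub; first exact: convex_simplex_hull.
  by move=> _ [i _ <-]; exact: mem_simplex_hull.
move=> _ [w ww ->]; apply: convex_barycenter => //; first exact: convex_conv_hull.
by move=> i; apply: sub_conv_hull; exists i.
Qed.

Lemma finite_set_range S : finite_set S ->
  exists n (x : 'I_n -> 'rV[R]_d), S = range x.
Proof.
move=> /finite_seqP[s ->]; exists (size s), (fun i => nth 0 s i).
apply/seteqP; split => [y /= ys|_ [i _ <-]/=]; last exact: mem_nth.
have := ys; rewrite -index_mem => h; exists (Ordinal h) => //=.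
by rewrite nth_index.
Qed.

Lemma polytopeP K : polytope K <-> exists n (x : 'I_n -> 'rV[R]_d), K = simplex_hull x.
Proof.
split=> [[S /finite_set_range[n [x ->]] ->]|[n [x ->]]].
  by exists n, x; rewrite conv_hull_range.
by exists (range x); rewrite ?conv_hull_range//; exact: finite_image.
Qed.

Lemma barycenter_coord n (w : 'I_n -> R) (x : 'I_n -> 'rV[R]_d) j :
  barycenter w x 0 j = \sum_i w i * x i 0 j.
Proof. by rewrite summxE; apply: eq_bigr => i _; rewrite mxE. Qed.

Lemma weights_le1 n (w : 'I_n -> R) i : weights w -> w i <= 1.
Proof.
by move=> [w0 <-]; rewrite (bigD1 i)//= lerDl sumr_ge0.
Qed.

Lemma barycenterB_norm n (w : 'I_n -> R) (x y : 'I_n -> 'rV[R]_d) (e : R) :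
  weights w -> (forall i, `|x i - y i| <= e) -> `|barycenter w x - barycenter w y| <= e.
Proof.
move=> [w0 w1] xy; rewrite /barycenter -sumrB.
apply: le_trans (ler_norm_sum _ _ _) _.
rewrite -[leRHS]mul1r -w1 mulr_suml; apply: ler_sum => i _.
by rewrite -scalerBr normrZ ger0_norm// ler_wpM2l.
Qed.

(* The bounded weights converge along the ultrafilter, so no subsequence is needed. *)
Lemma barycenter_limit n (x : nat -> 'I_n -> 'rV[R]_d) (x' : 'I_n -> 'rV[R]_d)
    (U : set_system nat) (a : 'rV[R]_d) (w : nat -> 'I_n -> R) :
  UltraFilter U -> \oo `<=` U ->
  (forall i j, x k i 0 j @[k --> U] --> x' i 0 j) ->
  (forall k, weights (w k)) ->
  (forall k, `|a - barycenter (w k) (x k)| <= k.+1%:R^-1) ->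
  simplex_hull x' a.
Proof.
move=> UU ooU xx' ww aw.
have UP : ProperFilter U by exact: ultra_proper.
have /choice[w' w'E] i : exists l : R, w k i @[k --> U] --> l.
  apply: (@bounded_ultralimit R U _ 1) => // k.
  by rewrite ger0_norm ?weights_le1//; exact: (ww k).1.
have U0 (f : nat -> R) (l : R) : f @ \oo --> l -> f @ U --> l.
  by move=> fl; apply: cvg_trans fl => B; exact: ooU.
exists w'.
  split=> [i|].
    apply: (@closed_cvg _ _ U UP (fun k => w k i) [set y : R | 0 <= y]) => //.
    by apply: (@filterE _ U) => k; exact: (ww k).1.
  have : \sum_i w k i @[k --> U] --> \sum_i w' i.
    exact: (@cvg_big R^o 'I_n +%R 0 xpredT (@add_continuous R^o) nat U _ (fun i k => w k i) w').
  have -> : (fun k => \sum_i w k i) = (fun=> 1) by apply/funext => k; rewrite (ww k).2.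
  move=> h; apply: (@cvg_unique R^o (@norm_hausdorff R R^o) (1 @[k --> U])) => //.
  exact: cvg_cst.
apply/rowP => j; rewrite barycenter_coord.
have h1 : \sum_i w k i * x k i 0 j @[k --> U] --> \sum_i w' i * x' i 0 j.
  apply: (@cvg_big R^o 'I_n +%R 0 xpredT (@add_continuous R^o) nat U _
    (fun i k => w k i * x k i 0 j) (fun i => w' i * x' i 0 j)) => i _.
  by apply: cvgM.
apply: (@cvg_unique R^o (@norm_hausdorff R R^o) ((\sum_i w k i * x k i 0 j) @[k --> U])) => //.
apply: U0; apply/cvgrPdist_le => e e0; near=> k.
rewrite -barycenter_coord.
have -> : a 0 j - barycenter (w k) (x k) 0 j = (a - barycenter (w k) (x k)) 0 j by rewrite !mxE.
apply: le_trans (coord_le_norm _ _) _; apply: le_trans (aw k) _.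
near: k; have := near_infty_natSinv_lt (PosNum e0); apply: filterS => k; exact: ltW.
Unshelve. all: by end_near.
Qed.

Lemma closed_simplex_hull n (x : 'I_n -> 'rV[R]_d) : closed (simplex_hull x).
Proof.
move=> a ca.
have /choice[y yP] (k : nat) : exists y, simplex_hull x y /\ `|a - y| <= k.+1%:R^-1.
  have [|y [xy ay]] := ca (ball a k.+1%:R^-1); first by apply: nbhsx_ballx; rewrite invr_gt0.
  by exists y; split=> //; move: ay; rewrite -ball_normE/= => /ltW.
have /choice[w wP] (k : nat) : exists w, weights w /\ y k = barycenter w x.
  by have [[w ww yE] _] := yP k; exists w.
have [U [UU ooU]] := eventually_ultrafilter.
apply: (@barycenter_limit n (fun=> x) x U a w) => //.
- by move=> i j; exact: cvg_cst.
- by move=> k; exact: (wP k).1.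
- by move=> k; rewrite -(wP k).2; exact: (yP k).2.
Qed.

Lemma compact_simplex_hull n (x : 'I_n -> 'rV[R]_d) : compact (simplex_hull x).
Proof.
apply: bounded_closed_compact; last exact: closed_simplex_hull.
exists (\sum_i `|x i|); split; first exact: num_real.
move=> M xM _ [w [w0 w1] ->]; apply: le_trans (ltW xM).
apply: le_trans (ler_norm_sum _ _ _) _; apply: ler_sum => i _.
by rewrite normrZ ger0_norm// ler_piMl// weights_le1.
Qed.

End convex_combinations.

(** * Inscribed balls, polytopes and tangent hyperplanes *)

Section hull_geometry.
Context {R : realType} {d : nat}.
Implicit Types (A C K : set 'rV[R]_d).

Lemma enormB_continuous (z : 'rV[R]_d) : continuous (fun x : 'rV[R]_d => enorm (x - z)).
Proof.
move=> x; apply: (@continuous_comp _ _ _ (fun x : 'rV[R]_d => x - z) (@enorm R d)).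
  exact: (@cvgB _ _ _ (nbhs x) (nbhs_filter x) id (cst z) x z cvg_id (@cvg_cst _ _ _ _ (nbhs_filter x))).
exact: enorm_continuous.
Qed.

Lemma closed_le_fun (f g : 'rV[R]_d -> R) : continuous f -> continuous g ->
  closed [set x | f x <= g x].
Proof.
move=> cf cg; rewrite (_ : mkset _ = (fun x : 'rV[R]_d => g x - f x) @^-1` [set y : R | 0 <= y]); last first.
  by apply/seteqP; split => x /=; rewrite subr_ge0.
apply: closed_comp; last exact: closed_ge.
move=> x _.
exact: (@cvgB _ R^o _ (nbhs x) (nbhs_filter x) g f _ _ (cg x) (cf x)).
Qed.

Lemma closure_unit_ball : closure (@unit_ball R d) = [set x | enorm x <= 1].
Proof.
apply/seteqP; split=> [|x /= x1].
  apply: (@subset_trans _ (closure [set x : 'rV[R]_d | enorm x <= 1])).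
    by apply: closure_subset => x /ltW.
  have /closure_id <- // : closed [set x : 'rV[R]_d | enorm x <= 1].
  by apply: closed_le_fun; [exact: enorm_continuous|exact: cst_continuous].
move=> B /nbhs_ballP[e /= e0 xB].
pose t := Num.min 1 (e / 2) / (1 + `|x|).
have x0 : 0 < 1 + `|x| by rewrite ltr_pwDl.
have m0 : 0 < Num.min 1 (e / 2) by rewrite lt_min ltr01 divr_gt0.
have t0 : 0 < t by rewrite divr_gt0.
have tx : t * (1 + `|x|) <= e / 2 by rewrite divfK ?gt_eqF// ge_min lexx orbT.
have t1 : t <= 1.
  rewrite ler_pdivrMr// mul1r ge_min; apply/orP; left.
  by rewrite lerDl.
exists ((1 - t) *: x); split.
  rewrite /unit_ball/= enormZ ger0_norm ?subr_ge0//.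
  apply: (@le_lt_trans _ _ ((1 - t) * 1)); first by rewrite ler_wpM2l// subr_ge0.
  by lra.
apply: xB; rewrite -ball_normE/= scalerBl scale1r subKr normrZ ger0_norm ?ltW//.
apply: (@le_lt_trans _ _ (t * (1 + `|x|))); last by lra.
by rewrite ler_wpM2l ?(ltW t0)// lerDr.
Qed.

(** The point [p] is the projection of [z]. If some [y] of the hull made an acute angle with
    [z - p], a small move from [p] towards [y] would come closer to [z]. *)
Lemma nearest_point n (x : 'I_n -> 'rV[R]_d) (z : 'rV[R]_d) : (0 < n)%N ->
  exists2 p, simplex_hull x p & forall y, simplex_hull x y -> dotp (y - p) (z - p) <= 0.
Proof.
move=> n0.
have ne : simplex_hull x !=set0 by exists (x (Ordinal n0)); exact: mem_simplex_hull.
have [p] := compact_EVT_min ne (@compact_simplex_hull R d n x)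
  (continuous_subspaceT (@enormB_continuous z)).
rewrite inE => px pmin; exists p => // y xy; rewrite leNgt; apply/negP => q0.
set q := dotp (y - p) (z - p) in q0.
pose Y := enorm (y - p) ^+ 2; have Y0 : 0 <= Y by rewrite sqr_ge0.
pose t := Num.min 1 (q / (Y + 1)).
have Y1 : 0 < Y + 1 by rewrite ltr_wpDl.
have t0 : 0 < t by rewrite lt_min ltr01 divr_gt0.
have t1 : t <= 1 by rewrite ge_min lexx.
have tq : t * (Y + 1) <= q by rewrite -ler_pdivlMr// ge_min lexx orbT.
have xt : simplex_hull x (t *: y + (1 - t) *: p).
  by apply: (proj1 (convex_setP _) (@convex_simplex_hull R d n x)) => //; rewrite t1 ltW.
have := pmin _ (mem_set xt).
have -> : t *: y + (1 - t) *: p - z = t *: (y - p) - (z - p).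
  by apply/rowP => i; rewrite !mxE; ring.
rewrite -(@ler_pXn2r _ 2)// ?nnegrE ?enorm_ge0// (enormBC p) (enormB_sqr (t *: _)).
rewrite dotpZl -/q enormZ exprMn real_normK ?num_real// -/Y.
by nra.
Qed.

(** Separation: if [z] differs from its projection [p] and [v] is the unit vector along [z - p],
    then every generator has <x, v> <= <p, v> <= <z, v> <= r, against the hypothesis. *)
Lemma ball_sub_simplex_hull n (x : 'I_n -> 'rV[R]_d) (r : R) : (0 < n)%N ->
  (forall v, enorm v = 1 -> exists i, r < dotp (x i) v) ->
  [set z | enorm z <= r] `<=` simplex_hull x.
Proof.
move=> n0 xr z /= zr; have [p px pz] := nearest_point x z n0.
have [->//|zp] := eqVneq z p.
have zp0 : 0 < enorm (z - p) by rewrite enorm_gt0 subr_eq0.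
pose v := (enorm (z - p))^-1 *: (z - p).
have v1 : enorm v = 1 by rewrite enormZ ger0_norm ?invr_ge0 ?enorm_ge0// mulVf// gt_eqF.
have [i ri] := xr v v1.
have xp : dotp (x i) v <= dotp p v.
  rewrite -subr_le0 -dotpBl dotpZr pmulr_rle0 ?invr_gt0//.
  exact: (pz _ (mem_simplex_hull x i)).
have pzv : dotp p v <= dotp z v.
  by rewrite -subr_ge0 -dotpBl dotpZr mulr_ge0 ?invr_ge0 ?enorm_ge0// dotp_ge0.
have zv : dotp z v <= r by apply: le_trans (dotp_le _ _) _; rewrite v1 mulr1.
by exfalso; lra.
Qed.

Lemma closed_conv_hull_sub A C : @convex_set R 'rV[R]_d C -> closed C -> A `<=` C ->
  closed_conv_hull A `<=` C.
Proof.
move=> cC clC AC; rewrite (closure_id C).1//.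
by apply: closure_subset; exact: conv_hull_sub.
Qed.

Lemma sub_closed_conv_hull A : conv_hull A `<=` closed_conv_hull A.
Proof. exact: subset_closure. Qed.

Lemma has_dim_full K (r : R) : 0 < r -> [set z | enorm z <= r] `<=` K -> has_dim K d.
Proof.
move=> r0 rK; exists 0, fullv; split; first by rewrite dimvf /dim/= mul1n.
apply/seteqP; split=> [y _|y _].
  by exists y; rewrite ?add0r//= memvf.
move=> M [aM KM].
have M0 : M 0 by apply: KM; apply: rK; rewrite /= enorm0 ltW.
have [->//|y0] := eqVneq y 0.
pose t := enorm y / r.
have en0 : 0 < enorm y by rewrite enorm_gt0.
have t0 : t != 0 by rewrite gt_eqF// divr_gt0.
have My : M (t^-1 *: y).
  apply: KM; apply: rK; rewrite /= enormZ ger0_norm ?invr_ge0 ?divr_ge0 ?(ltW en0) ?(ltW r0)//.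
  by rewrite /t invfM invrK mulrAC mulVf ?mul1r// gt_eqF.
have := aM 0 (t^-1 *: y) t M0 My.
by rewrite scaler0 add0r scalerA divff// scale1r.
Qed.

(** A point with <x, v> > r has norm above [r], so the finitely many points outside the ball already
    reach beyond [r] in every direction. Their hull contains the ball of radius [r], and with it all
    remaining points of [A]. *)
Lemma polytope_of_directions A (r : R) : (0 < d)%N -> 1 < r ->
  finite_set (A `&` [set x | r < enorm x]) ->
  (forall v, enorm v = 1 -> exists2 x, A x & r < dotp x v) ->
  [/\ polytope (closed_conv_hull A), has_dim (closed_conv_hull A) d &
      (1 < ball_radius (closed_conv_hull A))%E].
Proof.
move=> d0 r1 /finite_set_range[n [x xE]] Ar.
have xi i : A (x i) by have : range x (x i) by [exists i]; rewrite -xE => -[].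
have xr v : enorm v = 1 -> exists i, r < dotp (x i) v.
  move=> v1; have [y Ay ry] := Ar v v1.
  have : (A `&` [set x | r < enorm x]) y.
    by split=> //=; apply: (lt_le_trans ry); rewrite -[leRHS]mulr1 -v1 dotp_le.
  by rewrite xE => -[i _ yE]; exists i; rewrite yE.
have n0 : (0 < n)%N.
  have [|[i ltin] _] := xr (delta_mx 0 (Ordinal d0)); last exact: leq_ltn_trans ltin.
  rewrite enormE /dotp (bigD1 (Ordinal d0))//= !mxE !eqxx mulr1 big1 ?addr0 ?sqrtr1//.
  by move=> j /negbTE jd; rewrite !mxE jd mulr0.
have rC := ball_sub_simplex_hull n0 xr.
have AC : A `<=` simplex_hull x.
  move=> y Ay; have [yr|yr] := leP (enorm y) r; first exact: rC.
  have : (A `&` [set x | r < enorm x]) y by [].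
  by rewrite xE => -[i _ <-]; exact: mem_simplex_hull.
have KE : closed_conv_hull A = simplex_hull x.
  apply/seteqP; split.
    apply: closed_conv_hull_sub => //; first exact: convex_simplex_hull.
    exact: closed_simplex_hull.
  move=> _ [w ww ->]; apply: sub_closed_conv_hull.
  apply: convex_barycenter => //; first exact: convex_conv_hull.
  by move=> i; apply: sub_conv_hull.
have rpos : 0 < r by lra.
rewrite KE; split.
- by apply/polytopeP; exists n, x.
- exact: (has_dim_full rpos rC).
- apply: (@lt_le_trans _ _ r%:E); first by rewrite lte_fin.
  apply: ereal_sup_ubound; exists r => //; split => // _ [y + <-].
  rewrite closure_unit_ball => /= y1; apply: rC.
  by rewrite /= enormZ gtr0_norm// ler_piMr// ltW.
Qed.

Lemma enorm_normalize (v : 'rV[R]_d) : v != 0 -> enorm ((enorm v)^-1 *: v) = 1.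
Proof.
by move=> v0; rewrite enormZ ger0_norm ?invr_ge0 ?enorm_ge0// mulVf// enorm_eq0.
Qed.

Lemma orthogonal_unit (u : 'rV[R]_d) : (1 < d)%N -> enorm u = 1 ->
  exists2 e, enorm e = 1 & dotp u e = 0.
Proof.
move=> d1 u1.
have [i ui] : exists i, u 0 i != 0.
  apply/existsP; apply: contraPT (oner_neq0 R) => /existsPn u0.
  have u00 : u = 0 by apply/rowP => i; rewrite mxE; apply/eqP; have := u0 i; rewrite negbK.
  by rewrite -u1 u00 enorm0 eqxx.
have [j ij] : exists j : 'I_d, j != i.
  have h0 : (0 < d)%N by exact: ltn_trans d1.
  have [->|i0] := eqVneq i (Ordinal h0); first by exists (Ordinal d1).
  by exists (Ordinal h0); rewrite eq_sym.
pose w : 'rV[R]_d := u 0 j *: delta_mx 0 i - u 0 i *: delta_mx 0 j.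
have dd k : dotp u (delta_mx 0 k) = u 0 k.
  rewrite /dotp (bigD1 k)//= !mxE !eqxx mulr1 big1 ?addr0// => l /negbTE lk.
  by rewrite !mxE lk andbF mulr0.
have wu : dotp u w = 0 by rewrite dotpBr !dotpZr !dd; ring.
have w0 : w != 0.
  apply: contraNneq ui => /rowP/(_ j); rewrite !mxE !eqxx (negbTE ij)/= mulr0 mulr1 sub0r.
  by move/eqP; rewrite oppr_eq0.
exists ((enorm w)^-1 *: w); first exact: enorm_normalize.
by rewrite dotpZr wu mulr0.
Qed.

(* Near a vertex [u] a polytope lies in a cone [|y - u| <= c (1 - <y, u>)], which
   cannot contain the unit ball. *)
Lemma not_polytope_tangent A (u : 'rV[R]_d) (k : R) : (1 < d)%N -> enorm u = 1 -> 0 < k ->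
  [set z | enorm z <= 1] `<=` closed_conv_hull A ->
  (forall x, A x -> 0 <= enorm x ^+ 2 - 1 /\ dotp x u <= 1 - k * (enorm x ^+ 2 - 1)) ->
  ~ polytope (closed_conv_hull A) /\ ball_radius (closed_conv_hull A) = 1%E.
Proof.
move=> d1 u1 k0 BK Au.
set K := closed_conv_hull A.
have uu : dotp u u = 1 by rewrite -enorm_sqr u1 expr1n.
have cone_convex (a b : R) : 0 <= b ->
    @convex_set R 'rV[R]_d [set y | enorm (y - u) <= a + b * (1 - dotp y u)].
  move=> b0; apply/convex_setP => x y t /andP[t0 t1] /= xa ya.
  have -> : t *: x + (1 - t) *: y - u = t *: (x - u) + (1 - t) *: (y - u).
    rewrite !scalerBr addrACA -opprD -scalerDl; congr (_ - _).
    by rewrite addrC subrK scale1r.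
  apply: le_trans (enorm_triangle _ _) _.
  rewrite !enormZ !ger0_norm ?subr_ge0// dotpDl !dotpZl.
  have t1' : 0 <= 1 - t by rewrite subr_ge0.
  have := ler_wpM2l t0 xa; have := ler_wpM2l t1' ya; lra.
have half_convex : @convex_set R 'rV[R]_d [set y | dotp y u <= 1].
  apply/convex_setP => x y t /andP[t0 t1] /= xa ya; rewrite dotpDl !dotpZl.
  have t1' : 0 <= 1 - t by rewrite subr_ge0.
  have := ler_wpM2l t0 xa; have := ler_wpM2l t1' ya; lra.
have cdot : continuous (fun y => dotp y u).
  rewrite (_ : (fun y => dotp y u) = dotp u); first exact: dotp_continuous.
  by apply/funext => y; rewrite dotpC.
have K1 y : K y -> dotp y u <= 1.
  move: y; apply: closed_conv_hull_sub => //.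
    by apply: closed_le_fun => //; exact: cst_continuous.
  move=> x /Au[s0 /= xu]; apply: le_trans xu _.
  by rewrite lerBlDr lerDl mulr_ge0// ltW.
(* With s = |x|^2 - 1 one has |x - u|^2 = s + 2 (1 - <x, u>), and s <= (1 - <x, u>) / k. *)
pose C := k^-1 + 2.
have ki0 : 0 < k^-1 by rewrite invr_gt0.
have C0 : 0 < C by rewrite addr_gt0.
(* The quadratic bound on [A] gives, for each [e], a cone with additive slack [e]. This condition is
   convex and closed, so it passes to the hull. *)
have Kcone y e : 0 < e -> K y -> enorm (y - u) <= e + C / e * (1 - dotp y u).
  move=> e0; move: y; apply: closed_conv_hull_sub.
  - by apply: cone_convex; rewrite divr_ge0// ltW.
  - apply: closed_le_fun; first exact: enormB_continuous.
    move=> y; apply: (@continuous_comp _ _ _ (fun y => dotp y u)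
      (fun b : R => e + C / e * (1 - b))); first exact: cdot.
    apply: (@cvgD _ R^o _ _ _ (fun=> e)); first exact: cvg_cst.
    apply: (@cvgM _ _ _ _ (fun=> C / e)); first exact: cvg_cst.
    by apply: (@cvgB _ R^o _ _ _ (fun=> 1)); [exact: cvg_cst|exact: cvg_id].
  move=> x /Au[s0 /= xu].
  have w0 : 0 <= 1 - dotp x u by have := mulr_ge0 (ltW k0) s0; lra.
  have sw : enorm x ^+ 2 - 1 <= k^-1 * (1 - dotp x u).
    by rewrite mulrC ler_pdivlMr// mulrC; lra.
  have xC : enorm (x - u) ^+ 2 <= C * (1 - dotp x u).
    by rewrite enormB_sqr u1 expr1n /C; lra.
  have q0 : 0 <= C / e * (1 - dotp x u) by rewrite mulr_ge0// divr_ge0// ltW.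
  rewrite -(@ler_pXn2r _ 2)// ?nnegrE ?enorm_ge0 ?addr_ge0 ?(ltW e0)//.
  apply: (le_trans xC).
  have -> : C * (1 - dotp x u) = e * (C / e * (1 - dotp x u)).
    by field; rewrite gt_eqF.
  by nra.
split; last first.
  apply/eqP; rewrite eq_le; apply/andP; split.
    apply: ub_ereal_sup => _ [r [r0 rK] <-]; rewrite lee_fin.
    have : K (r *: u).
      by apply: rK; exists u => //; rewrite closure_unit_ball /= u1.
    by move=> /K1; rewrite dotpZl uu mulr1.
  apply: ereal_sup_ubound; exists 1 => //; split => // _ [y + <-].
  by rewrite closure_unit_ball scale1r; exact: BK.
move=> /polytopeP[n [x xE]].
have Kx i : K (x i) by rewrite xE; exact: mem_simplex_hull.
(* A generator on the hyperplane <y, u> = 1 must be [u]: otherwise take [e] equal to half its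
   distance from [u]. Every other generator lies in some cone, and their finite number gives a
   common one. *)
have /choice[c cP] i : exists c, 0 <= c /\ enorm (x i - u) <= c * (1 - dotp (x i) u).
  have := K1 _ (Kx i); rewrite le_eqVlt => /orP[/eqP xu|xu].
    exists 0; split=> //; rewrite mul0r leNgt; apply/negP => xu0.
    have h0 : 0 < enorm (x i - u) / 2 by rewrite divr_gt0.
    have := Kcone _ _ h0 (Kx i).
    by rewrite xu subrr mulr0 addr0 => h; lra.
  exists (enorm (x i - u) / (1 - dotp (x i) u)); split.
    by rewrite divr_ge0 ?enorm_ge0//; lra.
  by rewrite divfK// gt_eqF//; lra.
pose c' := \sum_i c i.
have c'0 : 0 <= c' by apply: sumr_ge0 => i _; exact: (cP i).1.
have Kc y : K y -> enorm (y - u) <= c' * (1 - dotp y u).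
  rewrite xE => -[w ww ->].
  have cc := cone_convex 0 c' c'0.
  rewrite -[leRHS]add0r; apply: (convex_barycenter cc ww) => i; rewrite /= add0r.
  apply: le_trans (cP i).2 _; rewrite ler_wpM2r ?subr_ge0 ?K1//.
  by rewrite /c' (bigD1 i)//= lerDl sumr_ge0// => j _; exact: (cP j).1.
have [e e1 ue] := orthogonal_unit d1 u1.
have ee : dotp e e = 1 by rewrite -enorm_sqr e1 expr1n.
(* The point [y] below is the rational parametrisation of the unit circle through [u] and [e]: |y -
   u| is of order t but 1 - <y, u> only of order t^2. For this [t] the cone condition would read 2 t
   <= t (1 - t). *)
pose t := (2 * c' + 1)^-1.
have c21 : 0 < 2 * c' + 1 by rewrite ltr_wpDl// mulr_ge0.
have t0 : 0 < t by rewrite invr_gt0.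
have tc : t * (2 * c' + 1) = 1 by rewrite mulVf// gt_eqF.
have D0 : 0 < 1 + t ^+ 2 by rewrite ltr_pwDl// sqr_ge0.
pose y := ((1 - t ^+ 2) / (1 + t ^+ 2)) *: u + (2 * t / (1 + t ^+ 2)) *: e.
have y1 : enorm y = 1.
  rewrite enormE (_ : dotp y y = 1) ?sqrtr1//.
  rewrite /y !dotpDl !dotpDr !dotpZl !dotpZr uu ee ue (dotpC e) ue.
  by field; rewrite gt_eqF.
have yu : dotp y u = (1 - t ^+ 2) / (1 + t ^+ 2).
  by rewrite /y dotpDl !dotpZl uu (dotpC e) ue mulr0 addr0 mulr1.
have ye : dotp (y - u) e = 2 * t / (1 + t ^+ 2).
  by rewrite dotpBl ue subr0 /y dotpDl !dotpZl ue ee mulr0 add0r mulr1.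
have := dotp_le (y - u) e; rewrite e1 mulr1 ye => h1.
have Ky : K y by apply: BK; rewrite /= y1.
have := le_trans h1 (Kc y Ky); rewrite yu.
have -> : c' * (1 - (1 - t ^+ 2) / (1 + t ^+ 2)) = 2 * c' * t ^+ 2 / (1 + t ^+ 2).
  by field; rewrite gt_eqF.
rewrite ler_pM2r ?invr_gt0// => h2.
have : 2 * c' * t ^+ 2 = t * (1 - t) by rewrite -[X in _ = t * (X - t)]tc; ring.
by nra.
Qed.

Lemma convex_closed_conv_hull A : @convex_set R 'rV[R]_d (closed_conv_hull A).
Proof.
apply/convex_setP => x y t /andP[t0 t1] cx cy B /nbhs_ballP[e /= e0 xB].
have [x' [Ax' xx']] := cx _ (nbhsx_ballx x e e0).
have [y' [Ay' yy']] := cy _ (nbhsx_ballx y e e0).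
exists (t *: x' + (1 - t) *: y'); split.
  by apply: (proj1 (convex_setP _) (@convex_conv_hull R d A)); rewrite ?t0.
have t1' : 0 <= 1 - t by rewrite subr_ge0.
apply: xB; move: xx' yy'; rewrite -!ball_normE/= => xx' yy'.
rewrite opprD addrACA -!scalerBr; apply: le_lt_trans (ler_normD _ _) _.
rewrite !normrZ !ger0_norm//.
have [->|tn0] := eqVneq t 0; first by rewrite mul0r add0r subr0 mul1r.
have tp : 0 < t by rewrite lt_neqAle eq_sym tn0.
have : t * `|x - x'| < t * e by rewrite ltr_pM2l.
have : (1 - t) * `|y - y'| <= (1 - t) * e by rewrite ler_wpM2l// ltW.
by lra.
Qed.

(** Each point of the sphere is a limit of points of [A], and each point of the ball lies on a
    diameter. *)
Lemma ball_sub_of_sphere A : (0 < d)%N ->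
  (forall p e, enorm p = 1 -> 0 < e -> exists2 x, A x & enorm (x - p) < e) ->
  [set z | enorm z <= 1] `<=` closed_conv_hull A.
Proof.
move=> d0 Ap z /= z1.
have sphere p : enorm p = 1 -> closed_conv_hull A p.
  move=> p1 B /nbhs_ballP[e /= e0 pB]; have [x Ax xp] := Ap p e p1 e0.
  exists x; split; first exact: sub_conv_hull.
  apply: pB; rewrite -ball_normE/=; apply: le_lt_trans (norm_le_enorm _) _.
  by rewrite enormBC.
have [p p1 zE] : exists2 p, enorm p = 1 & z = enorm z *: p.
  have [->|z0] := eqVneq z 0; last first.
    exists ((enorm z)^-1 *: z); first exact: enorm_normalize.
    by rewrite scalerA divff ?scale1r// enorm_eq0.
  exists (delta_mx 0 (Ordinal d0)); last by rewrite enorm0 scale0r.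
  rewrite enormE /dotp (bigD1 (Ordinal d0))//= !mxE !eqxx mulr1 big1 ?addr0 ?sqrtr1//.
  by move=> j /negbTE jd; rewrite !mxE jd mulr0.
have -> : z = ((1 + enorm z) / 2) *: p + (1 - (1 + enorm z) / 2) *: (- p).
  by rewrite scalerN -scalerBl {1}zE; congr (_ *: _); lra.
apply: (proj1 (convex_setP (closed_conv_hull A)) (@convex_closed_conv_hull A)).
- by have := enorm_ge0 z; move=> ?; apply/andP; split; lra.
- exact: sphere.
- by apply: sphere; rewrite enormN.
Qed.

End hull_geometry.

(** * Measurability of the hull events *)

Section countable_events.
Context {dO : measure_display} {Omega : measurableType dO}.

Lemma measurable_ex (T : countType) (F : T -> set Omega) :
  (forall t, measurable (F t)) -> measurable [set w | exists t, F t w].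
Proof.
move=> mF; rewrite (_ : mkset _ = \bigcup_t F t).
  by apply: countable_bigcupT_measurable => //; exact: countableP.
by apply/seteqP; split=> [w [t Ft]|w [t _ Ft]]; exists t.
Qed.

Lemma measurable_all (T : countType) (F : T -> set Omega) :
  (forall t, measurable (F t)) -> measurable [set w | forall t, F t w].
Proof.
move=> mF; rewrite (_ : mkset _ = ~` [set w | exists t, (~` F t) w]).
  by apply: measurableC; apply: measurable_ex => t; exact: measurableC.
apply/seteqP; split=> w /=; first by move=> Fw [t].
by move=> h t; apply: contrapT => Ft; apply: h; exists t.
Qed.

Lemma measurable_and (A B : set Omega) :
  measurable A -> measurable B -> measurable [set w | A w /\ B w].
Proof. exact: measurableI. Qed.

Lemma measurable_prop (Q : Prop) : measurable [set w : Omega | Q].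
Proof.
have [q|q] := pselect Q.
  by rewrite (_ : mkset _ = setT) //; apply/seteqP; split.
by rewrite (_ : mkset _ = set0) //; apply/seteqP; split.
Qed.

End countable_events.

Section point_measures.
Context {R : realType} {dE : measure_display} {E : measurableType dE}.
Hypothesis measurable_set1E : forall x : E, measurable [set x].
Variable m : {measure set E -> \bar R}.
Hypothesis pm : point_measure m.
Local Open Scope ereal_scope.

(** Multiplicities in [point_measure] may be zero, so only the points with [0 < k i] are atoms. *)
Lemma point_measure_atoms : exists (x : nat -> E) (k : nat -> nat),
  [/\ forall i, (0 < k i)%N -> atoms m (x i),
      forall a, atoms m a -> exists2 i, (0 < k i)%N & a = x i &
      forall B, measurable B -> m B = \sum_(0 <= i <oo) (k i)%:R%:E * \d_(x i) B].
Proof.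
have [x [k mE]] := pm; exists x, k.
have t0 B i : (0 : \bar R) <= (k i)%:R%:E * \d_(x i) B by apply: mule_ge0 => //; rewrite lee_fin.
split=> // [i ki|a].
  rewrite /atoms/= mE//; apply: (@lt_le_trans _ _ ((k i)%:R%:E * \d_(x i) [set x i])).
    by rewrite diracE mem_set// mule1 lte_fin ltr0n.
  apply: le_trans (nneseries_lim_ge i.+1 _); last by move=> *; exact: t0.
  by rewrite big_nat_recr//= leeDr//; apply: sume_ge0 => j _; exact: t0.
rewrite /atoms/= mE// => a0; apply: contrapT => h.
move: a0; rewrite eseries0 ?ltxx// => i _ _; rewrite diracE.
have [->|ki] := posnP (k i); first by rewrite mul0e.
rewrite memNset ?mule0// => /= xa; apply: h; exists i => //; exact/esym.
Qed.

Lemma atoms_meet (B : set E) : measurable B ->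
  (exists2 a, atoms m a & B a) <-> 0 < m B.
Proof.
move=> mB; split=> [[a a0 Ba]|].
  by apply: lt_le_trans a0 _; apply: le_measure; rewrite ?inE// => _ ->.
have [x [k [xa ax mE]]] := point_measure_atoms.
rewrite mE// => B0; apply: contrapT => h.
move: B0; rewrite eseries0 ?ltxx// => i _ _; rewrite diracE.
have [->|ki] := posnP (k i); first by rewrite mul0e.
by rewrite memNset ?mule0// => /= xB; apply: h; exists (x i) => //; exact: xa.
Qed.

(** The mass is a convergent series whose nonzero terms are at least 1, so some tail is below 1 and
    contributes no atom. *)
Lemma finite_atoms (B : set E) : measurable B -> m B < +oo ->
  finite_set (atoms m `&` B).
Proof.
move=> mB; have [x [k [xa ax mE]]] := point_measure_atoms.
have t0 i : (0 : \bar R) <= (k i)%:R%:E * \d_(x i) B by apply: mule_ge0 => //; rewrite lee_fin.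
rewrite mE// => Boo.
have := @nneseries_tail_cvg R _ xpredT Boo (fun i _ => t0 i).
move=> /(_ [set y | y < 1]) [].
  exact: (open_nbhs_nbhs (conj (@open_ereal_lt_ereal R 1) (@lte01 R))).
move=> N _ NP; apply: (@sub_finite_set _ _ (x @` `I_N)); last first.
  exact: finite_image.
move=> a [/ax[i ki ->] Bx]; exists i => //=; rewrite ltnNge; apply/negP => Ni.
have := NP i Ni; rewrite /= ltNge => /negP; apply.
have := @nneseries_split R (fun i => (k i)%:R%:E * \d_(x i) B) i 1 (fun j _ => t0 j).
move=> ->; rewrite addn1 big_nat1 diracE mem_set// mule1.
apply: (@le_trans _ _ (k i)%:R%:E); first by rewrite lee_fin ler1n.
by rewrite leeDl// nneseries_ge0.
Qed.

End point_measures.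

(** * Countable descriptions of hulls *)

Section rational_points.
Context {R : realType} {d : nat}.

Definition rV_ratr (q : 'rV[rat]_d) : 'rV[R]_d := \row_j ratr (q 0 j).

Lemma rV_ratr_ball (x : 'rV[R]_d) (e : R) : 0 < e -> exists q, ball (rV_ratr q) e x.
Proof.
move=> e0.
have /choice[q xq] j : exists q : rat, ball (ratr q : R) e (x 0 j).
  have /(_ _ (ball_open _ _))[|y [xy [q _ qy]]] := @dense_rat R (ball (x 0 j) e).
    by exists (x 0 j); exact: ballxx.
  by exists q; rewrite qy; exact: ball_sym.
exists (\row_j q j) ; split=> // i j; rewrite ord1 !mxE; exact: xq.
Qed.

Lemma rV_ratr_open (U : set 'rV[R]_d) : open U -> U !=set0 -> exists q, U (rV_ratr q).
Proof.
move=> oU [x Ux]; have /nbhs_ballP[e /= e0 xU] := open_nbhs_nbhs (conj oU Ux).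
by have [q /ball_sym xq] := rV_ratr_ball x e0; exists q; exact: xU.
Qed.

Lemma halve_natSinv (k : nat) :
  k.+1%:R^-1 = (2 * k.+1%:R)^-1 + (2 * k.+1%:R)^-1 :> R.
Proof. by rewrite invfM; move: (k.+1%:R^-1 : R) => c; lra. Qed.

Lemma rV_ball_open (x : 'rV[R]_d) (k : nat) : open (ball x k.+1%:R^-1).
Proof. by apply: ball_open; rewrite invr_gt0. Qed.

Lemma rV_ball_norm (x y : 'rV[R]_d) (e : R) : ball x e y = (`|x - y| < e).
Proof. by rewrite -ball_normE. Qed.

Lemma exists_natSinv_lt (e : R) : 0 < e -> exists k : nat, k.+1%:R^-1 < e.
Proof.
by move=> e0; have [k] := @ltr_add_invr _ 0 e e0; rewrite add0r => h; exists k.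
Qed.

Definition hull_nbhd n (x : 'I_n -> 'rV[R]_d) (k : nat) : set 'rV[R]_d :=
  [set y | exists2 w, weights w & `|y - barycenter w x| < k.+1%:R^-1].

Lemma hull_nbhd_open n (x : 'I_n -> 'rV[R]_d) k : open (hull_nbhd x k).
Proof.
rewrite (_ : hull_nbhd x k = \bigcup_(w in @weights R n) ball (barycenter w x) k.+1%:R^-1).
  by apply: bigcup_open => w _; exact: rV_ball_open.
apply/seteqP; split=> [y [w ww h]|y [w ww h]]; exists w => //.
  by rewrite rV_ball_norm distrC.
by rewrite distrC -rV_ball_norm.
Qed.

(** A closed set is determined by the open balls it meets, and meeting an open set is insensitive to
    closure. This lets the closed hull be replaced by the convex hull itself. *)
Definition hits (K U : set 'rV[R]_d) := K `&` U !=set0.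

Lemma hits_closure (A U : set 'rV[R]_d) : open U -> hits (closure A) U <-> hits A U.
Proof.
move=> oU; split=> [[y [cy Uy]]|[y [Ay Uy]]]; last first.
  by exists y; split=> //; exact: subset_closure.
exact: (cy _ (open_nbhs_nbhs (conj oU Uy))).
Qed.

Lemma closed_hits (K : set 'rV[R]_d) (y : 'rV[R]_d) : closed K ->
  (forall k, hits K (ball y k.+1%:R^-1)) -> K y.
Proof.
move=> cK yK; apply: cK => B /nbhs_ballP[e /= e0 yB].
have [k ke] := exists_natSinv_lt e0; have [z [Kz yz]] := yK k.
by exists z; split=> //; apply: yB; apply: le_ball yz; exact: ltW.
Qed.

Lemma ball_sub_hits (K : set 'rV[R]_d) (r : R) : closed K -> 0 < r ->
  [set r *: x | x in closure unit_ball] `<=` K <->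
  forall q k, enorm (rV_ratr q) < r -> hits K (ball (rV_ratr q) k.+1%:R^-1).
Proof.
move=> cK r0; split=> [rK q k qr|h].
  exists (rV_ratr q); split; last by apply: ballxx; rewrite invr_gt0.
  apply: rK; exists (r^-1 *: rV_ratr q).
    rewrite closure_unit_ball /= enormZ ger0_norm ?invr_ge0 ?(ltW r0)//.
    by rewrite mulrC ler_pdivrMr// mul1r ltW.
  by rewrite scalerA divff ?scale1r// gt_eqF.
move=> _ [x cx <-]; apply: closed_hits => // k.
pose e : R := (2 * k.+1%:R)^-1 / r.
have e0 : 0 < e by rewrite divr_gt0// invr_gt0 mulr_gt0.
have [z [z1 xz]] := cx _ (nbhsx_ballx x e e0).
pose U := [set y : 'rV[R]_d | enorm y < r] `&` ball (r *: x) (2 * k.+1%:R)^-1.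
have oU : open U.
  apply: openI; last by apply: ball_open; rewrite invr_gt0 mulr_gt0.
  have /closed_openC := @closed_le_fun R d (fun=> r) (@enorm R d)
    (@cst_continuous _ _ r) (@enorm_continuous R d).
  rewrite (_ : ~` _ = [set y : 'rV[R]_d | enorm y < r])//.
  by apply/seteqP; split=> y /=; rewrite ltNge => /negP.
have [|q [/= qr xq]] := rV_ratr_open oU.
  exists (r *: z); split=> /=.
    by rewrite enormZ gtr0_norm// -[ltRHS]mulr1 ltr_pM2l.
  rewrite rV_ball_norm -scalerBr normrZ gtr0_norm//.
  by move: xz; rewrite rV_ball_norm /e ltr_pdivlMr// mulrC.
(* The index [k.*2.+1] gives the radius 1/(2(k+1)), half of the target. *)
have [y [Ky qy]] := h q k.*2.+1 qr; exists y; split=> //.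
have hh : (2 * k.+1%:R)^-1 = k.*2.+2%:R^-1 :> R by rewrite -natrM mul2n.
move: xq qy; rewrite !rV_ball_norm => xq qy.
have -> : r *: x - y = (r *: x - rV_ratr q) + (rV_ratr q - y) by rewrite addrA subrK.
apply: le_lt_trans (ler_normD _ _) _.
have -> : k.+1%:R^-1 = (2 * k.+1%:R)^-1 + k.*2.+2%:R^-1 :> R.
  by rewrite -hh -halve_natSinv.
exact: ltrD.
Qed.

(** The vertices are approximated by rational points at every accuracy, with [n] and the bound [M]
    independent of the accuracy, so that limit vertices exist. The neighbourhood condition puts [A]
    into the hull of the limits; the hitting condition puts the limits into the closed hull of
    [A]. *)
Lemma polytope_hits (A : set 'rV[R]_d) : polytope (closed_conv_hull A) <->
  exists n (M : nat), forall k, exists q : {ffun 'I_n -> 'rV[rat]_d},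
    [/\ forall i, `|rV_ratr (q i)| <= M%:R :> R,
        A `<=` hull_nbhd (fun i => rV_ratr (q i)) k &
        forall i, hits (closed_conv_hull A) (ball (rV_ratr (q i)) k.+1%:R^-1)].
Proof.
split=> [/polytopeP[n [x KE]]|[n [M /choice[q qP]]]].
  pose M := Num.truncn (\sum_i `|x i| + 1).
  have ki k : 0 < k.+2%:R^-1 :> R by rewrite invr_gt0.
  have kl k : k.+2%:R^-1 < k.+1%:R^-1 :> R by rewrite ltf_pV2 ?posrE// ltr_nat.
  exists n, M.+1 => k.
  have /choice[q qx] i := rV_ratr_ball (x i) (ki k).
  exists [ffun i => q i]; split=> [i|a Aa|i].
  - rewrite ffunE; apply: (@le_trans _ _ (\sum_i `|x i| + 1)); last first.
      by apply: ltW; rewrite truncnS_gt.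
    rewrite -[rV_ratr _](subrK (x i)); apply: le_trans (ler_normD _ _) _.
    rewrite addrC lerD//.
      by rewrite (bigD1 i)//= lerDl sumr_ge0.
    have := qx i; rewrite rV_ball_norm => /ltW h; apply: (le_trans h).
    by rewrite invf_le1// ler1n.
  - have : closed_conv_hull A a by apply: sub_closed_conv_hull; exact: sub_conv_hull.
    rewrite KE => -[w ww ->]; exists w => //.
    apply: le_lt_trans (kl k); apply: barycenterB_norm => // i.
    by rewrite ffunE distrC; have := qx i; rewrite rV_ball_norm => /ltW.
  - exists (x i); split; first by rewrite KE; exact: mem_simplex_hull.
    by rewrite ffunE; apply: le_ball (qx i); exact: ltW.
have [U [UU ooU]] := @eventually_ultrafilter.
have UP : ProperFilter U by exact: ultra_proper.
have /choice[l lP] i : exists l : 'I_d -> R, forall j, rV_ratr (q k i) 0 j @[k --> U] --> l j.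
  suff /choice[l lP] : forall j, exists l : R, rV_ratr (q k i) 0 j @[k --> U] --> l.
    by exists l.
  move=> j; apply: (@bounded_ultralimit R U _ M%:R) => // k; apply: le_trans (coord_le_norm _ _) _.
  by have [] := qP k.
pose x i : 'rV[R]_d := \row_j l i j.
apply/polytopeP; exists n, x; apply/seteqP; split.
  apply: closed_conv_hull_sub; [exact: convex_simplex_hull|exact: closed_simplex_hull|].
  move=> a Aa.
  have /choice[w wP] k : exists w, weights w /\
      `|a - barycenter w (fun i => rV_ratr (q k i))| <= k.+1%:R^-1.
    by have [_ /(_ a Aa)[w ww /ltW h] _] := qP k; exists w.
  apply: (@barycenter_limit R d n (fun k i => rV_ratr (q k i)) x U a w) => //.
  - by move=> i j; rewrite mxE; exact: lP.
  - by move=> k; have [] := wP k.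
  - by move=> k; have [] := wP k.
move=> _ [w ww ->]; apply: convex_barycenter => //; first exact: convex_closed_conv_hull.
move=> i; apply: closed_hits; first exact: closed_closure.
move=> m.
have m0 : 0 < (2 * m.+1%:R)^-1 :> R by rewrite invr_gt0 mulr_gt0.
have Um : U [set k | forall j, `|l i j - rV_ratr (q k i) 0 j| < (2 * m.+1%:R)^-1].
  apply: (@filter_forall _ _
    (fun (j : 'I_d) (k : nat) => `|l i j - rV_ratr (q k i) 0 j| < (2 * m.+1%:R)^-1) U) => j.
  exact: ((proj1 (@cvgrPdist_lt _ _ _ _ _ _ _) (lP i j)) _ m0).
have Uk : U [set k | (k.+1%:R^-1 < (2 * m.+1%:R)^-1 :> R)].
  exact: (ooU _ (near_infty_natSinv_lt (PosNum m0))).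
have [k [/= k1 k2]] := filter_ex (filterI Um Uk).
have [_ _ /(_ i)[y [Ky qy]]] := qP k; exists y; split=> //.
move: qy; rewrite !rV_ball_norm => qy.
have xq : `|x i - rV_ratr (q k i)| < (2 * m.+1%:R)^-1.
  rewrite -rV_ball_norm; split=> // a j; rewrite ord1 !mxE.
  by have := k1 j; rewrite !mxE.
have -> : x i - y = (x i - rV_ratr (q k i)) + (rV_ratr (q k i) - y) by rewrite addrA subrK.
apply: le_lt_trans (ler_normD _ _) _.
rewrite [ltRHS]halve_natSinv.
by apply: ltrD => //; exact: lt_trans k2.
Qed.

Lemma ball_sub_le (K : set 'rV[R]_d) (r r' : R) : 0 < r' -> r' <= r ->
  [set r *: x | x in closure unit_ball] `<=` K ->
  [set r' *: x | x in closure unit_ball] `<=` K.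
Proof.
move=> r0 rr rK _ [x + <-]; rewrite closure_unit_ball /= => x1.
have r1 : 0 < r by exact: lt_le_trans rr.
apply: rK; exists ((r' / r) *: x); last first.
  by rewrite scalerA mulrC divfK// gt_eqF.
rewrite closure_unit_ball /= enormZ ger0_norm ?divr_ge0 ?(ltW r1) ?(ltW r0)//.
by apply: mulr_ile1 => //; rewrite ?enorm_ge0 ?divr_ge0 ?(ltW r1) ?(ltW r0)// ler_pdivrMr// mul1r.
Qed.

(** Inclusion of balls is monotone in the radius, so countably many radii decide the supremum. The
    offset [k.+2] keeps the smaller radii positive. *)
Lemma ball_radius_eq1P (K : set 'rV[R]_d) : ball_radius K = 1%E <->
  (forall k : nat, [set (1 - k.+2%:R^-1) *: x | x in closure unit_ball] `<=` K) /\
  ~ exists k : nat, [set (1 + k.+1%:R^-1) *: x | x in closure unit_ball] `<=` K.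
Proof.
have k0 (k : nat) : 0 < 1 - k.+2%:R^-1 :> R by rewrite subr_gt0 invf_lt1// ltr1n.
split=> [K1|[Kle Kgt]].
  split=> [k|[k kK]].
    have : ((1 - k.+2%:R^-1)%:E < ball_radius K)%E.
      by rewrite K1 lte_fin gtrDl oppr_lt0 invr_gt0.
    move=> /ereal_sup_gt[_ [r [r0 rK] <-]]; rewrite lte_fin => /ltW h.
    exact: ball_sub_le rK.
  have : ((1 + k.+1%:R^-1)%:E <= ball_radius K)%E.
    by apply: ereal_sup_ubound; exists (1 + k.+1%:R^-1) => //; split=> //; rewrite addr_gt0// invr_gt0.
  by rewrite K1 lee_fin gerDl leNgt invr_gt0 ltr0n.
apply/eqP; rewrite eq_le; apply/andP; split.
  apply: ge_ereal_sup => _ [r [r0 rK] <-]; rewrite lee_fin leNgt; apply/negP => r1.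
  have /exists_natSinv_lt[k kr] : 0 < r - 1 by rewrite subr_gt0.
  apply: Kgt; exists k; apply: ball_sub_le rK; last by rewrite addrC -lerBrDr ltW.
  by rewrite addr_gt0// invr_gt0.
apply/lee_addgt0Pr => e e0; have [k ke] := exists_natSinv_lt e0.
apply: (@le_trans _ _ ((1 - k.+2%:R^-1)%:E + e%:E)%E).
  rewrite -EFinD lee_fin; have : k.+2%:R^-1 <= k.+1%:R^-1 :> R by rewrite lef_pV2 ?posrE// ler_nat.
  by move: ke; move: (k.+1%:R^-1 : R) (k.+2%:R^-1 : R) => a b; lra.
by rewrite leeD2r//; apply: ereal_sup_ubound; exists (1 - k.+2%:R^-1).
Qed.

End rational_points.

Section measurable_events.
Context {R : realType} {d : nat} {dO : measure_display} {Omega : measurableType dO}.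
Variable zeta : Omega -> {measure set 'rV[R]_d -> \bar R}.
Hypothesis pzeta : forall w, point_measure (zeta w).
Hypothesis mzeta : forall B, measurable B -> measurable_fun setT (zeta ^~ B).

Let A w := atoms (zeta w).
Let K w := closed_conv_hull (A w).

Lemma rV_measurable_set1 (x : 'rV[R]_d) : measurable [set x].
Proof.
rewrite (_ : [set x] = [set y | forall i, [set x 0 i] (y 0 i)]).
  exact: (@measurable_rV_box R d (fun i => [set x 0 i])).
by apply/seteqP; split=> [y -> //|y /= xy]; apply/rowP => i; rewrite -xy.
Qed.

Lemma rV_atoms_meet w (B : set 'rV[R]_d) : measurable B ->
  (exists2 a, A w a & B a) <-> (0 < zeta w B)%E.
Proof. by move=> mB; apply: atoms_meet => //; exact: rV_measurable_set1. Qed.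

Lemma measurable_charged (B : set 'rV[R]_d) : measurable B ->
  measurable [set w | (0 < zeta w B)%E].
Proof.
move=> mB; have := mzeta mB measurableT (emeasurable_itv `]0%E, +oo[).
by rewrite setTI; congr measurable; apply/seteqP; split=> w /=; rewrite in_itv/= andbT.
Qed.

Lemma measurable_atoms_sub (B : set 'rV[R]_d) : measurable B ->
  measurable [set w | A w `<=` B].
Proof.
move=> mB; rewrite (_ : mkset _ = ~` [set w | (0 < zeta w (~` B))%E]).
  by apply: measurableC; apply: measurable_charged; exact: measurableC.
apply/seteqP; split=> w /= h.
  by move=> /(rV_atoms_meet w (measurableC mB))[a /h].
move=> a Aa; apply: contrapT => Ba; apply: h.
by apply/(rV_atoms_meet w (measurableC mB)); exists a.
Qed.

(** If a barycenter of finitely many atoms lies in the open set [U], it stays there when the atoms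
    move slightly. So the event is a countable union, over rational balls any choice of points from
    which has a barycenter in [U], of the events that all these balls are charged. *)
Lemma measurable_hits (U : set 'rV[R]_d) : open U -> measurable [set w | hits (K w) U].
Proof.
move=> oU.
rewrite (_ : mkset _ = [set w | exists n, exists q : {ffun 'I_n -> 'rV[rat]_d}, exists k : nat,
   (forall x : 'I_n -> 'rV[R]_d, (forall i, ball (rV_ratr (q i)) k.+1%:R^-1 (x i)) ->
     exists2 v, weights v & U (barycenter v x)) /\
   forall i, (0 < zeta w (ball (rV_ratr (q i) : 'rV[R]_d) k.+1%:R^-1))%E]).
  apply: measurable_ex => n; apply: measurable_ex => q; apply: measurable_ex => k.
  apply: measurable_and; first exact: measurable_prop.
  apply: measurable_all => i; apply: measurable_charged; apply: open_measurable_rV.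
  exact: rV_ball_open.
apply/seteqP; split=> w /=.
  move=> /(hits_closure _ oU)[y []]; rewrite conv_hullE => -[n [x [v [wv Ax ->]]]] Uy.
  have /nbhs_ballP[e /= e0 yU] := open_nbhs_nbhs (conj oU Uy).
  have e2 : 0 < e / 2 by rewrite divr_gt0.
  have [k ke] := exists_natSinv_lt e2.
  have k0 : 0 < k.+1%:R^-1 :> R by rewrite invr_gt0.
  have /choice[q qx] i := rV_ratr_ball (x i) k0.
  exists n, [ffun i => q i], k; split=> [x' x'q|i]; last first.
    rewrite ffunE; apply/rV_atoms_meet; last by exists (x i).
    by apply: open_measurable_rV; exact: rV_ball_open.
  exists v => //; apply: yU; rewrite rV_ball_norm.
  apply: (@le_lt_trans _ _ (k.+1%:R^-1 + k.+1%:R^-1)); last by rewrite (splitr e) ltrD.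
  apply: barycenterB_norm => // i.
  have := x'q i; rewrite ffunE rV_ball_norm => /ltW h1.
  have := qx i; rewrite rV_ball_norm distrC => /ltW h2.
  have -> : x i - x' i = (x i - rV_ratr (q i)) + (rV_ratr (q i) - x' i) by rewrite addrA subrK.
  by apply: le_trans (ler_normD _ _) _; rewrite lerD.
move=> [n [q [k [qU qz]]]].
have /choice[x xP] i : exists x, A w x /\ ball (rV_ratr (q i)) k.+1%:R^-1 x.
  have [|_ /(_ (qz i))[x Ax qx]] := @rV_atoms_meet w (ball (rV_ratr (q i)) k.+1%:R^-1).
    by apply: open_measurable_rV; exact: rV_ball_open.
  by exists x.
have [|v wv Uv] := qU x; first by move=> i; exact: (xP i).2.
exists (barycenter v x); split=> //; apply: sub_closed_conv_hull.
apply: convex_barycenter => //; first exact: convex_conv_hull.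
by move=> i; apply: sub_conv_hull; exact: (xP i).1.
Qed.

Lemma measurable_ball_sub (r : R) : 0 < r ->
  measurable [set w | [set r *: x | x in closure unit_ball] `<=` K w].
Proof.
move=> r0; rewrite (_ : mkset _ = [set w | forall q k, enorm (rV_ratr q) < r ->
    hits (K w) (ball (rV_ratr q) k.+1%:R^-1)]).
  apply: measurable_all => q; apply: measurable_all => k.
  have [qr|qr] := pselect (enorm (rV_ratr q : 'rV[R]_d) < r).
    rewrite [X in measurable X](_ : _ = [set w | hits (K w) (ball (rV_ratr q) k.+1%:R^-1)]).
      exact/measurable_hits/rV_ball_open.
    by apply/seteqP; split=> w /= h; [exact: h|].
  by rewrite [X in measurable X](_ : _ = setT)//; apply/seteqP; split.
by apply/seteqP; split=> w /= /(@ball_sub_hits R d (K w) r (@closed_closure _ _) r0).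
Qed.

Lemma measurable_polytope : measurable [set w | polytope (K w)].
Proof.
rewrite (_ : mkset _ = [set w | exists n (M : nat), forall k, exists q : {ffun 'I_n -> 'rV[rat]_d},
  (forall i, `|rV_ratr (q i)| <= M%:R :> R) /\
  (A w `<=` hull_nbhd (fun i => rV_ratr (q i)) k /\
  forall i, hits (K w) (ball (rV_ratr (q i)) k.+1%:R^-1))]).
  apply: measurable_ex => n; apply: measurable_ex => M; apply: measurable_all => k.
  apply: measurable_ex => q; apply: measurable_and; first exact: measurable_prop.
  apply: measurable_and; last first.
    by apply: measurable_all => i; exact/measurable_hits/rV_ball_open.
  by apply: measurable_atoms_sub; apply: open_measurable_rV; exact: hull_nbhd_open.
apply/seteqP; split=> w /=.
  move=> /polytope_hits[n [M h]]; exists n, M => k; have [q [? ? ?]] := h k.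
  by exists q.
move=> [n [M h]]; apply/polytope_hits; exists n, M => k; have [q [? [? ?]]] := h k.
by exists q.
Qed.

Lemma measurable_tangent :
  measurable [set w | ~ polytope (K w) /\ ball_radius (K w) = 1%E].
Proof.
rewrite (_ : mkset _ = [set w | ~ polytope (K w) /\
  ((forall k : nat, [set (1 - k.+2%:R^-1) *: x | x in closure unit_ball] `<=` K w) /\
   ~ exists k : nat, [set (1 + k.+1%:R^-1) *: x | x in closure unit_ball] `<=` K w)]).
  apply: measurable_and; first by apply: measurableC; exact: measurable_polytope.
  apply: measurable_and.
    apply: measurable_all => k; apply: measurable_ball_sub.
    by rewrite subr_gt0 invf_lt1// ltr1n.
  apply: measurableC; apply: measurable_ex => k; apply: measurable_ball_sub.
  by rewrite addr_gt0// invr_gt0.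
by apply/seteqP; split=> w /= [nP /ball_radius_eq1P].
Qed.

End measurable_events.

(** * Lower bounds for unions and upper limits of events *)

Section probability_bounds.
Local Open Scope ereal_scope.
Context {R : realType} {dO : measure_display} {Omega : measurableType dO}.
Variable P : probability Omega R.

(* With [t = \sum_i 1_(E i) / (N P (E i))], this integrates
   [2 l t - l ^ 2 t ^ 2 <= 1_(\bigcup_i E i)] for [l = 1 / K]. *)
Lemma second_moment (T : finType) (E : T -> set Omega) (p : T -> R) (r : T -> T -> R) (K : R) :
  (forall i, measurable (E i)) -> (forall i, 0 < p i)%R ->
  (forall i, P (E i) = (p i)%:E) ->
  (forall i j, P (E i `&` E j) <= (p i * p j * r i j)%:E) ->
  (0 < K)%R -> (0 < #|T|)%N -> (\sum_i \sum_j r i j <= K * #|T|%:R ^+ 2)%R ->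
  (K^-1)%:E <= P (\bigcup_i E i).
Proof.
move=> mE p0 pE rE K0 T0 rK.
have N0 : (0 < #|T|%:R :> R)%R by rewrite ltr0n.
set N : R := #|T|%:R in rK N0.
have U_meas : measurable (\bigcup_i E i).
  by apply: countable_bigcupT_measurable => //; exact: countableP.
pose c i : R := (N * p i)^-1%R.
have c0 i : (0 < c i)%R by rewrite invr_gt0 mulr_gt0.
pose l := (K^-1)%R; have l0 : (0 < l)%R by rewrite invr_gt0.
pose ind (A : set Omega) w : \bar R := (\1_A w)%:E.
have mind A : measurable A -> measurable_fun setT (ind A).
  by move=> mA; apply/measurable_EFinP; exact: measurable_indic.
have iind A : measurable A -> \int[P]_w ind A w = P A.
  by move=> mA; rewrite /ind integral_indic// setIT.
have ind0 A w : 0 <= ind A w by rewrite lee_fin.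
pose L w := \sum_(i : T) (2 * l * c i)%:E * ind (E i) w.
pose Q w := \sum_(i : T) \sum_(j : T) (l ^+ 2 * c i * c j)%:E * ind (E i `&` E j) w.
have lc0 i : (0 <= 2 * l * c i)%R by rewrite !mulr_ge0 ?(ltW l0) ?(ltW (c0 _)).
have lcc0 i j : (0 <= l ^+ 2 * c i * c j)%R by rewrite !mulr_ge0 ?sqr_ge0//; exact: ltW.
have mEE i j : measurable (E i `&` E j) by exact: measurableI.
have mQi i : measurable_fun setT (fun w => \sum_(j : T) (l ^+ 2 * c i * c j)%:E * ind (E i `&` E j) w).
  by apply: emeasurable_sum => j; apply: measurable_funeM; exact: mind.
have Qi0 i w : 0 <= \sum_(j : T) (l ^+ 2 * c i * c j)%:E * ind (E i `&` E j) w.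
  by apply: sume_ge0 => j _; rewrite mule_ge0// lee_fin.
have mL : measurable_fun setT L.
  by apply: emeasurable_sum => i; apply: measurable_funeM; exact: mind.
have mQ : measurable_fun setT Q by exact: emeasurable_sum.
have L0 w : 0 <= L w by apply: sume_ge0 => j _; rewrite mule_ge0// lee_fin.
have Q0 w : 0 <= Q w by apply: sume_ge0 => j _.
have LQ w : L w <= ind (\bigcup_i E i) w + Q w.
  pose t := (\sum_i c i * \1_(E i) w)%R.
  have -> : L w = (2 * l * t)%:E.
    rewrite /L /t mulr_sumr -sumEFin; apply: eq_bigr => i _.
    by rewrite -EFinM mulrA.
  have -> : Q w = (l ^+ 2 * t ^+ 2)%:E.
    rewrite [(t ^+ 2)%R]expr2 /Q /t big_distrlr/= mulr_sumr -sumEFin; apply: eq_bigr => i _.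
    rewrite mulr_sumr -sumEFin; apply: eq_bigr => j _.
    by rewrite -EFinM indicI/=; congr _%:E; ring.
  (* On the union the inequality is (l t - 1)^2 >= 0; off it, t = 0. *)
  rewrite -EFinD lee_fin indicE; case: (asboolP ((\bigcup_i E i) w)) => [Ew|nE].
    rewrite mem_set//=; have := sqr_ge0 (l * t - 1)%R; lra.
  rewrite memNset//=.
  have -> : t = 0%R.
    rewrite /t big1// => i _; rewrite indicE memNset ?mulr0// => Eiw.
    by apply: nE; exists i.
  by lra.
have iL : \int[P]_w L w = (2 * l)%:E.
  rewrite ge0_integral_sum//; last 2 first.
  - by move=> i; apply: measurable_funeM; exact: mind.
  - by move=> i w _; rewrite mule_ge0// lee_fin.
  under eq_bigr => i _.
    rewrite ge0_integralZl_EFin//; last exact: mind.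
    rewrite iind// pE -EFinM.
    rewrite (_ : (2 * l * c i * p i)%R = (2 * l / N)%R); last first.
      by rewrite /c; field; rewrite !gt_eqF.
    over.
  rewrite /= sumEFin sumr_const; congr _%:E; rewrite -[LHS]mulr_natr.
  by rewrite -/N divfK// gt_eqF.
have iQ : \int[P]_w Q w <= l%:E.
  rewrite ge0_integral_sum//.
  apply: (@le_trans _ _ (\sum_i \sum_j (l ^+ 2 / N ^+ 2 * r i j)%:E)).
    apply: lee_sum => i _; rewrite ge0_integral_sum//; last 2 first.
    - by move=> j; apply: measurable_funeM; exact: mind.
    - by move=> j w _; rewrite mule_ge0// lee_fin.
    apply: lee_sum => j _; rewrite ge0_integralZl_EFin//; last exact: mind.
    rewrite iind//.
    apply: (@le_trans _ _ ((l ^+ 2 * c i * c j)%:E * (p i * p j * r i j)%:E)).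
      by apply: lee_wpmul2l => //; rewrite lee_fin.
    rewrite -EFinM lee_fin le_eqVlt; apply/orP; left; apply/eqP.
    by rewrite /c; field; rewrite !gt_eqF.
  under eq_bigr do rewrite sumEFin -mulr_sumr.
  rewrite sumEFin -mulr_sumr lee_fin mulrAC ler_pdivrMr ?exprn_gt0//.
  apply: (@le_trans _ _ (l ^+ 2 * (K * N ^+ 2))%R); first by rewrite ler_wpM2l ?sqr_ge0.
  rewrite mulrA ler_pM2r ?exprn_gt0// expr2 -mulrA mulVf ?mulr1// gt_eqF//.
have mU := mind _ U_meas.
have : (2 * l)%:E <= P (\bigcup_i E i) + l%:E.
  rewrite -iL; apply: (@le_trans _ _ (\int[P]_w (ind (\bigcup_i E i) w + Q w))).
    by apply: ge0_le_integral => //; apply: emeasurable_funD.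
  by rewrite ge0_integralD// iind// leeD2l.
rewrite -leeBlDr// -EFinB; apply: le_trans.
by rewrite lee_fin -/l; lra.
Qed.

(** Continuity from above along the tail unions, each of which contains some [G n]. *)
Lemma limsup_ge (G : (set Omega)^nat) (c : R) : (forall m, measurable (G m)) ->
  (forall m, c%:E <= P (G m)) -> c%:E <= P (lim_sup_set G).
Proof.
move=> mG cG.
have mU n : measurable (\bigcup_(k >= n) G k) by apply: bigcup_measurable => k _.
have h := @lim_sup_set_cvg _ _ _ P G mG.
have {}h := h (le_lt_trans (probability_le1 P (mU 0%N)) (ltry _)).
apply: (cvge_to_ge h); apply: nearW => n; apply: le_trans (cG n) _.
by apply: le_measure; rewrite ?inE// => w Gw; exists n => //=.
Qed.

End probability_bounds.

(** * Void probabilities *)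

Section poisson_void.
Local Open Scope ereal_scope.
Context {R : realType} {dO dE : measure_display} {Omega : measurableType dO}.
Context {E : measurableType dE} (P : probability Omega R).
Variables (X : set E) (lambda : set E -> \bar R).
Variable zeta : Omega -> {measure set E -> \bar R}.
Hypothesis Pzeta : poisson_process P X lambda zeta.

Lemma measurable_count (B : set E) (y : \bar R) : measurable B ->
  measurable [set w | zeta w B = y].
Proof.
move=> mB; have [_ mz _ _ _] := Pzeta.
have := mz B mB measurableT [set y] (emeasurable_set1 y).
by rewrite setTI.
Qed.

Lemma void_probability (B : set E) : measurable B -> B `<=` X ->
  0 <= lambda B -> lambda B < +oo ->
  P [set w | zeta w B = 0] = (expR (- fine (lambda B)))%:E.
Proof.
move=> mB BX l0 loo; have [_ _ + _ _] := Pzeta.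
move=> /(_ B mB BX loo 0%N) ->; rewrite /poisson_prob.
have f0 : (0 <= fine (lambda B))%R by exact: fine_ge0.
(* At rate 0 [poisson_prob] is the Dirac mass at 0, in agreement with exp (-0) = 1. *)
case: ifPn => [fl|]; last first.
  rewrite -leNgt => fl; have -> : fine (lambda B) = 0%R by apply/eqP; rewrite eq_le fl f0.
  by rewrite oppr0 expR0 diracE mem_set.
by rewrite esum_set1 /poisson_pmf ?fl ?lee_fin ?expr0 ?fact0 ?invr1 ?mul1r ?expR_ge0.
Qed.

Lemma finite_count (B : set E) : measurable B -> B `<=` X ->
  0 <= lambda B -> lambda B < +oo ->
  P [set w | zeta w B = +oo] = 0.
Proof.
move=> mB BX l0 loo; have [_ _ Pk _ _] := Pzeta.
pose r := fine (lambda B).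
pose F k := [set w | zeta w B = k%:R%:E].
have mF k : measurable (F k) by exact: measurable_count.
have tF : trivIset setT F.
  apply/trivIsetP => i j _ _ ij; apply/seteqP; split=> // w [/= h1 h2].
  by move: h2; rewrite /F/= h1 => -[/eqP]; rewrite eqr_nat (negbTE ij).
have PF : P (\bigcup_k F k) = 1.
  rewrite measure_bigcup//.
  (* The hypothesis gives [poisson_prob] with the running count as second argument. All these are
     the measure [poisson_prob r 0], so the terms add up to its total mass and nothing is left for
     the value +oo. *)
  rewrite (eq_eseriesr (g := fun k => poisson_prob r 0 [set k])); last first.
    by move=> k _; exact: (Pk B mB BX loo k).
  rewrite -measure_bigcup//; last first.
    by apply/trivIsetP => i j _ _ /eqP ij; apply/seteqP; split=> // x [/= -> /ij].
  rewrite (_ : \bigcup_(k in _) _ = setT); first exact: (@probability_setT _ _ _ (poisson_prob r 0)).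
  by apply/seteqP; split=> // k _; exists k.
apply/eqP; rewrite eq_le measure_ge0 andbT.
have mU : measurable (\bigcup_k F k) by exact: bigcup_measurable.
apply: (@le_trans _ _ (P (~` \bigcup_k F k))).
  apply: le_measure; rewrite ?inE; first exact: measurable_count.
    exact: measurableC.
  by move=> w /= Bw [k _]; rewrite /F/= Bw.
by rewrite probability_setC// PF subee.
Qed.

End poisson_void.

(** Intersecting the covers gives a measurable null set, so [A] itself need not be measurable.
    Almost sure statements about hulls thus avoid the measurability of dimension and radius. *)
Lemma negligible_small (R : realType) (dO : measure_display) (Omega : measurableType dO)
    (P : probability Omega R) (A : set Omega) :
  (forall e : R, 0 < e -> exists B, [/\ measurable B, (P B <= e%:E)%E & A `<=` B]) ->
  P.-negligible A.
Proof.
move=> small.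
have /choice[B BP] (k : nat) : exists B,
    [/\ measurable B, (P B <= (k.+1%:R^-1)%:E)%E & A `<=` B].
  by apply: small; rewrite invr_gt0.
have mB : measurable (\bigcap_k B k).
  by apply: bigcapT_measurable => k; have [] := BP k.
exists (\bigcap_k B k); split=> //; last by move=> w Aw k _; have [_ _] := BP k; exact.
apply/eqP; rewrite eq_le measure_ge0 andbT; apply/lee_addgt0Pr => e e0; rewrite add0e.
have [k ke] := exists_natSinv_lt e0; apply: (@le_trans _ _ (P (B k))).
  by apply: le_measure; rewrite ?inE//; [have [] := BP k|move=> w; exact].
by have [_ h _] := BP k; apply: (le_trans h); rewrite lee_fin ltW.
Qed.

Section beta_star_poisson.
Local Open Scope ereal_scope.
Context {R : realType} {d : nat} {dO : measure_display} {Omega : measurableType dO}.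
Variables (P : probability Omega R) (alpha beta : R).
Variable zeta : Omega -> {measure set 'rV[R]_d -> \bar R}.
Hypothesis Pzeta : beta_star_process alpha beta P zeta.
Hypothesis alpha0 : (0 < alpha)%R.
Hypothesis beta0 : (d%:R / 2 < beta)%R.

Let Lam := @beta_star_intensity R d alpha beta.

Lemma beta_star_process_points w : point_measure (zeta w).
Proof. by have [h _ _ _ _] := Pzeta; have [] := h w. Qed.

Lemma beta_star_process_measurable B : measurable B ->
  measurable_fun setT (zeta ^~ B).
Proof. by have [_ h _ _ _] := Pzeta; exact: h. Qed.

Lemma beta_star_state_space : ~` closure (@unit_ball R d) = [set x | 1 < enorm x]%R.
Proof.
by rewrite closure_unit_ball; apply/seteqP; split=> x /=; rewrite ltNge => /negP.
Qed.

Lemma enorm_sqr_sub1_gt0 (x : 'rV[R]_d) : (0 < enorm x ^+ 2 - 1)%R = (1 < enorm x)%R.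
Proof. by rewrite subr_gt0 -[X in (X < _)%R](expr1n _ 2) ltr_pXn2r// ?nnegrE ?enorm_ge0. Qed.

Lemma atoms_outside w x : atoms (zeta w) x -> (0 < enorm x ^+ 2 - 1)%R.
Proof.
rewrite enorm_sqr_sub1_gt0 => zx; have [h _ _ _ _] := Pzeta; have [_ zX] := h w.
rewrite ltNge; apply/negP => x1.
have mX : measurable (~` ~` closure (@unit_ball R d)).
  apply: measurableC; rewrite beta_star_state_space.
  rewrite (_ : mkset _ = [set x | 0 < enorm x ^+ 2 - 1]%R); first exact: measurable_shell.
  by apply/seteqP; split=> y /=; rewrite enorm_sqr_sub1_gt0.
have : (0 < zeta w (~` ~` closure (@unit_ball R d))).
  apply/(rV_atoms_meet beta_star_process_points w mX); exists x => //.
  by rewrite beta_star_state_space /=; apply/negP; rewrite -leNgt.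
by rewrite zX ltxx.
Qed.

Lemma beta_star_void (B : set 'rV[R]_d) : measurable B ->
  (B `<=` [set x | 0 < enorm x ^+ 2 - 1]%R) -> Lam B < +oo ->
  P [set w | zeta w B = 0] = (expR (- fine (Lam B)))%:E.
Proof.
move=> mB BX Boo; apply: (void_probability Pzeta) => //; last exact: beta_star_intensity_ge0.
by rewrite beta_star_state_space => x /BX; rewrite /= enorm_sqr_sub1_gt0.
Qed.

Lemma beta_star_shell_finite (s : R) : (0 < s)%R ->
  P [set w | zeta w [set x | s < enorm x ^+ 2 - 1]%R = +oo] = 0.
Proof.
move=> s0; apply: (finite_count Pzeta); first exact: measurable_shell.
- rewrite beta_star_state_space => x /= sx; rewrite -enorm_sqr_sub1_gt0.
  exact: lt_trans sx.
- by apply: beta_star_intensity_ge0 => //; exact: measurable_shell.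
- exact: beta_star_intensity_shell.
Qed.

Lemma void_atoms w (B : set 'rV[R]_d) : measurable B -> zeta w B = 0 ->
  forall x, atoms (zeta w) x -> ~ B x.
Proof.
move=> mB B0 x zx Bx.
have : 0 < zeta w B by apply/(rV_atoms_meet beta_star_process_points w mB); exists x.
by rewrite B0 ltxx.
Qed.

Lemma nonvoid_atom w (B : set 'rV[R]_d) : measurable B -> zeta w B <> 0 ->
  exists2 x, atoms (zeta w) x & B x.
Proof.
move=> mB /eqP B0; apply/(rV_atoms_meet beta_star_process_points w mB).
by rewrite lt_neqAle eq_sym B0 measure_ge0.
Qed.

(** The additive form holds for infinite intensities too. It turns the void probability of a union
    into a product of void probabilities times the exponential of the shared intensity. *)
Lemma beta_star_intensityUI (A B : set 'rV[R]_d) : measurable A -> measurable B ->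
  Lam (A `|` B) + Lam (A `&` B) = Lam A + Lam B.
Proof.
move=> mA mB; rewrite /Lam !beta_star_intensityE//; [|exact: measurableI|exact: measurableU].
have c0 : 0 <= (alpha * beta_star_const d beta)%:E.
  by rewrite lee_fin mulr_ge0 ?(ltW alpha0)// ltW// beta_star_const_gt0.
have i0 D : 0 <= \int[lebesgue_rV d]_(x in D) beta_kernel beta x.
  by apply: integral_ge0 => x _; exact: beta_kernel_ge0.
rewrite -!ge0_muleDr//; congr (_ * _).
have iU C D : measurable C -> measurable D -> [disjoint C & D] ->
   \int[lebesgue_rV d]_(x in C `|` D) beta_kernel beta x =
   \int[lebesgue_rV d]_(x in C) beta_kernel beta x + \int[lebesgue_rV d]_(x in D) beta_kernel beta x.
  move=> mC mD CD; rewrite ge0_integral_setU//.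
    by apply: measurable_funTS; exact: measurable_beta_kernel.
  by move=> x _; exact: beta_kernel_ge0.
have AD : [disjoint A & B `\` A] by apply/disj_setPS => x [Ax []].
have ID : [disjoint A `&` B & B `\` A] by apply/disj_setPS => x [[Ax _] []].
have -> : A `|` B = A `|` (B `\` A).
  by rewrite setUDr setDv setD0.
rewrite iU//; last exact: measurableD.
rewrite -addeA -[in RHS](setUIDK B A) iU//; last 3 first.
- exact: measurableI.
- exact: measurableD.
- by rewrite setIC.
by rewrite (setIC B A) [X in _ + X]addeC.
Qed.

End beta_star_poisson.

(** * Caps that all contain an atom *)

Section direction_net.
Context {R : realType}.

(** Write <x, v> = <x, u> - |v - u|^2 / 2 + <x - u, v - u>. In the cap |x - u|^2 < s, so the last
    term costs at most k s / 4 + |v - u|^2 / k by a weighted mean inequality; the condition on [h]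
    bounds the other losses by k delta / 4, and half of the margin k delta survives. *)
Lemma cap_direction d (k s1 delta h : R) (x u v : 'rV[R]_d) :
  enorm u = 1 -> enorm v = 1 -> 0 < k -> 0 < delta -> cap_set k delta s1 u x ->
  enorm (v - u) <= h -> h ^+ 2 * (2^-1 + k^-1) <= k * delta / 4 ->
  1 + k / 2 * delta < dotp x v.
Proof.
move=> u1 v1 k0 delta0 [/andP[sd _] xu] vu hd.
set s := enorm x ^+ 2 - 1 in sd xu.
have uu : dotp u u = 1 by rewrite -enorm_sqr u1 expr1n.
have vuE : enorm (v - u) ^+ 2 = 2 - 2 * dotp v u.
  by rewrite enormB_sqr u1 v1 !expr1n -mulr_natl; ring.
have xuE : enorm (x - u) ^+ 2 = s + 2 - 2 * dotp x u.
  by rewrite enormB_sqr u1 expr1n -mulr_natl /s; ring.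
have xvE : dotp x v = dotp x u - enorm (v - u) ^+ 2 / 2 + dotp (x - u) (v - u).
  by rewrite vuE dotpBl !dotpBr uu (dotpC u v); field.
have cs : - (enorm (x - u) * enorm (v - u)) <= dotp (x - u) (v - u).
  by rewrite lerNl -dotpNl; apply: le_trans (dotp_le _ _) _; rewrite enormN.
have := enorm_ge0 (v - u); have := enorm_ge0 (x - u).
move: vu cs xuE xvE; set g := enorm (v - u); set q := enorm (x - u) => gh cs qE xvE q0 g0.
have ki0 : 0 < k^-1 by rewrite invr_gt0.
have am : q * g <= k / 4 * q ^+ 2 + k^-1 * g ^+ 2.
  have : 0 <= k^-1 * (k / 2 * q - g) ^+ 2 by rewrite mulr_ge0 ?sqr_ge0// ltW.
  have -> : k^-1 * (k / 2 * q - g) ^+ 2 = k / 4 * q ^+ 2 + k^-1 * g ^+ 2 - q * g.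
    by field; rewrite gt_eqF.
  lra.
have q2 : k / 4 * q ^+ 2 <= k / 4 * s.
  by rewrite ler_pM2l ?divr_gt0// qE; have := mulr_gt0 k0 (lt_trans delta0 sd); lra.
have g2 : g ^+ 2 * (2^-1 + k^-1) <= h ^+ 2 * (2^-1 + k^-1).
  rewrite ler_wpM2r ?addr_ge0 ?(ltW ki0)// ler_pXn2r ?nnegrE//.
  exact: le_trans gh.
have ks : k * delta < k * s by rewrite ltr_pM2l.
by move: g2 hd am; rewrite !mulrDr [g ^+ 2 * k^-1]mulrC [h ^+ 2 * k^-1]mulrC; lra.
Qed.

Lemma enorm_normalizeB d (p q : 'rV[R]_d) : 1 <= enorm p -> 1 <= enorm q ->
  enorm ((enorm p)^-1 *: p - (enorm q)^-1 *: q) <= 2 * enorm (p - q).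
Proof.
move=> p1 q1; have p0 : 0 < enorm p by exact: lt_le_trans p1.
have q0 : 0 < enorm q by exact: lt_le_trans q1.
have -> : (enorm p)^-1 *: p - (enorm q)^-1 *: q =
    (enorm p)^-1 *: (p - q) + ((enorm q - enorm p) / enorm p) *: ((enorm q)^-1 *: q).
  apply/rowP => i; rewrite !mxE.
  by move: p0 q0; move: (enorm p) (enorm q) => a b a0 b0; field; rewrite !gt_eqF.
apply: le_trans (enorm_triangle _ _) _; rewrite !enormZ.
have -> : `|(enorm q)^-1| * enorm q = 1.
  by rewrite ger0_norm ?invr_ge0 ?(ltW q0)// mulVf// gt_eqF.
have pq : `|enorm q - enorm p| <= enorm (p - q).
  rewrite ler_norml; apply/andP; split.
    have := enormB_triangle q p 0; rewrite !subr0; lra.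
  by have := enormB_triangle p q 0; rewrite !subr0 (enormBC q p); lra.
rewrite mulr1 normrM !normrV ?unitfE ?gt_eqF// (gtr0_norm p0).
have i1 : (enorm p)^-1 <= 1 by rewrite invf_le1.
have i0 : 0 <= (enorm p)^-1 by rewrite invr_ge0 ltW.
have := ler_pM i0 (enorm_ge0 (p - q)) i1 (lexx _).
have := ler_pM (normr_ge0 _) i0 pq i1.
lra.
Qed.

(** A grid of step 1/(m+1) on the boundary of the cube [-1, 1]^(n+1): [t] consists of a coordinate,
    the sign of its face and a position on that face. Its size is of order m^n, as for a net on the
    n-dimensional sphere. *)
Definition cube_point n (m : nat) (t : 'I_n.+1 * bool * {ffun 'I_n -> 'I_(2 * m.+1).+1}) :
  'rV[R]_n.+1 := \row_i
  if unlift t.1.1 i is Some j then (t.2 j)%:R / m.+1%:R - 1 else (-1) ^+ t.1.2.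

Definition net n m t := (enorm (@cube_point n m t))^-1 *: cube_point t.

Lemma cube_point_ge1 n m t : 1 <= enorm (@cube_point n m t).
Proof.
apply: le_trans (coord_le_enorm _ t.1.1).
by rewrite mxE unlift_none normrX normrN1 expr1n.
Qed.

Lemma enorm_net n m t : enorm (@net n m t) = 1.
Proof.
rewrite enormZ ger0_norm ?invr_ge0 ?enorm_ge0// mulVf// gt_eqF//.
exact: lt_le_trans (cube_point_ge1 _).
Qed.

(** Rescaling [v] by its largest coordinate places it on a face of the cube, where it is rounded.
    Passing from the sup norm costs the factor n+1, normalising the factor 2. *)
Lemma net_dense n m (v : 'rV[R]_n.+1) : enorm v = 1 ->
  exists t, enorm (v - @net n m t) <= 2 * (n.+1%:R / m.+1%:R).
Proof.
move=> v1.
have [i0 _ i0max] := @arg_maxP _ _ _ ord0 xpredT (fun i => `|v 0 i|) isT.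
have v0 : 0 < `|v 0 i0|.
  rewrite lt_neqAle normr_ge0 andbT eq_sym; apply/eqP => vi0.
  have := oner_neq0 R; rewrite -v1; suff -> : v = 0 by rewrite enorm0 eqxx.
  apply/rowP => i; rewrite mxE; apply/eqP; rewrite -normr_le0 -vi0; exact: i0max.
pose p := `|v 0 i0|^-1 *: v.
have pi i : `|p 0 i| <= 1.
  rewrite mxE normrM normfV normr_id mulrC ler_pdivrMr// mul1r; exact: i0max.
have p1 : 1 <= enorm p.
  apply: le_trans (coord_le_enorm _ i0).
  by rewrite mxE normrM normfV normr_id mulVf// gt_eqF.
have m0 : 0 < m.+1%:R :> R by [].
(* Rounding down loses less than one grid step. The value 2(m+1) can occur, hence 2(m+1) + 1
   positions per coordinate. *)
pose c j := Num.truncn ((p 0 (lift i0 j) + 1) * m.+1%:R).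
have pj j : 0 <= (p 0 (lift i0 j) + 1) * m.+1%:R <= (2 * m.+1)%:R.
  have := pi (lift i0 j); rewrite ler_norml => /andP[h1 h2].
  apply/andP; split; first by rewrite mulr_ge0//; lra.
  by rewrite natrM ler_pM2r//; lra.
have cm j : (c j < (2 * m.+1).+1)%N.
  have /andP[h1 h2] := pj j; rewrite ltnS -(ler_nat R).
  by apply: le_trans h2; rewrite truncn_le.
exists (i0, v 0 i0 < 0, [ffun j => Ordinal (cm j)]).
set t := (_, _, _).
have vp : v = (enorm p)^-1 *: p.
  rewrite /p enormZ v1 mulr1 normfV normr_id invrK scalerA divff ?scale1r// gt_eqF//.
rewrite {1}vp; apply: le_trans (enorm_normalizeB p1 (cube_point_ge1 _)) _.
rewrite ler_pM2l//; apply: le_trans (enorm_le_norm _) _.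
rewrite ler_pM2l//; apply: rV_norm_le; first by rewrite invr_ge0 ltW.
move=> i; rewrite !mxE /t/=; case: unliftP => [j ->|->]; last first.
  rewrite (_ : _ - _ = 0) ?normr0 ?invr_ge0 ?(ltW m0)//.
  have [vn|vn] := ltP (v 0 i0) 0; rewrite /= ?expr1 ?expr0.
    by rewrite ltr0_norm// invrN mulNr mulVf ?subrr// lt_eqF.
  by rewrite ger0_norm// mulVf ?subrr// gt_eqF// -(ger0_norm vn).
rewrite ffunE/=; have /andP[h1 h2] := pj j.
have /andP[c1 c2] := truncn_itv h1; rewrite -/(c j) in c1 c2.
have -> : `|v 0 i0|^-1 * v 0 (lift i0 j) = p 0 (lift i0 j) by rewrite mxE.
have {}c2 : (p 0 (lift i0 j) + 1) * m.+1%:R < (c j)%:R + 1 by rewrite natr1.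
move: c1 c2; set y := p 0 _; set z := (c j)%:R => c1 c2.
have -> : y - (z / m.+1%:R - 1) = ((y + 1) * m.+1%:R - z) / m.+1%:R.
  by field; rewrite gt_eqF.
rewrite normrM normfV (gtr0_norm m0) ler_pdivrMr// mulVf ?gt_eqF//.
by rewrite ger0_norm; lra.
Qed.

Lemma card_net n m :
  #|{: 'I_n.+1 * bool * {ffun 'I_n -> 'I_(2 * m.+1).+1}}| = (n.+1 * 2 * (2 * m.+1).+1 ^ n)%N.
Proof. by rewrite !card_prod card_ord card_bool card_ffun !card_ord. Qed.

End direction_net.

Lemma measure_finite_union (R : realType) (d : measure_display) (T : measurableType d)
    (mu : {measure set T -> \bar R}) (I : finType) (F : I -> set T) :
  (forall i, measurable (F i)) ->
  measurable (\bigcup_i F i) /\ (mu (\bigcup_i F i) <= \sum_i mu (F i))%E.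
Proof.
move=> mF; have -> : \bigcup_i F i = \big[setU/set0]_i F i.
  rewrite -bigcup_seq; apply: eq_bigcupl; split=> i _ //=.
  exact: mem_index_enum.
split; first exact: bigsetU_measurable.
pose Q A (x : \bar R) := measurable A /\ (mu A <= x)%E.
suff [] : Q (\big[setU/set0]_i F i) (\sum_i mu (F i)) by [].
elim/big_ind2 : _ => [|x A y B [mA Ax] [mB By]|i _] /=; last by split.
  by split=> //; rewrite measure0.
split; first exact: measurableU.
by apply: le_trans (measureU2 mu mA mB) _; rewrite leeD.
Qed.

(** * Almost surely a polytope *)

Section part_one.
Context {R : realType} {n : nat} {dO : measure_display} {Omega : measurableType dO}.
Variables (P : probability Omega R) (alpha beta : R).
Variable zeta : Omega -> {measure set 'rV[R]_n.+1 -> \bar R}.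
Hypothesis Pzeta : beta_star_process alpha beta P zeta.
Hypothesis n0 : (0 < n)%N.
Hypothesis alpha0 : 0 < alpha.
Hypothesis beta0 : n.+1%:R / 2 < beta.
Hypothesis cond : n%:R / 2 + 1 < beta \/ beta = n%:R / 2 + 1 /\ n%:R * pi < alpha.

Let good w := [/\ polytope (beta_star_set (zeta w)), has_dim (beta_star_set (zeta w)) n.+1 &
  (1 < ball_radius (beta_star_set (zeta w)))%E].

(** The exceptional set is contained in the union of two events: some cap of the net is empty, or
    the shell outside radius [r] has infinitely many atoms. The second is null, the first is
    controlled by the union bound. *)
Lemma beta_star_polytope_up_to (e : R) : 0 < e ->
  exists B, [/\ measurable B, (P B <= e%:E)%E & ~` good `<=` B].
Proof.
move=> e0.
have [k [s1 [a [C [d0 [k0 na d00 cap]]]]]] := cap_intensity_lower n0 alpha0 beta0 cond.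
pose c0 := 2^-1 + k^-1 : R.
have c00 : 0 < c0 by rewrite addr_gt0// invr_gt0.
(* With net spacing h = 2 (n+1) q and delta = D q^2, this makes the condition h^2 (1/2 + 1/k) <= k
   delta / 4 of [cap_direction] an equality. *)
pose D := 16 * n.+1%:R ^+ 2 * c0 / k : R.
have D0 : 0 < D by rewrite divr_gt0// !mulr_gt0// exprn_gt0.
(* The net has at most 2 (n+1) (3/q)^n directions and each cap is empty with probability at most e^C
   (D q^2)^a, so the union bound is K q^(2a - n). *)
pose K := expR C * D `^ a * (n.+1 * 2)%:R * 3 ^+ n : R.
have K0 : 0 < K.
  by rewrite !mulr_gt0 ?expR_gt0 ?powR_gt0 ?exprn_gt0// ltr0n muln_gt0.
have p0 : 0 < 2 * a - n%:R by lra.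
have tau0 : 0 < Num.min 1 (d0 / D) by rewrite lt_min ltr01 divr_gt0.
have [s [/andP[s0 sle] sp]] := exists_small_powR p0 (divr_gt0 e0 K0) tau0.
have [m ms] := exists_natSinv_lt s0.
pose q : R := m.+1%:R^-1.
have q0 : 0 < q by rewrite invr_gt0.
have q1 : q <= 1 by rewrite invf_le1// ler1n.
pose delta := D * q ^+ 2.
have delta0 : 0 < delta by rewrite mulr_gt0// exprn_gt0.
have deltad : delta < d0.
  have : q < d0 / D by apply: lt_le_trans ms _; apply: le_trans sle _; rewrite ge_min lexx orbT.
  rewrite ltr_pdivlMr// mulrC => h; apply: le_lt_trans h.
  by rewrite ler_pM2l// expr2 ler_piMl// ltW.
have dd : 0 < delta < d0 by rewrite delta0.
pose T := ('I_n.+1 * bool * {ffun 'I_n -> 'I_(2 * m.+1).+1})%type.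
pose c (t : T) := cap_set k delta s1 (@net R n m t).
have mc t : measurable (c t) by exact: measurable_cap_set.
have csub t : c t `<=` [set x | delta < enorm x ^+ 2 - 1] by move=> x [/andP[]].
have coo t : (beta_star_intensity alpha beta (c t) < +oo)%E.
  apply: le_lt_trans (beta_star_intensity_shell alpha0 beta0 delta0).
  by apply: le_beta_star_intensity => //; exact: measurable_shell.
pose V t := [set w | zeta w (c t) = 0%E].
have mV t : measurable (V t) by exact: (measurable_count Pzeta).
have PV t : (P (V t) <= (expR C * delta `^ a)%:E)%E.
  rewrite (beta_star_void Pzeta alpha0 beta0)//; last first.
    by move=> x /csub/=; exact: lt_trans.
  rewrite lee_fin /powR gt_eqF// -expRD ler_expR.
  have := cap delta _ dd (enorm_net t); rewrite lnV// -/(c t).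
  rewrite -[X in (_ <= X)%E -> _]fineK ?lee_fin; last first.
    by rewrite ge0_fin_numE// beta_star_intensity_ge0.
  by lra.
(* Half of the margin k delta / 2 that [cap_direction] provides, so that atoms exceed [r] strictly
   in every direction. *)
pose r := 1 + k / 4 * delta.
have kd0 : 0 < k * delta by rewrite mulr_gt0.
have r1 : 1 < r by rewrite /r; lra.
have r20 : 0 < r ^+ 2 - 1 by rewrite subr_gt0 -[ltLHS](expr1n _ 2) ltr_pXn2r// ?nnegrE; lra.
pose S := [set x : 'rV[R]_n.+1 | r ^+ 2 - 1 < enorm x ^+ 2 - 1].
have mS : measurable S by exact: measurable_shell.
pose F := [set w | zeta w S = +oo%E].
have mF : measurable F by exact: (measurable_count Pzeta).
have [mU PU] := measure_finite_union P mV.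
exists ((\bigcup_t V t) `|` F); split; first exact: measurableU.
  have PF : P F = 0%E by exact: (beta_star_shell_finite Pzeta).
  have PUF : (P ((\bigcup_t V t) `|` F) <= P (\bigcup_t V t) + P F)%E := measureU2 P mU mF.
  apply: (le_trans PUF); rewrite PF adde0.
  apply: (le_trans PU).
  apply: (@le_trans _ _ (\sum_(t : T) (expR C * delta `^ a)%:E)%E).
    by apply: lee_sum => t _; exact: PV.
  rewrite sumEFin sumr_const lee_fin.
  have -> : #|xpredT : pred T| = (n.+1 * 2 * (2 * m.+1).+1 ^ n)%N := @card_net n m.
  rewrite -[leLHS]mulr_natr natrM natrX.
  have h1 : (2 * m.+1).+1%:R <= 3 * q^-1.
    by rewrite /q invrK -natrM ler_nat [(3 * _)%N]mulSn addSn ltnS leq_addl.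
  have h2 : (2 * m.+1).+1%:R ^+ n <= 3 ^+ n * q^-1 ^+ n.
    by rewrite -exprMn; apply: lerXn2r; rewrite ?nnegrE// mulr_ge0// invr_ge0 ltW.
  have h3 : delta `^ a * q^-1 ^+ n = D `^ a * q `^ (2 * a - n%:R).
    rewrite powRM ?(ltW D0) ?sqr_ge0// -mulrA; congr (_ * _).
    rewrite -powR_mulrn ?(ltW q0)// -powRrM powRD ?(gt_eqF q0) ?implybT// powRN.
    by rewrite exprVn powR_mulrn// ltW.
  apply: (@le_trans _ _ (K * q `^ (2 * a - n%:R))).
    have -> : K * q `^ (2 * a - n%:R) =
       expR C * (n.+1 * 2)%:R * 3 ^+ n * (D `^ a * q `^ (2 * a - n%:R)).
      by rewrite /K; ring.
    rewrite -h3.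
    have -> : expR C * (n.+1 * 2)%:R * 3 ^+ n * (delta `^ a * q^-1 ^+ n) =
       expR C * delta `^ a * ((n.+1 * 2)%:R * (3 ^+ n * q^-1 ^+ n)) by ring.
    by rewrite !ler_wpM2l// mulr_ge0 ?expR_ge0 ?powR_ge0.
  rewrite mulrC -ler_pdivlMr//; apply: le_trans sp.
  by apply: ge0_ler_powR; rewrite ?nnegrE ?(ltW p0) ?(ltW q0) ?(ltW s0)// ltW.
move=> w; apply: contra_notP => /not_orP[nV nF].
apply: (polytope_of_directions (ltn0Sn n) r1).
  rewrite (_ : [set x | _] = S).
    apply: finite_atoms => //; first exact: rV_measurable_set1.
      exact: (beta_star_process_points Pzeta).
    by rewrite ltey; apply/eqP.
  apply/seteqP; split=> x /=; rewrite /S/= ltrD2r ltr_pXn2r ?nnegrE ?enorm_ge0//; lra.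
move=> v v1; have [t vt] := net_dense m v1.
have [x zx cx] : exists2 x, atoms (zeta w) x & c t x.
  apply: (nonvoid_atom Pzeta) => // z0; apply: nV; exists t => //.
exists x => //; apply: (@lt_trans _ _ (1 + k / 2 * delta)).
  by rewrite /r; lra.
apply: (cap_direction (enorm_net t) v1 k0 delta0 cx vt).
rewrite le_eqVlt; apply/orP; left; apply/eqP.
rewrite /delta /D /c0 /q.
have m0 : m.+1%:R != 0 :> R by rewrite pnatr_eq0.
by move: (m.+1%:R : R) (n.+1%:R : R) m0 => M N m0; field; rewrite m0 gt_eqF.
Qed.

Lemma beta_star_ae_polytope : {ae P, forall w, good w}.
Proof. by apply: negligible_small => e e0; exact: beta_star_polytope_up_to. Qed.

End part_one.

(** * Empty tangent caps *)

Section grid_sums.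
Context {R : realType}.

(** Young's inequality for t^q and 1 with exponents 1/q and 1/(1 - q). *)
Lemma powR_bernoulli (t q : R) : 0 <= t -> 0 < q < 1 -> t `^ q <= 1 - q * (1 - t).
Proof.
move=> t0 /andP[q0 q1]; have q1' : 0 < 1 - q by rewrite subr_gt0.
have := @conjugate_powR R (t `^ q) 1 q^-1 (1 - q)^-1 (powR_ge0 _ _) ler01.
rewrite !invr_gt0 !invrK => /(_ q0 q1') h.
have {}h := h (subrKC _ _); move: h.
rewrite -powRrM divff ?gt_eqF// powRr1// powR1 mulr1 mul1r; lra.
Qed.

(** A telescoping replacement for the integral comparison: Bernoulli's inequality at M/(M+1) bounds
    (M+1)^(q-1) by the increment of M^q / q. *)
Lemma sum_powRN (q : R) (M : nat) : 0 < q < 1 ->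
  \sum_(i < M) i.+1%:R `^ (q - 1) <= M%:R `^ q / q.
Proof.
move=> q01; have /andP[q0 q1] := q01.
elim: M => [|M IH]; first by rewrite big_ord0 divr_ge0 ?powR_ge0// ltW.
rewrite big_ord_recr/=; have M0 : 0 < M.+1%:R :> R by [].
have h1 : M.+1%:R `^ (q - 1) = M.+1%:R `^ q / M.+1%:R :> R.
  by rewrite powRD ?(gt_eqF M0) ?implybT// powRN powRr1.
have h2 : M%:R `^ q <= M.+1%:R `^ q * (1 - q / M.+1%:R) :> R.
  have t0 : 0 <= M%:R / M.+1%:R :> R by rewrite divr_ge0.
  have := powR_bernoulli t0 q01.
  have -> : 1 - q * (1 - M%:R / M.+1%:R) = 1 - q / M.+1%:R :> R.
    by rewrite -[in X in _ = X](natr1 M) -(natr1 M); field; rewrite natr1 pnatr_eq0.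
  have -> : M%:R `^ q = M.+1%:R `^ q * (M%:R / M.+1%:R) `^ q :> R.
    by rewrite -powRM// ?divr_ge0// mulrCA mulfV ?mulr1// gt_eqF.
  by rewrite ler_pM2l// powR_gt0.
have : M%:R `^ q / q <= M.+1%:R `^ q * (1 - q / M.+1%:R) / q.
  by rewrite ler_pM2r ?invr_gt0.
have -> : M.+1%:R `^ q * (1 - q / M.+1%:R) / q = M.+1%:R `^ q / q - M.+1%:R `^ q / M.+1%:R.
  by move: (M.+1%:R : R) M0 => N N0; field; rewrite !gt_eqF.
move: IH; rewrite h1; set S := \sum_(i < M) _.
by move: (M%:R `^ q / q : R) (M.+1%:R `^ q / q : R) (M.+1%:R `^ q / M.+1%:R : R) S => a b c S; lra.
Qed.

(** Truncated subtraction makes one summand vanish, so this is the absolute difference. *)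
Definition natdist (i j : nat) := ((i - j) + (j - i))%N.

(** The correlation factor of one coordinate at grid distance [r]; [maxn 1 r] covers coincident
    coordinates. *)
Definition grid_weight (m : nat) (g : R) (r : nat) : R := (m%:R / (maxn 1 r)%:R) `^ g.

(** As g < 1, the sum of r^(-g) for r up to m is of order m^(1 - g): the weights have a mean bounded
    independently of m. The 1 accounts for the distance 0, the 2 for the two sides of [l]. *)
Lemma sum_grid_weight (m l : nat) (g : R) : 0 < g < 1 -> (l < m)%N ->
  \sum_(i < m) grid_weight m g (natdist l i) <= (1 + 2 / (1 - g)) * m%:R.
Proof.
move=> /andP[g0 g1] lm; pose q := 1 - g.
have q01 : 0 < q < 1 by rewrite /q; apply/andP; split; lra.
have q0 : 0 < q by have /andP[] := q01.
have m0 : 0 < m%:R :> R by rewrite ltr0n; exact: leq_ltn_trans lm.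
have m1 : 1 <= m%:R :> R by rewrite ler1n; exact: leq_ltn_trans lm.
pose f (r : nat) : R := (maxn 1 r)%:R `^ (q - 1).
have wf r : grid_weight m g r = m%:R `^ g * f r.
  rewrite /grid_weight /f powRM// ?invr_ge0//; congr (_ * _).
  rewrite (_ : q - 1 = - g); last by rewrite /q; ring.
  by rewrite powRN -powR_inv1// -powRrM mulN1r powRN.
under eq_bigr do rewrite wf; rewrite -mulr_sumr.
have fB M : (M <= m)%N -> \sum_(0 <= i < M) f i.+1 <= m%:R `^ q / q.
  move=> Mm; rewrite big_mkord; apply: (@le_trans _ _ (M%:R `^ q / q)).
    by apply: le_trans (sum_powRN M q01); apply: ler_sum => i _; rewrite /f (maxn_idPr _).
  by rewrite ler_pM2r ?invr_gt0// ge0_ler_powR// ?nnegrE ?ler_nat// ltW.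
have fsum : \sum_(i < m) f (natdist l i) <= 1 + 2 * (m%:R `^ q / q).
  rewrite -(big_mkord xpredT (fun i => f (natdist l i))) (big_cat_nat (n := l.+1))//=.
  have -> : \sum_(0 <= i < l.+1) f (natdist l i) = f 0%N + \sum_(0 <= i < l) f i.+1.
    rewrite -big_nat_recl// [LHS]big_nat_rev/= add0n; apply: eq_big_nat => i /andP[_ il].
    rewrite /natdist subSS subKn//.
    by rewrite (eqP (_ : l - i - l == 0)%N) ?addn0// subn_eq0 leq_subr.
  have -> : \sum_(l.+1 <= i < m) f (natdist l i) = \sum_(0 <= i < m - l.+1) f i.+1.
    rewrite -[l.+1 in LHS]add0n big_addn; apply: eq_big_nat => i _.
    congr f; rewrite /natdist addnS -addSn addnK.
    by rewrite (eqP (_ : l - (i.+1 + l) == 0)%N)// subn_eq0 leq_addl.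
  have -> : f 0%N = 1 by rewrite /f maxn0 powR1.
  have := fB _ (ltnW lm); have := fB _ (leq_subr l.+1 m); lra.
have mq : m%:R = m%:R `^ g * m%:R `^ q :> R.
  by rewrite -powRD ?(gt_eqF m0) ?implybT// /q subrKC powRr1// ltW.
rewrite [in leRHS]mq mulrCA ler_pM2l ?powR_gt0//; apply: (le_trans fsum).
have mq1 : 1 <= m%:R `^ q :> R by rewrite -[leLHS](powRr0 m%:R) ler_powR// ltW.
have -> : (1 + 2 / (1 - g)) * m%:R `^ q = m%:R `^ q + 2 * (m%:R `^ q / q).
  by rewrite -/q; ring.
by rewrite lerD2r.
Qed.

Lemma sum_grid_prod (n m : nat) (g : R) (y : {ffun 'I_n -> 'I_m}) : 0 < g < 1 ->
  \sum_(z : {ffun 'I_n -> 'I_m}) \prod_j grid_weight m g (natdist (y j) (z j))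
  <= ((1 + 2 / (1 - g)) * m%:R) ^+ n.
Proof.
move=> g01; rewrite -(@bigA_distr_bigA R 0 1 _ _ 'I_n 'I_m (fun j i => grid_weight m g (natdist (y j) i))).
rewrite -[X in _ <= _ ^+ X]card_ord -prodr_const; apply: ler_prod => j _.
rewrite sum_grid_weight// ?andbT//.
by apply: sumr_ge0 => i _; exact: powR_ge0.
Qed.

(** One face of a cube is enough here: these directions have to be separated, not to cover the
    sphere. *)
Definition grid_point n m (y : {ffun 'I_n -> 'I_m}) : 'rV[R]_n.+1 :=
  \row_i if unlift ord0 i is Some j then (y j)%:R / m%:R else 1.

Definition grid_dir n m (y : {ffun 'I_n -> 'I_m}) := (enorm (grid_point y))^-1 *: grid_point y.

Lemma grid_point_norm n m (y : {ffun 'I_n -> 'I_m}) : 1 <= enorm (grid_point y) <= n.+1%:R.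
Proof.
apply/andP; split.
  by apply: le_trans (coord_le_enorm _ ord0); rewrite mxE unlift_none normr1.
apply: le_trans (enorm_le_norm _) _; rewrite ler_piMr//; apply: rV_norm_le => // i.
rewrite mxE; case: unliftP => [j _|_]; last by rewrite normr1.
have ym := ltn_ord (y j); have m0 : 0 < m%:R :> R by rewrite ltr0n; exact: leq_ltn_trans ym.
by rewrite ger0_norm ?divr_ge0// ler_pdivrMr// mul1r ler_nat ltnW.
Qed.

Lemma enorm_grid_dir n m (y : {ffun 'I_n -> 'I_m}) : enorm (grid_dir y) = 1.
Proof.
have /andP[y1 _] := grid_point_norm y.
rewrite enormZ ger0_norm ?invr_ge0 ?enorm_ge0// mulVf// gt_eqF//.
exact: lt_le_trans y1.
Qed.

(** With a and b the norms of the grid points, the first coordinate recovers 1/a - 1/b and the j-th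
    recovers s/a - t/b. Both are at most the distance of the directions, and s - t is a times a
    combination of them with a <= n+1. *)
Lemma grid_dir_sep n m (y z : {ffun 'I_n -> 'I_m}) j :
  (natdist (y j) (z j))%:R / m%:R <= 2 * n.+1%:R * enorm (grid_dir y - grid_dir z).
Proof.
have ym := ltn_ord (y j); have m0 : 0 < m%:R :> R by rewrite ltr0n; exact: leq_ltn_trans ym.
pose a := enorm (grid_point y); pose b := enorm (grid_point z).
have /andP[a1 an] := grid_point_norm y; have /andP[b1 bn] := grid_point_norm z.
have a0 : 0 < a by exact: lt_le_trans a1.
have b0 : 0 < b by exact: lt_le_trans b1.
pose s : R := (y j)%:R / m%:R; pose t : R := (z j)%:R / m%:R.
have t01 : 0 <= t <= 1.
  by rewrite divr_ge0//= ler_pdivrMr// mul1r ler_nat ltnW.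
set e := enorm _; have e0 : 0 <= e by exact: enorm_ge0.
have h1 : `|a^-1 - b^-1| <= e.
  by apply: le_trans (coord_le_enorm _ ord0); rewrite !mxE unlift_none !mulr1.
have h2 : `|s / a - t / b| <= e.
  apply: le_trans (coord_le_enorm _ (lift ord0 j)).
  by rewrite !mxE liftK mulrC [X in _ - X]mulrC.
have -> : (natdist (y j) (z j))%:R / m%:R = `|s - t|.
  rewrite /s /t -mulrBl normrM [`|m%:R^-1|]ger0_norm ?invr_ge0//; congr (_ / _).
  rewrite /natdist; have [yz|zy] := leqP (y j) (z j).
    by rewrite (eqP yz) add0n natrB// distrC ger0_norm// subr_ge0 ler_nat.
  by rewrite (eqP (ltnW zy)) addn0 natrB 1?ltnW// ger0_norm// subr_ge0 ler_nat ltnW.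
have -> : s - t = a * ((s / a - t / b) - t * (a^-1 - b^-1)).
  by field; rewrite !gt_eqF.
rewrite normrM (gtr0_norm a0).
have h3 : `|s / a - t / b - t * (a^-1 - b^-1)| <= 2 * e.
  apply: le_trans (ler_normB _ _) _; rewrite normrM.
  have /andP[t0 t1] := t01; rewrite (ger0_norm t0).
  have := ler_pM t0 (normr_ge0 _) t1 h1; lra.
apply: le_trans (ler_pM (ltW a0) (normr_ge0 _) an h3) _.
by rewrite mulrA [n.+1%:R * 2]mulrC.
Qed.

End grid_sums.

Section tangent_caps.
Context {R : realType} {d : nat}.

(** There is no upper cut on the height, because an empty cap has to constrain distant atoms too. *)
Definition tangent_cap (k delta : R) (u : 'rV[R]_d) : set 'rV[R]_d :=
  [set x | delta < enorm x ^+ 2 - 1 /\ 1 - k * (enorm x ^+ 2 - 1) < dotp x u].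

Lemma measurable_tangent_cap k delta u : measurable (tangent_cap k delta u).
Proof.
apply: measurable_and; first exact: measurable_shell.
apply: measurable_set_lt; last exact: measurable_dotpr.
by apply: measurable_funB => //; apply: measurable_funM => //; exact: measurable_enorm_sqr_sub.
Qed.

(** A point of height s in both caps satisfies |x - u|^2 < (1 + 2k) s and likewise for [v]; the
    triangle inequality does the rest. Distant directions therefore share only high atoms. *)
Lemma tangent_cap_overlap k delta (x u v : 'rV[R]_d) : 0 < k ->
  enorm u = 1 -> enorm v = 1 -> tangent_cap k delta u x -> tangent_cap k delta v x ->
  enorm (u - v) ^+ 2 < 4 * (1 + 2 * k) * (enorm x ^+ 2 - 1).
Proof.
move=> k0 u1 v1 [_ xu] [_ xv]; set s := enorm x ^+ 2 - 1 in xu xv *.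
have xuE : enorm (x - u) ^+ 2 = s + 2 - 2 * dotp x u.
  by rewrite enormB_sqr u1 expr1n -mulr_natl /s; ring.
have xvE : enorm (x - v) ^+ 2 = s + 2 - 2 * dotp x v.
  by rewrite enormB_sqr v1 expr1n -mulr_natl /s; ring.
have := enormB_triangle x u v; rewrite (enormBC u x) => tri.
have := enorm_ge0 (u - v); have := enorm_ge0 (x - u); have := enorm_ge0 (x - v).
move: tri xuE xvE.
move: (enorm (u - v)) (enorm (x - u)) (enorm (x - v)) => a b c abc bE cE c0 b0 a0.
have h1 : a ^+ 2 <= (b + c) ^+ 2 by rewrite ler_pXn2r ?nnegrE// addr_ge0.
have h2 := sqr_ge0 (b - c).
have -> : 4 * (1 + 2 * k) * s = 4 * s + 8 * (k * s) by ring.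
have h3 : (b + c) ^+ 2 + (b - c) ^+ 2 = 2 * b ^+ 2 + 2 * c ^+ 2 by ring.
by lra.
Qed.

(** The height of a fixed point of [A] is positive and exceeds c/(N+1) for all large N, so its
    constraint survives in the limit of the directions. *)
Lemma limit_direction (A : set 'rV[R]_d) (k c : R) :
  (forall x, A x -> 0 < enorm x ^+ 2 - 1) ->
  (forall N : nat, exists u, enorm u = 1 /\ forall x, A x ->
     c / N.+1%:R < enorm x ^+ 2 - 1 -> dotp x u <= 1 - k * (enorm x ^+ 2 - 1)) ->
  exists u, enorm u = 1 /\ forall x, A x -> dotp x u <= 1 - k * (enorm x ^+ 2 - 1).
Proof.
move=> A0 /choice[u uP].
have [U [UU ooU]] := @eventually_ultrafilter.
have UP : ProperFilter U by exact: ultra_proper.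
have /choice[l lP] (j : 'I_d) : exists l : R, u N 0 j @[N --> U] --> l.
  apply: (@bounded_ultralimit R U _ 1) => // N; apply: le_trans (coord_le_enorm _ _) _.
  by have [->] := uP N.
pose v : 'rV[R]_d := \row_j l j.
have dot_cvg (a : nat -> 'rV[R]_d) (b : 'rV[R]_d) : (forall j, a N 0 j @[N --> U] --> b 0 j) ->
    dotp (a N) (u N) @[N --> U] --> dotp b v.
  move=> ab; apply: (@cvg_big R^o 'I_d +%R 0 xpredT (@add_continuous R^o) nat U _
    (fun j N => a N 0 j * u N 0 j) (fun j => b 0 j * v 0 j)) => j _.
  by apply: cvgM; [exact: ab|rewrite mxE; exact: lP].
exists v; split.
  have h : dotp (u N) (u N) @[N --> U] --> dotp v v.
    by apply: dot_cvg => j; rewrite mxE; exact: lP.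
  rewrite enormE -(_ : 1 = dotp v v) ?sqrtr1//.
  have uE : (fun N => dotp (u N) (u N)) = (fun=> 1).
    by apply/funext => N; rewrite -enorm_sqr; have [->] := uP N; rewrite expr1n.
  rewrite uE in h.
  apply: (@cvg_unique R^o (@norm_hausdorff R R^o) ((1 : R) @[_ --> U])) => //.
  exact: cvg_cst.
move=> x Ax.
have h : dotp x (u N) @[N --> U] --> dotp x v.
  by apply: (dot_cvg (fun=> x)) => j; exact: cvg_cst.
apply: (@closed_cvg _ _ U UP (fun N => dotp x (u N)) [set y : R | y <= 1 - k * (enorm x ^+ 2 - 1)]) => //.
apply: ooU.
have x0 := A0 x Ax.
have [N0 N0x] : exists N0 : nat, N0.+1%:R^-1 * (`|c| + 1) < enorm x ^+ 2 - 1.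
  have c0 : 0 < `|c| + 1 by rewrite ltr_wpDl.
  have [N0 h0] := exists_natSinv_lt (divr_gt0 x0 c0).
  by exists N0; rewrite -ltr_pdivlMr.
exists N0 => // N /= N0N; have [_] := uP N; apply => //.
apply: le_lt_trans N0x; rewrite mulrC.
apply: (@le_trans _ _ (N.+1%:R^-1 * (`|c| + 1))).
  by rewrite ler_pM2l ?invr_gt0//; have := ler_norm c; lra.
by rewrite ler_pM2r ?ltr_wpDl// lef_pV2 ?posrE// ler_nat ltnS.
Qed.

End tangent_caps.

(** * Tangency with positive probability *)

Section part_two.
Context {R : realType} {n : nat} {dO : measure_display} {Omega : measurableType dO}.
Variables (P : probability Omega R) (alpha beta : R).
Variable zeta : Omega -> {measure set 'rV[R]_n.+1 -> \bar R}.
Hypothesis Pzeta : beta_star_process alpha beta P zeta.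
Hypothesis n0 : (0 < n)%N.
Hypothesis alpha0 : 0 < alpha.
Hypothesis beta0 : n.+1%:R / 2 < beta.

(** Almost surely, all rational balls of infinite intensity contain atoms, since there are countably
    many of them. Every neighbourhood of a point of the sphere contains such a ball. *)
Lemma unit_ball_sub_beta_star :
  {ae P, forall w, [set z | enorm z <= 1] `<=` beta_star_set (zeta w)}.
Proof.
have n1 : 1 <= n%:R :> R by rewrite ler1n.
have beta1 : 1 <= beta by move: beta0; rewrite -natr1; lra.
pose S : set 'rV[R]_n.+1 := [set x | 0 < enorm x ^+ 2 - 1].
pose B (t : 'rV[rat]_n.+1 * nat) := ball (rV_ratr t.1 : 'rV[R]_n.+1) t.2.+1%:R^-1 `&` S.
have mB t : measurable (B t).
  apply: measurableI; last exact: measurable_shell.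
  by apply: open_measurable_rV; exact: rV_ball_open.
have Bae t : beta_star_intensity alpha beta (B t) = +oo%E -> {ae P, forall w, zeta w (B t) = +oo%E}.
  move=> Boo; have [_ _ _ Poo _] := Pzeta.
  have mF : measurable [set w | zeta w (B t) = +oo%E] by exact: (measurable_count Pzeta).
  exists (~` [set w | zeta w (B t) = +oo%E]); split=> //; first exact: measurableC.
  have BX : B t `<=` ~` closure unit_ball.
    by rewrite beta_star_state_space => x [_]; rewrite /S/= enorm_sqr_sub1_gt0.
  have := Poo (B t) (mB t) BX Boo.
  by move=> h; rewrite probability_setC// h subee.
(* The almost sure statements are combined over the naturals, so pairs of a rational centre and a
   radius index are enumerated by [unpickle]. *)
have hae : {ae P, forall w, forall j : nat, forall t, unpickle j = Some t ->
    beta_star_intensity alpha beta (B t) = +oo%E -> zeta w (B t) = +oo%E}.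
  apply: ae_foralln => j; case: (unpickle j) => [t|]; last by apply: aeW.
  have [Boo|nBoo] := pselect (beta_star_intensity alpha beta (B t) = +oo%E).
    by apply: filterS (Bae t Boo) => w h _ [<-].
  by apply: aeW => w _ [<-].
apply: filterS hae => w hw; apply: ball_sub_of_sphere => // p e p1 e0.
pose D : R := n.+1%:R; have D0 : 0 < D by [].
(* The atom found is within 2/(k+1) of [p] in the sup norm, and [D] converts this to the Euclidean
   norm. *)
have [k ke] := exists_natSinv_lt (divr_gt0 e0 (mulr_gt0 (ltr0Sn R 1) D0)).
have k0 : 0 < k.+1%:R^-1 :> R by rewrite invr_gt0.
have [q pq] := rV_ratr_ball p (divr_gt0 k0 (ltr0Sn R 1)).
have Boo : beta_star_intensity alpha beta (B (q, k)) = +oo%E.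
  apply/eqP; rewrite -leye_eq.
  have k20 : 0 < k.+1%:R^-1 / 2 :> R by rewrite divr_gt0.
  rewrite -(beta_star_intensity_sphere alpha0 beta0 beta1 p1 k20).
  have Esub : [set x : 'rV[R]_n.+1 | 1 < enorm x /\ enorm (x - p) < k.+1%:R^-1 / 2] `<=` B (q, k).
    move=> x /= [x1 xp]; split; last by rewrite /S/= enorm_sqr_sub1_gt0.
    rewrite rV_ball_norm/= -[rV_ratr q](subrK p) -addrA; apply: le_lt_trans (ler_normD _ _) _.
    rewrite [ltRHS]splitr; apply: ltrD; first by rewrite -rV_ball_norm.
    by rewrite distrC; apply: le_lt_trans (norm_le_enorm _) xp.
  apply: le_beta_star_intensity => //.
  apply: measurable_and; first by apply: measurable_set_lt => //; exact: measurable_enorm.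
  apply: open_measurable_rV.
  have /closed_openC := @closed_le_fun R n.+1 (fun=> k.+1%:R^-1 / 2) (fun x => enorm (x - p))
    (@cst_continuous _ _ _) (@enormB_continuous _ _ p).
  rewrite (_ : ~` _ = [set x | enorm (x - p) < k.+1%:R^-1 / 2])//.
  by apply/seteqP; split=> x /=; rewrite ltNge => /negP.
have zB : zeta w (B (q, k)) = +oo%E by apply: (hw (pickle (q, k))) => //; rewrite pickleK.
have [x zx [xq _]] : exists2 x, atoms (zeta w) x & B (q, k) x.
  by apply: (nonvoid_atom Pzeta) => //; rewrite zB.
exists x => //.
move: pq xq; rewrite !rV_ball_norm/= => pq qx.
apply: le_lt_trans (enorm_le_norm _) _; rewrite -/D.
have : `|x - p| < k.+1%:R^-1 + k.+1%:R^-1.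
  rewrite -[x](subrK (rV_ratr q)) -addrA; apply: le_lt_trans (ler_normD _ _) _.
  apply: ltrD; first by rewrite distrC.
  by apply: lt_le_trans pq _; rewrite ler_pdivrMr// ler_peMr ?(ltW k0)// ler1n.
move: ke; rewrite ltr_pdivlMr ?mulr_gt0//.
move: (k.+1%:R^-1 : R) k0 => i i0 ke h.
by have := ltr_pM2l D0 `|x - p| (i + i); rewrite h => h'; move: h'; rewrite mulrDr; lra.
Qed.

Hypothesis cond : beta < n%:R / 2 + 1 \/ beta = n%:R / 2 + 1 /\ alpha < n%:R * pi.

Let Lam := @beta_star_intensity R n.+1 alpha beta.

(** Writing the coefficient as (n/2) g lets the correlation split into n coordinate factors of
    exponent [g], each summable as g < 1. The maximum with 1/2 keeps [g] positive when the
    coefficient is 0. *)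
Lemma tangent_cap_bound : exists k g C : R, [/\ 0 < k, 0 < g < 1 &
  forall delta (u : 'rV[R]_n.+1), 0 < delta < 1 -> enorm u = 1 ->
  (Lam (tangent_cap k delta u) <= (n%:R / 2 * g * ln delta^-1 + C)%:E)%E].
Proof.
have [k [a [C [k0 /andP[a0 an] cap]]]] := cap_intensity_upper n0 alpha0 beta0 cond.
have nR : 0 < n%:R / 2 :> R by rewrite divr_gt0// ltr0n.
pose g := Num.max (a / (n%:R / 2)) (1 / 2).
exists k, g, C; split=> // [|delta u d01 u1].
  rewrite lt_max gt_max; apply/andP; split; first by apply/orP; right; lra.
  by apply/andP; split; [rewrite ltr_pdivrMr// mul1r|lra].
apply: le_trans (cap delta u d01 u1) _; rewrite lee_fin lerD2r.
have /andP[d0 d1] := d01.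
apply: ler_wpM2r; first by rewrite ln_ge0// -invr1 lef_pV2 ?posrE// ltW.
by rewrite mulrC -ler_pdivrMr// le_max lexx.
Qed.

(* Grid directions [u_y], [u_z] at grid distance [r] share only atoms at height
   at least [c (r / m) ^ 2], which bounds the correlation of the two void events. *)
Lemma tangent_cap_void_prob : exists k c K : R, [/\ 0 < k, 0 < c < 1, 0 < K &
  forall m : nat, exists E : set Omega, [/\ measurable E, (K^-1%:E <= P E)%E &
    forall w, E w -> exists u : 'rV[R]_n.+1, enorm u = 1 /\
      forall x, atoms (zeta w) x -> c / m.+1%:R ^+ 2 < enorm x ^+ 2 - 1 ->
        dotp x u <= 1 - k * (enorm x ^+ 2 - 1)]].
Proof.
have [k [g [C [k0 g01 cap]]]] := tangent_cap_bound.
have /andP[g0 g1] := g01.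
have k12 : 1 < 1 + 2 * k by rewrite ltrDl mulr_gt0.
have N1 : 1 <= n.+1%:R :> R by rewrite ler1n.
(* The product of (2 (n+1))^2 from [grid_dir_sep] and 4 (1 + 2k) from [tangent_cap_overlap]. *)
pose D : R := 16 * n.+1%:R ^+ 2 * (1 + 2 * k).
have D1 : 1 < D.
  have : 1 <= n.+1%:R ^+ 2 :> R by rewrite exprn_ege1.
  by rewrite /D => h; nra.
have D0 : 0 < D by exact: lt_trans D1.
pose c := D^-1.
have c0 : 0 < c by rewrite invr_gt0.
have c1 : c < 1 by rewrite invf_lt1.
pose B := 1 + 2 / (1 - g).
have B0 : 0 < B by rewrite addr_gt0// divr_gt0// subr_gt0.
(* The shared intensity is evaluated at height c q^2; [K1] collects the additive constant and the
   part due to [c]. *)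
pose K1 := expR (C - n%:R / 2 * g * ln c).
pose K := K1 * B ^+ n.
have K0 : 0 < K by rewrite mulr_gt0 ?expR_gt0 ?exprn_gt0.
exists k, c, K; split=> // [|m]; first by rewrite c0.
have m0 : 0 < m.+1%:R :> R by [].
pose M : R := m.+1%:R.
pose delta := c / M ^+ 2.
have delta01 : 0 < delta < 1.
  rewrite divr_gt0 ?exprn_gt0//= ltr_pdivrMr ?exprn_gt0// mul1r.
  by apply: (lt_le_trans c1); rewrite exprn_ege1// ler1n.
have /andP[delta0 delta1] := delta01.
pose T := {ffun 'I_n -> 'I_m.+1}.
pose u (y : T) : 'rV[R]_n.+1 := grid_dir y.
have u1 y : enorm (u y) = 1 by exact: enorm_grid_dir.
pose A y := tangent_cap k delta (u y).
have mA y : measurable (A y) by exact: measurable_tangent_cap.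
have AX y : A y `<=` [set x | 0 < enorm x ^+ 2 - 1].
  by move=> x [/= dx _]; exact: lt_trans dx.
have Aoo D' : measurable D' -> D' `<=` [set x | delta < enorm x ^+ 2 - 1] -> (Lam D' < +oo)%E.
  move=> mD' Dd; apply: le_lt_trans (beta_star_intensity_shell alpha0 beta0 delta0).
  by apply: le_beta_star_intensity => //; exact: measurable_shell.
have Ad y : A y `<=` [set x | delta < enorm x ^+ 2 - 1] by move=> x [].
pose V y := [set w | zeta w (A y) = 0%E].
have mV y : measurable (V y) by exact: (measurable_count Pzeta).
pose p y := expR (- fine (Lam (A y))).
have pV y : P (V y) = (p y)%:E.
  by rewrite (beta_star_void Pzeta alpha0 beta0)//; apply: Aoo.
pose r (y z : T) := K1 * \prod_j grid_weight m.+1 g (natdist (y j) (z j)).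
have r0 y z : 0 < r y z.
  rewrite mulr_gt0 ?expR_gt0// prodr_gt0// => j _; rewrite powR_gt0// divr_gt0.
have AIcap y z : fine (Lam (A y `&` A z)) <= ln (r y z).
  pose dj j := natdist (y j) (z j).
  (* The coordinate with the largest grid distance gives the best lower bound on the height of
     shared atoms. *)
  have [j0 _ jmax] := @arg_maxnP _ (Ordinal n0) xpredT dj isT.
  pose q : R := (maxn 1 (dj j0))%:R / M.
  have q0 : 0 < q by rewrite divr_gt0// ltr0n leq_max.
  have natdist_lt j : (dj j <= m)%N.
    have := ltn_ord (y j); have := ltn_ord (z j); rewrite /dj /natdist !ltnS => zm ym.
    have [yz|zy] := leqP (y j) (z j).
      by rewrite (eqP yz) add0n; apply: leq_trans (leq_subr _ _) zm.
    by rewrite (eqP (ltnW zy)) addn0; apply: leq_trans (leq_subr _ _) ym.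
  have q1 : q <= 1.
    by rewrite ler_pdivrMr// mul1r ler_nat geq_max/= ltnW// ltnS.
  pose d' := c * q ^+ 2.
  have d'01 : 0 < d' < 1.
    rewrite mulr_gt0 ?exprn_gt0//=; apply: le_lt_trans c1.
    by rewrite ler_piMr ?(ltW c0)// expr_le1// ltW.
  have sub : A y `&` A z `<=` tangent_cap k d' (u y).
    move=> x [Ay Az]; have [/= dx xu] := Ay; split=> //.
    (* If all coordinates agree, d' is delta itself and nothing is to be shown about separation. *)
    have [dj0|djp] := posnP (dj j0).
      move: dx; rewrite /delta /d' /q dj0 maxn0.
      by rewrite mul1r exprVn.
    rewrite /d' /q (maxn_idPr djp).
    have := grid_dir_sep y z j0; rewrite -/(dj j0) -/M -/(u y) -/(u z) => sep.
    have ov := tangent_cap_overlap k0 (u1 y) (u1 z) Ay Az.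
    have h1 : ((dj j0)%:R / M) ^+ 2 <= (2 * n.+1%:R * enorm (u y - u z)) ^+ 2.
      by rewrite ler_pXn2r// ?nnegrE ?divr_ge0 ?mulr_ge0 ?enorm_ge0// ltW.
    rewrite /c mulrC ltr_pdivrMr//; apply: (le_lt_trans h1).
    have N2 : 0 < 4 * n.+1%:R ^+ 2 :> R by rewrite mulr_gt0// exprn_gt0.
    have -> : (2 * n.+1%:R * enorm (u y - u z)) ^+ 2 =
      4 * n.+1%:R ^+ 2 * enorm (u y - u z) ^+ 2 by ring.
    have -> : (enorm x ^+ 2 - 1) * D =
      4 * n.+1%:R ^+ 2 * (4 * (1 + 2 * k) * (enorm x ^+ 2 - 1)) by rewrite /D; ring.
    by rewrite ltr_pM2l.
  have mAI : measurable (A y `&` A z) by exact: measurableI.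
  have h1 : (Lam (A y `&` A z) <= (n%:R / 2 * g * ln d'^-1 + C)%:E)%E.
    apply: le_trans (cap d' (u y) d'01 (u1 y)).
    by apply: le_beta_star_intensity => //; exact: measurable_tangent_cap.
  apply: (@le_trans _ _ (n%:R / 2 * g * ln d'^-1 + C)).
    rewrite -lee_fin fineK// ge0_fin_numE; last exact: beta_star_intensity_ge0.
    by apply: le_lt_trans h1 _; rewrite ltry.
  have pr0 : 0 < \prod_j grid_weight m.+1 g (dj j).
    by rewrite prodr_gt0// => j _; rewrite powR_gt0// divr_gt0// ltr0n leq_max.
  rewrite /r lnM ?posrE ?expR_gt0// expRK.
  have qi0 : 0 < q^-1 `^ g by rewrite powR_gt0// invr_gt0.
  (* The factor at the maximal distance is the smallest, so its n-th power is below the product of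
     all factors. In product form the sum over the grid factorises. *)
  have h2 : (q^-1 `^ g) ^+ n <= \prod_j grid_weight m.+1 g (dj j).
    rewrite -[X in _ ^+ X]card_ord -prodr_const; apply: ler_prod => j _.
    rewrite (ltW qi0)/=; apply: ge0_ler_powR; rewrite ?nnegrE ?invr_ge0 ?divr_ge0 ?(ltW g0) ?(ltW q0)//.
    rewrite /q invf_div ler_pM2l// lef_pV2 ?posrE ?ltr0n ?leq_max// ler_nat.
    have jm : (dj j <= dj j0)%N := jmax j isT.
    by rewrite geq_max !leq_max jm orbT.
  have h3 : ln ((q^-1 `^ g) ^+ n) <= ln (\prod_j grid_weight m.+1 g (dj j)).
    by rewrite ler_ln ?posrE// exprn_gt0.
  move: h3; rewrite lnXn// ln_powR lnV ?posrE// => h3.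
  have -> : ln d'^-1 = - (ln c + 2 * ln q).
    have dV : ln d'^-1 = - ln d' by apply: lnV; rewrite posrE; have /andP[] := d'01.
    have dM : ln d' = ln c + ln (q ^+ 2) by apply: lnM; rewrite posrE ?exprn_gt0.
    by rewrite dV dM lnXn// mulr_natl.
  by move: h3; rewrite -mulr_natl; lra.
have VV y z : (P (V y `&` V z) <= (p y * p z * r y z)%:E)%E.
  have mAU : measurable (A y `|` A z) by exact: measurableU.
  have mAI : measurable (A y `&` A z) by exact: measurableI.
  have AUd : A y `|` A z `<=` [set x | delta < enorm x ^+ 2 - 1].
    by move=> x [/Ad|/Ad].
  have AId : A y `&` A z `<=` [set x | delta < enorm x ^+ 2 - 1] by move=> x [/Ad].
  apply: (@le_trans _ _ (P [set w | zeta w (A y `|` A z) = 0%E])).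
    apply: le_measure; rewrite ?inE; first exact: measurableI.
      exact: (measurable_count Pzeta).
    move=> w [/= Vy Vz]; apply/eqP; rewrite eq_le measure_ge0 andbT.
    have h : (zeta w (A y `|` A z) <= zeta w (A y) + zeta w (A z))%E :=
      measureU2 (zeta w) (mA y) (mA z).
    by apply: (le_trans h); rewrite Vy Vz adde0.
  rewrite (beta_star_void Pzeta alpha0 beta0)//; last 2 first.
  - by move=> x /AUd/=; exact: lt_trans.
  - exact: Aoo.
  rewrite -/Lam lee_fin -[r y z]lnK ?posrE// -!expRD ler_expR.
  have := beta_star_intensityUI alpha0 beta0 (mA y) (mA z); rewrite -/Lam.
  have fL D' : measurable D' -> D' `<=` [set x | delta < enorm x ^+ 2 - 1] ->
      Lam D' = (fine (Lam D'))%:E.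
    by move=> mD' D'd; rewrite fineK// ge0_fin_numE ?Aoo// beta_star_intensity_ge0.
  rewrite (fL _ mAU AUd) (fL _ mAI AId) (fL _ (mA y) (@Ad y)) (fL _ (mA z) (@Ad z)).
  rewrite -!EFinD => -[h].
  have -> : fine (Lam (A y `|` A z)) =
      fine (Lam (A y)) + fine (Lam (A z)) - fine (Lam (A y `&` A z)) by rewrite -h addrK.
  by rewrite opprB opprD addrC lerD2l.
exists (\bigcup_y V y); split.
- by have [] := measure_finite_union P mV.
- apply: (second_moment (p := p) (r := r)) => //.
  + by move=> y; exact: expR_gt0.
  + by rewrite card_ffun !card_ord expn_gt0.
  + rewrite [X in K * X]expr2 mulrA.
    apply: (@le_trans _ _ (\sum_(y : T) K1 * (B * M) ^+ n)).
      apply: ler_sum => y _; rewrite -mulr_sumr ler_wpM2l ?expR_ge0//.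
      exact: sum_grid_prod.
    rewrite sumr_const -[leLHS]mulr_natr ler_pM2r ?ltr0n ?card_ffun ?card_ord ?expn_gt0//.
    by rewrite exprMn mulrA natrX.
- move=> w [y _ Vy]; exists (u y); split=> // x zx dx; rewrite leNgt; apply/negP => xu.
  by apply: (void_atoms Pzeta (mA y) Vy zx).
Qed.

(** Every outcome of the upper limit of the void events has the tangency property, except on the
    null set where the hull misses part of the unit ball. *)
Lemma beta_star_tangent_pos :
  (0 < P [set w | ~ polytope (beta_star_set (zeta w)) /\
                  ball_radius (beta_star_set (zeta w)) = 1])%E.
Proof.
set T := mkset _.
have [k [c [K [k0 /andP[c0 c1] K0 /choice[G GP]]]]] := tangent_cap_void_prob.
have mG m : measurable (G m) by have [] := GP m.
have PG m : (K^-1%:E <= P (G m))%E by have [] := GP m.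
have PL := limsup_ge mG PG.
have mL : measurable (lim_sup_set G).
  by apply: bigcapT_measurable => i; apply: bigcup_measurable.
have mT : measurable T.
  exact: (measurable_tangent (beta_star_process_points Pzeta) (beta_star_process_measurable Pzeta)).
have [N [mN PN Nsub]] := unit_ball_sub_beta_star.
have LTN : lim_sup_set G `<=` T `|` N.
  move=> w Lw; have [Nw|nN] := pselect (N w); [by right|left].
  have ballK : [set z | enorm z <= 1] `<=` beta_star_set (zeta w).
    by apply: contrapT => h; apply: nN; exact: Nsub.
  have [x zx|M|u [u1 uA]] := @limit_direction R n.+1 (atoms (zeta w)) k c.
  - exact: (atoms_outside Pzeta zx).
  (* Any m >= M at which the void event occurs will do, since c/(m+1)^2 <= c/(M+1). *)
  - have [m /= Mm Gm] := Lw M Logic.I; have [_ _ /(_ w Gm)[u [u1 ux]]] := GP m.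
    exists u; split=> // x zx cx; apply: ux => //; apply: le_lt_trans cx.
    rewrite ler_pM2l// lef_pV2 ?posrE ?exprn_gt0//.
    apply: (@le_trans _ _ m.+1%:R); first by rewrite ler_nat.
    by rewrite expr2 ler_peMr// ler1n.
  apply: (not_polytope_tangent _ u1 k0 ballK) => // x zx; split.
    by apply: ltW; exact: (atoms_outside Pzeta zx).
  exact: uA.
have PTN : (P (T `|` N) <= P T + P N)%E := measureU2 P mT mN.
have {}PL : (K^-1%:E <= P T)%E.
  apply: (le_trans PL); rewrite PN adde0 in PTN; apply: le_trans PTN.
  by apply: le_measure; rewrite ?inE//; exact: measurableU.
by apply: lt_le_trans PL; rewrite lte_fin invr_gt0.
Qed.

End part_two.

Theorem theorem2p4 (R : realType) (d : nat) (alpha beta : R)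
    (dO : measure_display) (Omega : measurableType dO) (P : probability Omega R)
    (zeta : Omega -> {measure set 'rV[R]_d -> \bar R}) :
  (2 <= d)%N -> 0 < alpha -> d%:R / 2 < beta ->
  beta_star_process alpha beta P zeta ->
  ((d%:R + 1) / 2 < beta \/
     (beta = (d%:R + 1) / 2 /\ (d%:R - 1) * pi < alpha) ->
   {ae P, forall w,
     [/\ polytope (beta_star_set (zeta w)),
         has_dim (beta_star_set (zeta w)) d &
         (1 < ball_radius (beta_star_set (zeta w)))%E]}) /\
  (beta < (d%:R + 1) / 2 \/
     (beta = (d%:R + 1) / 2 /\ alpha < (d%:R - 1) * pi) ->
   (0 < P [set w | ~ polytope (beta_star_set (zeta w)) /\
                   ball_radius (beta_star_set (zeta w)) = 1])%E).
Proof.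
case: d zeta => [//|n] zeta n1 a0 b0 Pz.
have n0 : (0 < n)%N by [].
have -> : (n.+1%:R + 1) / 2 = n%:R / 2 + 1 :> R by rewrite -natr1; field.
have -> : n.+1%:R - 1 = n%:R :> R by rewrite -natr1 addrK.
split; first exact: (beta_star_ae_polytope Pz n0 a0 b0).
exact: (beta_star_tangent_pos Pz n0 a0 b0).
Qed.
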